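(* Let $X\in\mathbb{R}^d$ be elliptically symmetric and absolutely continuously distributed with $\mathbb{E}\|X\|^2<\infty$, mean $\mu_0$ and nonsingular covariance $\Sigma_0$; let $X_1,X_2,\dots$ be i.i.d. copies with law $P$, $\bar X_n$ and $\widehat\Sigma_n=n^{-1}\sum_{i=1}^n(X_i-\bar X_n)(X_i-\bar X_n)^\top$ the empirical mean and covariance, $\eta_0=(\Sigma_0^{-1/2},\mu_0)$, $\widehat\eta_n=(\widehat\Sigma_n^{-1/2},\bar X_n)$ (well defined a.s. for $n\ge d+1$). Then, with $\mathbb{G}_n f=\sqrt n(\mathbb{P}_n-P)f$, $$\sup_{\theta\in\Theta}\big|\mathbb{G}_n(f_{\theta,\widehat\eta_n}-f_{\theta,\eta_0})\big|\to0\quad\text{in probability as }n\to\infty.$$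
   Context: $X$ is elliptically symmetric if $X=\mu_0+\Sigma_0^{1/2}Y$ with $Y$ spherically symmetric (invariant in distribution under all orthogonal transformations). $\Theta=\mathcal{S}_{d-1}\times\mathcal{S}_{d-1}\times\mathbb{R}$ with $\mathcal{S}_{d-1}$ the Euclidean unit sphere. For $\theta=(u,v,c)\in\Theta$ and $\eta=(A,\mu)$ with $A$ a positive definite $d\times d$ matrix and $\mu\in\mathbb{R}^d$, $$f_{\theta,\eta}(x)=(v-(v^\top u)u)^\top A(x-\mu)\,\mathbf{1}_{\{u^\top A(x-\mu)\ge c\}}.$$ $\mathbb{P}_n$ is the empirical measure; $Pf_{\widehat\eta_n}$ means $\int f_{\widehat\eta_n}\,dP$ with $\widehat\eta_n$ held fixed. *)

(* Defs.v *)
From HB Require Import structures.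
From mathcomp Require Import all_boot all_order all_algebra.
From mathcomp Require Import all_classical all_reals all_analysis.
Set Implicit Arguments. Unset Strict Implicit. Unset Printing Implicit Defensive.
Import Order.TTheory GRing.Theory Num.Theory.
Import numFieldNormedType.Exports.
Local Open Scope classical_set_scope.
Local Open Scope ring_scope.

Section Defs.
Variables (R : realType) (d : nat).

Definition borelRd (B : set 'cV[R]_d) : Prop :=
  <<s [set: 'cV[R]_d], [set U : set 'cV[R]_d | open U] >> B.

Definition psdmx (A : 'M[R]_d) : Prop :=
  A^T = A /\ forall x : 'cV[R]_d, 0 <= (x^T *m A *m x) 0 0.

(* The positive semidefinite square root A^{1/2} (unique when it exists);
   0 when A has no psd square root (never used in that case). *)
Definition sqrtmx (A : 'M[R]_d) : 'M[R]_d :=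
  match pselect (exists B : 'M[R]_d, psdmx B /\ B *m B = A) with
  | left h => proj1_sig (cid h)
  | right _ => 0
  end.

Definition invsqrtmx (A : 'M[R]_d) : 'M[R]_d := invmx (sqrtmx A).

Definition sqnorm (x : 'cV[R]_d) : R := \sum_(k < d) (x k 0) ^+ 2.
Definition unit_sphere : set 'cV[R]_d := [set u | sqnorm u = 1].

Definition orthogonalmx (Q : 'M[R]_d) : Prop := Q^T *m Q = 1%:M.

Definition box (a b : 'cV[R]_d) : set 'cV[R]_d :=
  [set x | forall k : 'I_d, a k 0 <= x k 0 <= b k 0].
Definition box_vol (a b : 'cV[R]_d) : R :=
  \prod_(k < d) Num.max 0 (b k 0 - a k 0).
Definition lebesgue_null (B : set 'cV[R]_d) : Prop :=
  forall eps : R, 0 < eps -> exists a b : nat -> 'cV[R]_d,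
    B `<=` \bigcup_n box (a n) (b n) /\
    (\sum_(0 <= n <oo) (box_vol (a n) (b n))%:E < eps%:E)%E.

Variables (dd : measure_display) (Omega : measurableType dd)
  (Pr : probability Omega R).

Definition random_vector (X : Omega -> 'cV[R]_d) : Prop :=
  forall B, borelRd B -> measurable (X @^-1` B).

Definition same_law (X Y : Omega -> 'cV[R]_d) : Prop :=
  forall B, borelRd B -> Pr (X @^-1` B) = Pr (Y @^-1` B).

Definition spherically_symmetric (Y : Omega -> 'cV[R]_d) : Prop :=
  forall Q : 'M[R]_d, orthogonalmx Q -> same_law (fun w => Q *m Y w) Y.

Definition elliptically_symmetric (X : Omega -> 'cV[R]_d) : Prop :=
  exists (mu : 'cV[R]_d) (Sigma : 'M[R]_d) (Y : Omega -> 'cV[R]_d),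
    psdmx Sigma /\ random_vector Y /\ spherically_symmetric Y /\
    forall w, X w = mu + sqrtmx Sigma *m Y w.

Definition abs_continuous (X : Omega -> 'cV[R]_d) : Prop :=
  forall B, borelRd B -> lebesgue_null B -> Pr (X @^-1` B) = 0%E.

Definition finite_second_moment (X : Omega -> 'cV[R]_d) : Prop :=
  (\int[Pr]_w (sqnorm (X w))%:E < +oo)%E.

Definition has_mean (X : Omega -> 'cV[R]_d) (mu : 'cV[R]_d) : Prop :=
  forall k : 'I_d, (\int[Pr]_w (X w k 0)%:E = (mu k 0)%:E)%E.

Definition has_covariance (X : Omega -> 'cV[R]_d) (mu : 'cV[R]_d)
  (Sigma : 'M[R]_d) : Prop :=
  forall k l : 'I_d,
    (\int[Pr]_w ((X w k 0 - mu k 0) * (X w l 0 - mu l 0))%:E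
      = (Sigma k l)%:E)%E.

Definition mutually_independent (Xs : nat -> Omega -> 'cV[R]_d) : Prop :=
  forall (I : seq nat) (B : nat -> set 'cV[R]_d), uniq I ->
    (forall i, borelRd (B i)) ->
    Pr (\bigcap_(i in [set i | i \in I]) (Xs i @^-1` B i))
      = (\prod_(i <- I) Pr (Xs i @^-1` B i))%E.

(* X_1, X_2, ... (indexed here from 0) are i.i.d. copies of X *)
Definition iid_copies (Xs : nat -> Omega -> 'cV[R]_d) (X : Omega -> 'cV[R]_d)
  : Prop :=
  (forall i, random_vector (Xs i)) /\ (forall i, same_law (Xs i) X) /\
  mutually_independent Xs.

Definition emp_mean (Xs : nat -> Omega -> 'cV[R]_d) (n : nat) (w : Omega)
  : 'cV[R]_d := (n%:R)^-1 *: \sum_(i < n) Xs i w.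
Definition emp_cov (Xs : nat -> Omega -> 'cV[R]_d) (n : nat) (w : Omega)
  : 'M[R]_d :=
  (n%:R)^-1 *: \sum_(i < n)
     ((Xs i w - emp_mean Xs n w) *m (Xs i w - emp_mean Xs n w)^T).

Definition ftheta (u v : 'cV[R]_d) (c : R) (A : 'M[R]_d) (mu : 'cV[R]_d)
  (x : 'cV[R]_d) : R :=
  ((v - (v^T *m u) 0 0 *: u)^T *m A *m (x - mu)) 0 0 *
  (if c <= (u^T *m A *m (x - mu)) 0 0 then 1 else 0).

Definition Theta : set ('cV[R]_d * 'cV[R]_d * R) :=
  [set uvc | unit_sphere uvc.1.1 /\ unit_sphere uvc.1.2].

(* G_n (f_{theta, eta_hat_n} - f_{theta, eta_0}) evaluated at outcome w,
   where P is the law of X and eta_hat_n = eta_hat_n(w) is held fixed in Pf *)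
Definition Gn_diff (X : Omega -> 'cV[R]_d) (Xs : nat -> Omega -> 'cV[R]_d)
  (mu0 : 'cV[R]_d) (Sigma0 : 'M[R]_d) (n : nat) (u v : 'cV[R]_d) (c : R)
  (w : Omega) : R :=
  let Ahat := invsqrtmx (emp_cov Xs n w) in
  let muhat := emp_mean Xs n w in
  let A0 := invsqrtmx Sigma0 in
  let g := fun x => ftheta u v c Ahat muhat x - ftheta u v c A0 mu0 x in
  Num.sqrt (n%:R) *
    ((n%:R)^-1 * (\sum_(i < n) g (Xs i w)) - Rintegral Pr setT (fun w' => g (X w'))).

Definition sup_Gn_diff X Xs mu0 Sigma0 n (w : Omega) : \bar R :=
  ereal_sup [set (`|Gn_diff X Xs mu0 Sigma0 n uvc.1.1 uvc.1.2 uvc.2 w|)%:E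
            | uvc in Theta].

Definition outer_prob (A : set Omega) : \bar R :=
  ereal_inf [set Pr B | B in [set B | measurable B /\ A `<=` B]].

Definition cvg_in_prob_0 (Z : nat -> Omega -> \bar R) : Prop :=
  forall eps : R, 0 < eps ->
    (fun n => outer_prob [set w | (eps%:E < Z n w)%E]) @ \oo --> 0%E.

End Defs.

(* Main.v *)
(* In the features (x_1, ..., x_d, 1), f_{theta,eta} is an affine form times the
   indicator of a halfspace, so f_{theta,eta_hat} - f_{theta,eta_0} is a sum of terms
   (b_hat - b_0)_k phi_k 1_{H_hat} and b_{0,k} phi_k (1_{H_hat} - 1_{H_0}).  The
   coefficients are bounded and converge uniformly in theta, because eta_hat_n is
   consistent (weak law of large numbers and continuity of S |-> S^{-1/2}).  It
   remains to see that, for w in L^2, the process p |-> G_n (w 1_{H_p}) is tight and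
   asymptotically equicontinuous.

   Symmetrization by a second sample turns G_n into a Rademacher sum.  Given the
   sample, the weights w(X_i)^2 / sum_j w(X_j)^2 form a probability on the sample
   points, for which the traces of halfspaces have polynomial covering numbers
   (Pajor's and Dudley's lemmas); chaining then bounds all increments between
   halfspaces with a small weighted symmetric difference.  The law of large numbers
   for w^2 1_S gives this smallness at once for every pair of halfspaces whose
   difference lies in S, so finitely many small sets S must contain all the symmetric
   differences of H_hat and H_0.  These differences lie in strips around the
   hyperplanes bounding H_0; the strips are covered by finitely many thicker ones by
   compactness of the sphere, and a thin strip is small because absolute continuity
   makes hyperplanes null.

   Suprema over halfspaces are reduced to rational coefficients, to keep events
   measurable. *)

Require Import Defs.
From HB Require Import structures.
From mathcomp Require Import all_boot all_order all_algebra.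
From mathcomp Require Import all_classical all_reals all_analysis.
From mathcomp Require Import measurable_realfun random_variable simple_functions.
From mathcomp Require Import lra ring zify.
Set Implicit Arguments. Unset Strict Implicit. Unset Printing Implicit Defensive.
Import Order.TTheory GRing.Theory Num.Theory.
Import numFieldNormedType.Exports.
Local Open Scope ring_scope.

(** * Halfspaces and the Vapnik-Chervonenkis dimension *)

(** The weights [w] are unbounded and the process is not truncated: they enter the Rademacher
    increments through their squares, and the masses that measure halfspaces absorb them. Dividing
    these squares by a deterministic bound [K] of their sum, rather than by the sum itself, leaves a
    subprobability and keeps all constants free of the sample. No sign variables are added to the
    probability space: the law of the doubled sample is invariant under exchanging the members of
    any set of pairs, so a probability is an average over these exchanges, and for a fixed sample it
    is bounded by counting sign patterns. The level [k] at which [(3 / 4) ^+ k] beats [L] is chosen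
    after it, then the finitely many sets [S i], then the sample size; the final argument rests on
    this order of choices. *)

Section Shattering.
Context {J : finType}.
Implicit Types (F : {set {set J}}) (A B S : {set J}).

Definition shatters F A :=
  [forall B : {set J}, (B \subset A) ==> [exists S in F, S :&: A == B]].

Lemma shattersP F A :
  reflect (forall B, B \subset A -> exists2 S, S \in F & S :&: A = B)
          (shatters F A).
Proof.
apply: (iffP forallP) => h B.
- move=> BA; move: (h B); rewrite BA /= => /existsP[S /andP[SF /eqP SA]].
  by exists S.
- apply/implyP => BA; have [S SF SA] := h _ BA.
  by apply/existsP; exists S; rewrite SF SA eqxx.
Qed.

Lemma shatters_sub F F' A : F \subset F' -> shatters F A -> shatters F' A.
Proof.
move=> FF' /shattersP h; apply/shattersP => B /h[S SF SA]; exists S => //.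
exact: (fintype.subsetP FF').
Qed.

(* Splitting [F] on a separating element [x], a set shattered by both halves
   is shattered by [F] both with and without [x]. *)
Lemma pajor F : (#|F| <= #|[set A | shatters F A]|)%N.
Proof.
have [n] := ubnP #|F|; elim: n F => // n IH F; rewrite ltnS => Fn.
have [F1|] := leqP #|F| 1.
  have [->|[S SF]] := set_0Vmem F; first by rewrite cards0.
  apply: (leq_trans F1); apply/card_gt0P; exists finset.set0; rewrite inE.
  apply/shattersP => B; rewrite finset.subset0 => /eqP ->.
  by exists S => //; rewrite finset.setI0.
move=> /card_gt1P[S1 [S2 [S1F S2F S12]]].
have [x xS] : exists x, (x \in S1) != (x \in S2).
  apply/existsP; apply: contraR S12 => /existsPn h.
  by apply/eqP/setP => x; have := h x; rewrite negbK => /eqP.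
pose F0 := [set S in F | x \notin S]; pose F1 := [set S in F | x \in S].
have F0F : F0 \subset F by apply/fintype.subsetP => S; rewrite inE => /andP[].
have F1F : F1 \subset F by apply/fintype.subsetP => S; rewrite inE => /andP[].
have cF : (#|F| = #|F0| + #|F1|)%N.
  rewrite -(cardsID F1 F) addnC; congr (_ + _)%N; apply: eq_card => S;
  rewrite !inE; case: (S \in F) => //=; by case: (x \in S).
have F0n : (0 < #|F0|)%N /\ (0 < #|F1|)%N.
  split; apply/card_gt0P; move: xS; case: (boolP (x \in S1)); case: (boolP (x \in S2)) => //= a b _;
  by [exists S1; rewrite inE S1F|exists S2; rewrite inE S2F].
have i0 := IH F0 ltac:(lia). have i1 := IH F1 ltac:(lia).
rewrite cF; apply: (leq_trans (leq_add i0 i1)).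
set G0 := [set A | shatters F0 A]; set G1 := [set A | shatters F1 A].
have xG0 A : A \in G0 -> x \notin A.
  rewrite inE => /shattersP/(_ A (subxx _))[S]; rewrite inE => /andP[_ xnS] SA.
  by apply: contra xnS => xA; move: xA; rewrite -{1}SA inE => /andP[].
have xG1 A : A \in G1 -> x \notin A.
  rewrite inE => /shattersP/(_ finset.set0 (finset.sub0set _))[S]; rewrite inE => /andP[_ xS'] SA.
  apply/negP => xA; have : x \in S :&: A by rewrite inE xS' xA.
  by rewrite SA inE.
(* The sets shattered by both halves are counted a second time through [x |: A]; these images
   contain [x], so they are new. *)
rewrite -cardsUI.
have inj : {in G0 :&: G1 &, injective (fun A => x |: A)}.
  move=> A B; rewrite !inE => /andP[a _] /andP[b _] AB.
  have := congr1 (fun S => S :\ x) AB.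
  by rewrite !setU1K //; apply: xG0; rewrite inE.
rewrite -(card_in_imset inj).
rewrite -cardsUI (_ : _ :&: [set x |: A | A in _] = finset.set0) ?cards0 ?addn0; last first.
  apply/setP => B; rewrite [in RHS]inE; apply/negP; rewrite finset.in_setI => /andP[].
  rewrite finset.in_setU => BG /imsetP[A _ BE].
  have : x \in B by rewrite BE setU11.
  by apply/negP; case/orP: BG; [exact: xG0|exact: xG1].
apply/subset_leq_card/fintype.subsetP => A; rewrite finset.in_setU => /orP[|].
  by rewrite finset.in_setU !inE => /orP[]; apply: shatters_sub.
move=> /imsetP[{}A AG ->]; move: (AG); rewrite !inE => /andP[/shattersP h0 /shattersP h1].
have xA : x \notin A by move: AG; rewrite finset.in_setI => /andP[/xG0].
apply/shattersP => B BA.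
have BxA : B :\ x \subset A.
  by rewrite finset.subDset.
have [xB|xB] := boolP (x \in B).
- have [S + SE] := h1 _ BxA; rewrite inE => /andP[SF xS']; exists S => //.
  rewrite finset.setIUr SE (_ : S :&: [set x]%SET = [set x]%SET); first exact: finset.setD1K.
  by apply/finset.setIidPr; rewrite finset.sub1set.
- have [S + SE] := h0 _ BxA; rewrite inE => /andP[SF xS']; exists S => //.
  rewrite finset.setIUr SE (_ : S :&: [set x]%SET = finset.set0).
    rewrite finset.set0U; apply/setP => y; rewrite !inE.
    by case: eqP => // ->; rewrite (negbTE xB).
  by apply/setP => y; rewrite !inE; case: eqP => [->|]; rewrite ?(negbTE xS') ?andbF.
Qed.

(** A set of at most [D] elements is read off a function from ['I_D] to [option J], with [None] as
    padding; hence the base [#|J|.+1]. *)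
Lemma card_small_sets D :
  (#|[set A : {set J} | #|A| <= D]%N| <= #|J|.+1 ^ D)%N.
Proof.
pose h (f : {ffun 'I_D -> option J}) := [set j | Some j \in codom f].
apply: (@leq_trans #|[set h f | f in {ffun 'I_D -> option J}]|); last first.
  by apply: (leq_trans (leq_imset_card _ _)); rewrite card_ffun card_ord card_option.
apply/subset_leq_card/fintype.subsetP => A; rewrite inE => AD.
apply/imsetP; exists [ffun i : 'I_D => nth None [seq Some j | j <- enum A] i] => //.
apply/setP => j; rewrite inE; apply/idP/codomP.
- move=> jA; have ji : (index j (enum A) < D)%N.
    by apply: (leq_trans _ AD); rewrite cardE index_mem mem_enum.
  exists (Ordinal ji); rewrite ffunE /= (nth_map j) ?nth_index ?index_mem ?mem_enum //.
- move=> [i]; rewrite ffunE => E.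
  have [iA|iA] := ltnP i (size (enum A)).
    move: E; rewrite (nth_map j) // => -[->]; by rewrite -mem_enum mem_nth.
  by move: E; rewrite nth_default // size_map.
Qed.

End Shattering.

(** * Traces of halfspaces on finite families *)

Section Traces.
Context {R : realType} {F : finType}.

Definition affine_form (p v : F -> R) : R := \sum_k p k * v k.

(** Sets of indices rather than of points, so that any family is allowed, with repetitions. *)
Definition traces (J : finType) (v : J -> F -> R) : {set {set J}} :=
  [set S : {set J} | `[< exists p, forall j, (j \in S) = (0 <= affine_form p (v j)) >]].

Lemma tracesP (J : finType) (v : J -> F -> R) (S : {set J}) :
  reflect (exists p, forall j, (j \in S) = (0 <= affine_form p (v j)))
          (S \in traces v).
Proof. by rewrite inE; apply: asboolP. Qed.

(** More vectors than coordinates leave a nonzero kernel. The sign is normalized because the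
    shattering argument needs one strictly positive term, and only points outside a closed halfspace
    give a strict inequality. *)
Lemma linear_dependence (J : finType) (v : J -> F -> R) (A : {set J}) :
  (#|F| < #|A|)%N ->
  exists l : J -> R, [/\ exists2 j, j \in A & l j < 0 &
    forall k, \sum_(j in A) l j * v j k = 0].
Proof.
move=> FA; pose M : 'M[R]_(#|A|, #|F|) := \matrix_(i, k) v (enum_val i) (enum_val k).
have : kermx M != 0.
  rewrite -mxrank_eq0 mxrank_ker -lt0n subn_gt0.
  exact: (leq_ltn_trans (rank_leq_col M)).
move=> /rowV0Pn[u /sub_kermxP uM u0].
have [i ui] : exists i, u 0 i != 0.
  apply/existsP; apply: contraR u0 => /existsPn h.
  by apply/eqP/rowP => i; rewrite mxE; apply/eqP; have := h i; rewrite negbK.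
wlog ui0 : u uM u0 ui / u 0 i < 0.
  move=> H; have [ui0|] := ltP (u 0 i) 0; first exact: (H u).
  move=> ui0; apply: (H (- u)); rewrite ?mulNmx ?uM ?oppr0 ?oppr_eq0 //.
  - by rewrite mxE oppr_eq0.
  - by rewrite mxE oppr_lt0 lt0r ui.
pose l j := if [pick i : 'I_#|A| | enum_val i == j] is Some i then u 0 i else 0.
have lE i' : l (enum_val i') = u 0 i'.
  rewrite /l; case: pickP => [i''|/(_ i')]; last by rewrite eqxx.
  by move=> /eqP/enum_val_inj ->.
exists l; split; first by exists (enum_val i); rewrite ?enum_valP ?lE.
move=> k; have := congr1 (fun N : 'rV_#|F| => N 0 (enum_rank k)) uM.
rewrite !mxE => uk; rewrite -[RHS]uk big_enum_val /=; apply: eq_bigr => i' _.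
by rewrite lE mxE enum_rankK.
Qed.

(* If [sum_A l_j v_j = 0], no form is nonnegative exactly where [l] is. *)
Lemma shattered_traces_card (J : finType) (v : J -> F -> R) (A : {set J}) :
  shatters (traces v) A -> (#|A| <= #|F|)%N.
Proof.
move=> /shattersP sh; rewrite leqNgt; apply/negP => /(linear_dependence v).
move=> [l [[j0 j0A lj0] lv]].
have [|S /tracesP[p pS] SA] := sh [set j in A | 0 <= l j].
  by apply/fintype.subsetP => j; rewrite inE => /andP[].
have pSA j : j \in A -> (0 <= affine_form p (v j)) = (0 <= l j).
  move=> jA; rewrite -pS; have /setP/(_ j) := SA.
  by rewrite finset.in_setI !inE jA andbT.
have : \sum_(j in A) l j * affine_form p (v j) = 0.
  under eq_bigr do rewrite mulr_sumr.
  rewrite exchange_big /= big1 // => k _.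
  under eq_bigr do rewrite mulrCA.
  by rewrite -mulr_sumr lv mulr0.
apply/eqP; rewrite gt_eqF // (bigD1 j0) //=; apply: ltr_pwDl.
  by rewrite nmulr_rgt0 // ltNge pSA // -ltNge.
apply: sumr_ge0 => j /andP[jA _]; have := pSA j jA.
have [lj /idP ?|lj] := leP 0 (l j); first exact: mulr_ge0.
by move=> /negbT; rewrite -ltNge => ?; apply: mulr_le0; apply: ltW.
Qed.

Lemma card_traces (J : finType) (v : J -> F -> R) :
  (#|traces v| <= #|J|.+1 ^ #|F|)%N.
Proof.
apply: (leq_trans (pajor _)); apply: leq_trans (card_small_sets #|F|).
apply/subset_leq_card/fintype.subsetP => A; rewrite !inE.
exact: shattered_traces_card.
Qed.

End Traces.

(** * Packing numbers of halfspace traces *)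

Section Packing.
Context {R : realType} {F J : finType}.
Variables (v : J -> F -> R) (q : J -> R).
Hypothesis q_ge0 : forall j, 0 <= q j.
Hypothesis q_le1 : \sum_j q j <= 1.

Definition symdiff (A B : {set J}) : {set J} := (A :\: B) :|: (B :\: A).

Lemma in_symdiff A B j : (j \in symdiff A B) = ((j \in A) != (j \in B)).
Proof. by rewrite !inE; case: (j \in A); case: (j \in B). Qed.

Definition mass (A : {set J}) : R := \sum_(j in A) q j.

Lemma mass_ge0 A : 0 <= mass A.
Proof. by apply: sumr_ge0 => j _; apply: q_ge0. Qed.

Lemma mass_setC (A : {set J}) : mass (~: A) = \sum_j q j - mass A.
Proof.
rewrite /mass [X in _ = X - _](bigID [in A]) /= addrC addrK.
by apply: eq_bigl => j; rewrite finset.in_setC.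
Qed.

Definition mass_separated (eps : R) (N : {set {set J}}) :=
  forall A B, A \in N -> B \in N -> A != B -> eps < mass (symdiff A B).

(* Dudley's argument: [k] points drawn independently from [q] distinguish all
   members of a mass_separated family with positive probability. *)
Lemma separated_card eps k (N : {set {set J}}) :
  0 <= eps <= 1 ->
  N \subset traces v -> mass_separated eps N ->
  ((k.+1 ^ #|F|).+1 ^ 2)%:R * (1 - eps) ^+ k < 1 :> R ->
  (#|N| <= k.+1 ^ #|F|)%N.
Proof.
move=> /andP[e0 e1] NT sepN hk; rewrite leqNgt; apply/negP => cN.
set n := (k.+1 ^ #|F|)%N in hk cN.
(* Exactly [n.+1] members are kept, which bounds the number of pairs by the square in [hk]. *)
have [N' N'N cN'] : exists2 N' : {set {set J}}, N' \subset N & #|N'| = n.+1.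
  have /card_geqP[s [us ss sN]] := cN.
  exists [set A in s]; last by rewrite cardsE; move/card_uniqP: us => ->.
  by apply/fintype.subsetP => A; rewrite inE => /sN.
set Q := \sum_j q j.
have Q0 : 0 <= Q by apply: sumr_ge0 => j _; apply: q_ge0.
(* [Q ^+ k] is the total weight of the [k]-tuples. On each tuple halfspaces have at most [n] traces,
   so two of the [n.+1] members agree on it: the tuple avoids their symmetric difference. *)
have key : Q ^+ k <= \sum_(AB : {set J} * {set J} | [&& AB.1 \in N', AB.2 \in N' & AB.1 != AB.2])
     mass (~: symdiff AB.1 AB.2) ^+ k.
  have -> : Q ^+ k = \sum_(z : {ffun 'I_k -> J}) \prod_i q (z i).
    by rewrite -(bigA_distr_bigA (fun (_ : 'I_k) j => q j)) prodr_const card_ord.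
  have -> : \sum_(AB : {set J} * {set J} | [&& AB.1 \in N', AB.2 \in N' & AB.1 != AB.2])
     mass (~: symdiff AB.1 AB.2) ^+ k =
     \sum_(AB : {set J} * {set J} | [&& AB.1 \in N', AB.2 \in N' & AB.1 != AB.2])
       \sum_(z : {ffun 'I_k -> J} | [forall i, z i \notin symdiff AB.1 AB.2]) \prod_i q (z i).
    apply: eq_bigr => AB _; rewrite -[in LHS](card_ord k) -prodr_const /mass.
    rewrite bigA_distr_big /=; apply: eq_bigl => z.
    apply/ffun_onP/forallP => h i; have := h i; first by rewrite finset.in_setC.
    by rewrite -finset.in_setC.
  rewrite (exchange_big_dep xpredT) //=; apply: ler_sum => z _.
  have pz : 0 <= \prod_(i < k) q (z i) by apply: prodr_ge0 => i _; exact: q_ge0.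
  pose tr (A : {set J}) : {set 'I_k} := [set i | z i \in A].
  have [A AN' [B]] : exists2 A, A \in N' & exists2 B, B \in [predD1 N' & A] & tr A = tr B.
    apply/dinjectivePn; apply/negP => /dinjectiveP inj.
    suff : (#|N'| <= n)%N by rewrite cN' ltnn.
    rewrite -(card_in_imset inj); have := card_traces (v \o z); rewrite card_ord.
    apply: leq_trans; apply/subset_leq_card/fintype.subsetP.
    move=> _ /imsetP[A AN' ->]; apply/tracesP.
    have /tracesP[p pA] := fintype.subsetP NT _ (fintype.subsetP N'N _ AN').
    by exists p => i; rewrite inE pA.
  rewrite inE /= => /andP[BA BN'] trAB.
  rewrite (bigD1 (A, B)) /=; last first.
    rewrite AN' BN' eq_sym BA /=; apply/forallP => i; rewrite in_symdiff negbK.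
    by have /setP/(_ i) := trAB; rewrite !inE => ->.
  by rewrite lerDl; apply: sumr_ge0.
have [Qe|Qe] := ltP Q eps.
  have /card_gt1P[A [B [AN' BN' AB]]] : (1 < #|N'|)%N.
    by rewrite cN' ltnS /n expn_gt0.
  have := sepN A B (fintype.subsetP N'N _ AN') (fintype.subsetP N'N _ BN') AB.
  apply/negP; rewrite -leNgt (le_trans _ (ltW Qe)) // /Q /mass.
  rewrite [leRHS](bigID [in symdiff A B]) /= lerDl.
  by apply: sumr_ge0 => j _; apply: q_ge0.
have Qp : 0 < Q ^+ k \/ Q = 0.
  have [/eqP ->|Q1] := boolP (Q == 0); [by right|left].
  by rewrite exprn_gt0 // lt0r Q1.
have le1 : Q ^+ k <= ((n.+1) ^ 2)%:R * ((1 - eps) ^+ k * Q ^+ k).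
  apply: (le_trans key).
  apply: (@le_trans _ _ (\sum_(AB : {set J} * {set J} | [&& AB.1 \in N', AB.2 \in N' & AB.1 != AB.2])
    ((1 - eps) ^+ k * Q ^+ k))).
    apply: ler_sum => -[A B] /= /and3P[AN' BN' AB].
    rewrite -exprMn; apply: lerXn2r; rewrite ?nnegrE ?mass_ge0 ?mulr_ge0 ?subr_ge0 //.
    (* The total mass [Q] is at most 1, so [eps * Q] is still below the separation. *)
    rewrite mass_setC -/Q.
    have := sepN A B (fintype.subsetP N'N _ AN') (fintype.subsetP N'N _ BN') AB.
    rewrite mulrBl mul1r => /ltW h; rewrite lerB //.
    by apply: le_trans h; rewrite ler_piMr.
  rewrite sumr_const -[in leLHS]mulr_natl ler_wpM2r //.
    by rewrite mulr_ge0 ?exprn_ge0 ?subr_ge0.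
  rewrite ler_nat -cN' expnS expn1 -cardsX; apply/subset_leq_card/fintype.subsetP.
  by move=> [A B]; rewrite !inE /= => /and3P[-> ->].
case: Qp => [Qp|Q0'].
  have : ((n.+1) ^ 2)%:R * ((1 - eps) ^+ k * Q ^+ k) < Q ^+ k.
    by rewrite mulrA gtr_pMl.
  by rewrite ltNge le1.
have e00 : eps = 0 by apply/eqP; rewrite eq_le e0 -Q0' Qe.
by move: hk; rewrite e00 subr0 expr1n mulr1 ltrn1.
Qed.

End Packing.

(** * Rademacher sums and chaining *)

Section Rademacher.
Context {R : realType}.

(* The bound is checked near [0] and propagated by
   [cosh (2 y) = 2 cosh y ^ 2 - 1]. *)
Lemma cosh_le_expR_sqr (y : R) :
  expR y + expR (- y) <= 2 * expR (2 * y ^+ 2).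
Proof.
have small (x : R) : `|x| <= 1 / 2 -> expR x + expR (- x) <= 2 * expR (2 * x ^+ 2).
  rewrite ler_norml => /andP[xl xr].
  have h (z : R) : -1/2 <= z <= 1/2 -> expR z <= (1 - z)^-1.
    move=> /andP[z1 z2]; rewrite -[z in expR z]opprK expRN lef_pV2 ?posrE ?expR_gt0 //; last lra.
    exact: expR_ge1Dx.
  have h1 := h x ltac:(lra); have h2 := h (- x) ltac:(lra).
  apply: (le_trans (lerD h1 h2)).
  apply: (@le_trans _ _ (2 * (1 + 2 * x ^+ 2))).
    have x1 : 0 < 1 - x by lra.
    have x2 : 0 < 1 + x by lra.
    rewrite opprK.
    have -> : (1 - x)^-1 + (1 + x)^-1 = 2 / ((1 - x) * (1 + x)).
      by field; rewrite !gt_eqF.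
    rewrite ler_pdivrMr ?mulr_gt0 //.
    have x4 : x ^+ 2 <= 1 / 2 by nra.
    have := mulr_ge0 (sqr_ge0 x) (_ : 0 <= 1 - 2 * x ^+ 2).
    by move=> /(_ ltac:(lra)); lra.
  by rewrite ler_pM2l //; apply: expR_ge1Dx.
have [n yn] : exists n, `|y| <= 2 ^+ n * (1 / 2).
  exists (Num.bound `|y|).+1; apply: ltW; apply: (lt_le_trans (archi_boundP (normr_ge0 y))).
  rewrite exprS mulrAC mul1r mulfV ?pnatr_eq0 // mul1r -natrX ler_nat ltnW //.
  exact: ltn_expl.
elim: n y yn => [|n IH] y yn; first by apply: small; rewrite expr0 mul1r in yn.
have /IH : `|y / 2| <= 2 ^+ n * (1 / 2).
  by rewrite normrM [`|2^-1|]ger0_norm // ler_pdivrMr // mulrAC -exprSr.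
set z := y / 2; have -> : y = z + z by rewrite /z; lra.
rewrite opprD !expRD; set a := expR z; set b := expR (- z).
have ab : a * b = 1 by rewrite /a /b -expRD subrr expR0.
have -> : expR (2 * (z + z) ^+ 2) = expR (2 * z ^+ 2) ^+ 4.
  by rewrite -expRM_natl; congr expR; ring.
set c := expR (2 * z ^+ 2); have c0 : 0 < c by exact: expR_gt0.
have a0 : 0 < a by exact: expR_gt0. have b0 : 0 < b by exact: expR_gt0.
move=> abc; have : (a + b) ^+ 2 <= (2 * c) ^+ 2.
  by apply: lerXn2r => //; rewrite nnegrE; apply: ltW; rewrite ?addr_gt0 ?mulr_gt0.
have : 0 <= (c ^+ 2 - 1) ^+ 2 by apply: sqr_ge0.
nra.
Qed.

Context {I : finType}.

(** Signs are booleans; probabilities over them are cardinalities of subsets of [{ffun I -> bool}],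
    and expectations are sums over this type. *)
Definition rademacher_sum (a : I -> R) (e : {ffun I -> bool}) : R :=
  \sum_i (-1) ^+ e i * a i.

Lemma rademacher_mgf (a : I -> R) :
  \sum_e expR (rademacher_sum a e) <=
  expR (2 * \sum_i a i ^+ 2) * #|{ffun I -> bool}|%:R.
Proof.
have -> : \sum_e expR (rademacher_sum a e) =
    \sum_(e : {ffun I -> bool}) \prod_i expR ((-1) ^+ e i * a i).
  by apply: eq_bigr => e _; rewrite -expR_sum.
rewrite -(bigA_distr_bigA (fun i b => expR ((-1) ^+ (b : bool) * a i))) /=.
rewrite mulr_sumr expR_sum card_ffun card_bool natrX.
rewrite -prodr_const -big_split /=; apply: ler_prod => i _.
rewrite big_bool /= expr1 mulN1r expr0 mul1r addr_ge0 ?expR_ge0 //=.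
by rewrite mulrC addrC; apply: cosh_le_expR_sqr.
Qed.

(** Hoeffding's bound, from the exponential moment at the optimal [l = t / (4 * s)]. The usual
    constant 2 becomes 8 because [cosh y] is bounded by [expR (2 * y ^+ 2)]. *)
Lemma rademacher_tail (a : I -> R) (s t : R) : 0 < s -> 0 <= t ->
  \sum_i a i ^+ 2 <= s ^+ 2 ->
  #|[set e | t * s < `|rademacher_sum a e|]%SET|%:R <=
  2 * expR (- (t ^+ 2 / 8)) * #|{ffun I -> bool}|%:R.
Proof.
move=> s0 t0 as2.
pose l := t / (4 * s).
have half (b : I -> R) : \sum_i b i ^+ 2 <= s ^+ 2 ->
    #|[set e | t * s < rademacher_sum b e]%SET|%:R <=
    expR (- (t ^+ 2 / 8)) * #|{ffun I -> bool}|%:R.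
  move=> bs; have l0 : 0 <= l by rewrite divr_ge0 // mulr_ge0 // ltW.
  have := rademacher_mgf (fun i => l * b i).
  have -> : \sum_i (l * b i) ^+ 2 = l ^+ 2 * \sum_i b i ^+ 2.
    by rewrite mulr_sumr; apply: eq_bigr => i _; rewrite exprMn.
  move=> h; have : expR (l * (t * s)) * #|[set e | t * s < rademacher_sum b e]%SET|%:R
      <= expR (2 * (l ^+ 2 * s ^+ 2)) * #|{ffun I -> bool}|%:R.
    apply: (@le_trans _ _ (expR (2 * (l ^+ 2 * \sum_i b i ^+ 2)) * #|{ffun I -> bool}|%:R)); last first.
      by rewrite ler_wpM2r // ler_expR ler_wpM2l // ler_wpM2l // sqr_ge0.
    apply: le_trans h; rewrite -sum1_card natr_sum mulr_sumr.
    rewrite [leRHS](bigID [in [set e | t * s < rademacher_sum b e]%SET]) /=.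
    rewrite -[leLHS]addr0; apply: lerD; last by apply: sumr_ge0 => e _; apply: expR_ge0.
    apply: ler_sum => e; rewrite inE mulr1 ler_expR => he.
    have -> : rademacher_sum (fun i => l * b i) e = l * rademacher_sum b e.
      by rewrite mulr_sumr; apply: eq_bigr => i _; rewrite mulrCA.
    by rewrite ler_wpM2l // ltW.
  rewrite -ler_pdivlMl ?expR_gt0 // [leRHS]mulrA -expRN -expRD.
  have -> : - (l * (t * s)) + 2 * (l ^+ 2 * s ^+ 2) = - (t ^+ 2 / 8).
    by rewrite /l; field; rewrite gt_eqF.
  by [].
have h1 := half a as2.
have h2 := half (fun i => - a i) ltac:(by under eq_bigr do rewrite sqrrN).
rewrite -mulrA mulr2n mulrDl mul1r; apply: le_trans (lerD h1 h2).
rewrite -natrD ler_nat; apply: leq_trans (leq_card_setU _ _).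
apply/subset_leq_card/fintype.subsetP => e; rewrite !inE.
have -> : rademacher_sum (fun i => - a i) e = - rademacher_sum a e.
  by rewrite /rademacher_sum -sumrN; apply: eq_bigr => i _; rewrite mulrN.
by rewrite ltr_normr.
Qed.

End Rademacher.

(** * Growth estimates for the chaining constants *)

Section Growth.
Context {R : realType}.

(** [expR y] is the [p]-th power of [expR (y / (2 * p)) ^+ 2], and already [(1 + y / (2 * p)) ^+ 2]
    exceeds [y]. *)
Lemma expn_lt_expR (p y : nat) : (16 * p ^ 2 < y)%N -> (y ^ p)%:R < expR y%:R :> R.
Proof.
case: p => [|p] py.
  by rewrite expn0 expR_gt1 ltr0n; move: py; rewrite exp0n.
set q := (2 * p.+1)%N.
have -> : expR (y%:R : R) = expR (y%:R / q%:R) ^+ q.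
  by rewrite -expRM_natl mulrCA divff ?mulr1 // pnatr_eq0.
rewrite /q exprM natrX ltrXn2r // ?nnegrE ?exprn_ge0 ?expR_ge0 //.
have yq : 0 <= y%:R / q%:R :> R by rewrite divr_ge0.
apply: (@lt_le_trans _ _ ((1 + y%:R / q%:R) ^+ 2)); last first.
  by apply: lerXn2r; rewrite ?nnegrE ?expR_ge0 ?addr_ge0 //; exact: expR_ge1Dx.
have : y%:R < (y%:R / q%:R) ^+ 2 :> R.
  rewrite expr_div_n ltr_pdivlMr ?exprn_gt0 ?ltr0n // -!natrX -natrM ltr_nat /q.
  by move: py; rewrite !expnS !expn0; nia.
nra.
Qed.

(** The condition of the packing bound at separation [4^-k], met by [c * 8 ^ k] draws: with
    [y = c * 2 ^ k] the power is at most [expR (- y)], while the counting factor is polynomial in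
    [y]. One [c] serves all levels, since the nets of all levels enter the same sum. *)
Lemma packing_growth (D : nat) : exists2 c, (0 < c)%N & forall k,
  ((((c * 8 ^ k).+1 ^ D).+1 ^ 2)%:R * (1 - 4^-1 ^+ k) ^+ (c * 8 ^ k) < 1 :> R).
Proof.
(* As [m.+1 <= y ^ 4], the counting factor is at most [(y ^ (4 * D).+1) ^ 2]. *)
set P := (8 * D + 2)%N.
exists (16 * P ^ 2).+1 => // k; set c := (16 * P ^ 2).+1.
set m := (c * 8 ^ k)%N; set y := (c * 2 ^ k)%N.
have cy : (c <= y)%N by rewrite /y leq_pmulr // expn_gt0.
have y2 : (2 <= y)%N by apply: leq_trans cy; rewrite /c ltnS; nia.
have my : (m <= y ^ 3)%N.
  have -> : m = (c * (2 ^ k) ^ 3)%N by rewrite /m -expnM [(k * 3)%N]mulnC expnM.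
  rewrite /y expnMn leq_mul //.
  have : (0 < c)%N by [].
  by case: (c) => // c' _; rewrite !expnS; nia.
have e1 : (1 - 4^-1 ^+ k) ^+ m <= expR (- y%:R) :> R.
  have -> : - y%:R = m%:R * (- (4^-1 ^+ k)) :> R.
    rewrite /m /y !natrM !natrX -mulrA !mulrN; congr (- _); congr (_ * _).
    by rewrite -exprMn; congr (_ ^+ _); lra.
  rewrite expRM_natl; apply: lerXn2r; rewrite ?nnegrE ?expR_ge0 //.
    by rewrite subr_ge0 exprn_ile1 //; lra.
  exact: expR_ge1Dx.
have e2 : (((m.+1 ^ D).+1 ^ 2) <= y ^ P)%N.
  have h1 : (m.+1 <= y ^ 4)%N.
    apply: (@leq_trans (y ^ 3).+1); first by rewrite ltnS.
    have y3 : (0 < y ^ 3)%N by rewrite expn_gt0; apply/orP; left; lia.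
    by rewrite [(y ^ 4)%N]expnS; nia.
  have h2 : (m.+1 ^ D <= y ^ (4 * D))%N by have [->|D0] := posnP D; [rewrite muln0 !expn0|rewrite expnM leq_exp2r].
  have h3 : ((m.+1 ^ D).+1 <= y ^ (4 * D).+1)%N.
    apply: (@leq_trans (y ^ (4 * D)).+1); first by rewrite ltnS.
    have y4 : (0 < y ^ (4 * D))%N by rewrite expn_gt0; apply/orP; left; lia.
    by rewrite [X in (_ < X)%N]expnS; nia.
  apply: (@leq_trans ((y ^ (4 * D).+1) ^ 2)); first by rewrite leq_exp2r.
  by rewrite -expnM leq_pexp2l //; lia.
have e3 : (y ^ P)%:R < expR y%:R :> R by apply: (@expn_lt_expR P y); apply: leq_trans cy; rewrite /c.
have y0 := expR_gt0 (y%:R : R).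
apply: (@le_lt_trans _ _ ((y ^ P)%:R * expR (- y%:R))).
  apply: ler_pM => //; last by rewrite ler_nat.
  by rewrite exprn_ge0 // subr_ge0 exprn_ile1 //; lra.
by rewrite expRN ltr_pdivrMr // mul1r.
Qed.

Lemma geometric_le (x : R) n : 0 <= x <= 1 / 2 -> \sum_(k < n) x ^+ k.+1 <= 2 * x.
Proof.
move=> /andP[x0 x2].
suff : \sum_(k < n) x ^+ k.+1 <= 2 * x * (1 - x ^+ n).
  move=> h; apply: (le_trans h); rewrite ler_piMr ?mulr_ge0 // lerBlDr lerDl.
  exact: exprn_ge0.
elim: n => [|n IH]; first by rewrite big_ord0 expr0 subrr mulr0.
rewrite big_ord_recr /=; apply: (le_trans (lerD IH (lexx _))).
rewrite !exprS; have := exprn_ge0 n x0; set z := x ^+ n => z0.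
have : 0 <= x * z * (1 - 2 * x) by rewrite !mulr_ge0 //; lra.
nra.
Qed.

End Growth.

(** * Nets and chaining *)

Section Chaining.
Context {R : realType} {F J : finType}.
Variables (v : J -> F -> R) (q : J -> R).
Hypothesis q_ge0 : forall j, 0 <= q j.
Local Notation mass := (mass q).

Lemma symdiffxx (A : {set J}) : symdiff A A = finset.set0.
Proof. by apply/setP => j; rewrite in_symdiff eqxx inE. Qed.

Lemma symdiffC (A B : {set J}) : symdiff A B = symdiff B A.
Proof. by apply/setP => j; rewrite !in_symdiff eq_sym. Qed.

Lemma mass_symdiff_trans (B A C : {set J}) :
  mass (symdiff A C) <= mass (symdiff A B) + mass (symdiff B C).
Proof.
rewrite /mass !(big_mkcond (fun j => j \in symdiff _ _)) -big_split /=.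
apply: ler_sum => j _; rewrite !in_symdiff; have := q_ge0 j.
by case: (j \in A); case: (j \in B); case: (j \in C) => //= ?; lra.
Qed.

(** A maximal separated family is a net of the same radius, since a trace far from all members could
    be added. The existence is informative, so that nets can be named level by level. *)
Lemma maximal_separated (eps : R) : 0 <= eps ->
  {N : {set {set J}} | [/\ N \subset traces v, mass_separated q eps N &
    forall A, A \in traces v -> exists2 B, B \in N & mass (symdiff A B) <= eps]}.
Proof.
move=> e0; pose P (N : {set {set J}}) := (N \subset traces v) && `[< mass_separated q eps N >].
have [|N /maxsetP[/andP[NT /asboolP sepN] maxN] _] := @maxset_exists _ P finset.set0.
  rewrite /P finset.sub0set; apply/asboolP => A B.
  by rewrite inE.
exists N; split => // A AT.
have [/existsP[B /andP[BN AB]]|/existsPn far] :=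
  boolP [exists B, (B \in N) && (mass (symdiff A B) <= eps)]; first by exists B.
exists A; last by rewrite symdiffxx /mass big_set0.
rewrite -(maxN (A |: N)); [by rewrite setU11| |exact: finset.subsetUr].
have far' B : B \in N -> eps < mass (symdiff A B).
  by move=> BN; have := far B; rewrite BN /= -ltNge.
apply/andP; split; first by rewrite finset.subUset NT finset.sub1set AT.
apply/asboolP => B C; rewrite !in_setU1 => /orP[/eqP->|BN] /orP[/eqP->|CN]; rewrite ?eqxx // => BC.
- exact: far'.
- by rewrite symdiffC; exact: far'.
- exact: sepN.
Qed.

End Chaining.

Section ChainingBound.
Context {R : realType} {F : finType}.

(* [4^-k] is the squared radius of the [k]-th net, and increments between the
   nets [k] and [k+1] are required to be at most [L * (3/4)^k]. *)
Theorem chaining (eta : R) : 0 < eta -> exists2 L : R, 1 <= L &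
  forall (J : finType) (v : J -> F -> R) (q : J -> R) (E : finType)
    (S : {set J} -> E -> R),
  (forall j, 0 <= q j) -> \sum_j q j <= 1 ->
  (forall A B e, mass q (symdiff A B) = 0 -> S A e = S B e) ->
  (forall A B s t, 0 < s -> 0 <= t -> mass q (symdiff A B) <= s ^+ 2 ->
     #|[set e | t * s < `|S A e - S B e|]%SET|%:R <=
     2 * expR (- (t ^+ 2 / 8)) * #|E|%:R) ->
  #|[set e | `[< exists A B k, [/\ A \in traces v, B \in traces v,
       mass q (symdiff A B) <= 4^-1 ^+ k &
       9 * L * (3 / 4) ^+ k < `|S A e - S B e| ] >] ]%SET|%:R <= eta * #|E|%:R.
Proof.
move=> eta0; set D := #|F|; have [c c0 hc] := @packing_growth R D.
(* [al * be ^+ k.+1] bounds twice the number of pairs taken from nets [k] and [k.+1], the 2 being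
   that of the tail bound. With [L] such that [be * expR (- (L ^+ 2 / 32)) <= x], the failure
   probabilities sum to at most [2 * al * x <= eta]. *)
pose al : R := 8 * (2 * c%:R) ^+ D ^+ 2.
pose be : R := 64 ^+ D.
have al0 : 0 < al by rewrite mulr_gt0 // !exprn_gt0 // mulr_gt0 // ltr0n.
have be0 : 0 < be by rewrite exprn_gt0.
pose x := Num.min (1 / 2) (eta / (2 * al)).
have x0 : 0 < x by rewrite lt_min divr_gt0 // divr_gt0 // mulr_gt0.
have [y yE] : exists y, expR y = be / x by apply: expR_total; rewrite divr_gt0.
pose L := 1 + 32 * `|y|.
have L1 : 1 <= L by rewrite lerDl mulr_ge0.
have hL : be * expR (- (L ^+ 2 / 32)) <= x.
  rewrite expRN ler_pdivrMr ?expR_gt0 // mulrC -ler_pdivrMr // -yE ler_expR.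
  apply: (le_trans (ler_norm y)); rewrite ler_pdivlMr // /L.
  have := normr_ge0 y; set z := `|y|; nra.
exists L => // J v q E S q0 q1 S0 Stail.
have quarter0 k : 0 <= (4^-1 : R) ^+ k by apply: exprn_ge0; lra.
pose net k : {set {set J}} := sval (maximal_separated v q (quarter0 k)).
have netT k A : A \in net k -> A \in traces v.
  by rewrite /net; case: maximal_separated => N [/= NT _ _]; apply: (fintype.subsetP NT).
have netP k A : A \in traces v ->
    exists2 B, B \in net k & mass q (symdiff A B) <= 4^-1 ^+ k.
  by rewrite /net; case: maximal_separated => N [/= _ _]; apply.
have net_card k : (#|net k| <= (c * 8 ^ k).+1 ^ D)%N.
  rewrite /net; case: maximal_separated => N [/= NT sepN _].
  apply: (separated_card (eps := 4^-1 ^+ k) q0 q1 _ NT sepN (hc k)).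
  by rewrite quarter0 exprn_ile1 //; lra.
(* [J] is finite, so the positive weights are bounded below and a mass of at most [4^-K] is zero:
   chains stop at level [K], where the process no longer changes. *)
have [K KP] : exists K, forall C, mass q C <= 4^-1 ^+ K -> mass q C = 0.
  have Kj j : exists n, 0 < q j -> 4^-1 ^+ n < q j.
    exists (Num.bound (q j)^-1) => qj; rewrite exprVn invf_plt ?posrE ?exprn_gt0 //.
    apply: (lt_le_trans (archi_boundP _)); first by rewrite invr_ge0 ltW.
    by rewrite -natrX ler_nat ltnW // ltn_expl.
  have {}[n nP] := choice Kj; exists (\max_j n j)%N => C hC.
  apply: big1 => j jC; apply/eqP; rewrite eq_le q0 andbT leNgt; apply/negP => qj.
  have : q j <= mass q C.
    by rewrite /mass (bigD1 j) //= lerDl; apply: sumr_ge0.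
  apply/negP; rewrite -ltNge; apply: (le_lt_trans hC); apply: le_lt_trans (nP j qj).
  by apply: ler_wiXn2l; rewrite ?leq_bigmax //; lra.
pose nets k := net k :|: net k.+1.
have nets_card k : (#|nets k|%:R <= 2 * ((2 * c%:R) ^+ D * (8 ^+ D) ^+ k.+1) :> R).
  have -> : 2 * ((2 * c%:R) ^+ D * (8 ^+ D) ^+ k.+1) =
      (2 * (2 * c * 8 ^ k.+1) ^ D)%:R :> R.
    rewrite natrM [in RHS]natrX natrM natrX natrM [in RHS]exprMn.
    by rewrite -!exprM [(D * _)%N]mulnC.
  rewrite ler_nat; apply: (leq_trans (leq_card_setU _ _)); rewrite mul2n -addnn.
  have cD l : (l <= k.+1)%N -> (#|net l| <= (2 * c * 8 ^ k.+1) ^ D)%N.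
    move=> lk; apply: (leq_trans (net_card l)); have [->|D0] := posnP D; first by rewrite !expn0.
    rewrite leq_exp2r //; have : (8 ^ l <= 8 ^ k.+1)%N by rewrite leq_exp2l.
    have : (0 < 8 ^ l)%N by rewrite expn_gt0.
    by nia.
  by rewrite leq_add // cD.
pose X k A B := [set e | L * (3 / 4) ^+ k < `|S A e - S B e| ]%SET.
(* The radius [4 * 4^-k] admits both kinds of pairs used below: neighbours in consecutive nets, at
   most [4^-(k+1) + 4^-k] apart, and two members of one net, at most [3 * 4^-k] apart. *)
pose Bad := \bigcup_(k < K) \bigcup_(A in nets k)
  \bigcup_(B in nets k | mass q (symdiff A B) <= 4 * 4^-1 ^+ k) X k A B.
have card_bigcup (T : finType) (P : pred T) (G : T -> {set E}) (b : R) : 0 <= b ->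
    (forall t, P t -> #|G t|%:R <= b) -> #|\bigcup_(t | P t) G t|%:R <= #|[pred t | P t]|%:R * b.
  move=> b0 Gb; apply: (@le_trans _ _ (\sum_(t | P t) #|G t|%:R)).
    apply: (big_rec2 (fun (A : {set E}) (r : R) => is_true (#|A|%:R <= r))); first by rewrite cards0.
    move=> t r A _ h; apply: le_trans (lerD (lexx _) h).
    by rewrite -natrD ler_nat leq_card_setU.
  by apply: (le_trans (ler_sum _ Gb)); rewrite sumr_const mulr_natl.
have Bad_le : #|Bad|%:R <= eta * #|E|%:R.
  have step k : #|\bigcup_(A in nets k)
      \bigcup_(B in nets k | mass q (symdiff A B) <= 4 * 4^-1 ^+ k) X k A B|%:R <=
      al * x ^+ k.+1 * #|E|%:R.
    pose b := 2 * expR (- (L ^+ 2 / 32)) ^+ k.+1 * #|E|%:R.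
    have b0 : 0 <= b by rewrite !mulr_ge0 // exprn_ge0 // expR_ge0.
    have XA A : #|\bigcup_(B in nets k | mass q (symdiff A B) <= 4 * 4^-1 ^+ k) X k A B|%:R
        <= #|nets k|%:R * b.
      apply: (@le_trans _ _ (#|[pred B | (B \in nets k) && (mass q (symdiff A B) <= 4 * 4^-1 ^+ k)]|%:R * b)).
        apply: card_bigcup => // B /andP[_ AB].
        (* [s ^+ 2] is the radius and [t * s] the allowed increment. As [3 / 4] exceeds [1 / 2], [t]
           grows geometrically, and [t ^+ 2 / 8 = L ^+ 2 / 32 * (9 / 4) ^+ k] is at least [k.+1]
           times [L ^+ 2 / 32], which beats the size of the nets. *)
        have := @Stail A B (2 * 2^-1 ^+ k) (L / 2 * (3 / 2) ^+ k).
        have -> : L / 2 * (3 / 2) ^+ k * (2 * 2^-1 ^+ k) = L * (3 / 4) ^+ k :> R.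
          have -> : (3 / 4 : R) = (3 / 2) * 2^-1 by lra.
          rewrite [in RHS]exprMn; set z1 := _ ^+ k; set z2 := 2^-1 ^+ k.
          by field.
        move=> /(_ _ _ _)/le_trans; apply.
        - by rewrite mulr_gt0 // exprn_gt0 // invr_gt0.
        - by rewrite mulr_ge0 ?divr_ge0 ?exprn_ge0 //; lra.
        - rewrite exprMn -exprM mulnC exprM; apply: (le_trans AB).
          have -> : (2^-1 : R) ^+ 2 = 4^-1 by lra.
          by have -> : (2 : R) ^+ 2 = 4 by lra.
        rewrite /b ler_wpM2r // ler_wpM2l // -expRM_natl ler_expR mulrN lerN2.
        have k9 : (k.+1)%:R <= (9 / 4) ^+ k :> R.
          elim: (k) => [|k' IH]; first by rewrite expr0.
          rewrite exprS -natr1; have : 1 <= (k'.+1)%:R :> R by rewrite ler1n.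
          lra.
        have -> : (L / 2 * (3 / 2) ^+ k) ^+ 2 = L ^+ 2 / 4 * (9 / 4) ^+ k.
          rewrite exprMn -exprM [(k * 2)%N]mulnC exprM; congr (_ * _ ^+ _); lra.
        have w0 : 0 <= L ^+ 2 / 32 by rewrite divr_ge0 // sqr_ge0.
        have := ler_wpM2l w0 k9; set z := (9 / 4) ^+ k; set w := L ^+ 2.
        lra.
      rewrite ler_wpM2r // ler_nat; apply/subset_leq_card/fintype.subsetP => B.
      by rewrite inE => /andP[].
    apply: (le_trans (card_bigcup _ _ _ _ _ (fun A _ => XA A))).
      by rewrite mulr_ge0.
    rewrite mulrA.
    have nc : (#|nets k|%:R * #|nets k|%:R <=
        (2 * ((2 * c%:R) ^+ D * (8 ^+ D) ^+ k.+1)) ^+ 2 :> R).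
      by rewrite expr2; apply: ler_pM.
    apply: (le_trans (ler_wpM2r b0 nc)).
    rewrite /b [leLHS]mulrA ler_wpM2r //.
    have -> : (2 * ((2 * c%:R) ^+ D * (8 ^+ D) ^+ k.+1)) ^+ 2 *
        (2 * expR (- (L ^+ 2 / 32)) ^+ k.+1) = al * (be * expR (- (L ^+ 2 / 32))) ^+ k.+1.
      have -> : be = (8 ^+ D) ^+ 2.
        by rewrite /be -exprM mulnC exprM; congr (_ ^+ _); lra.
      rewrite /al [(_ ^+ 2 * _) ^+ k.+1]exprMn -(exprM (8 ^+ D)) [(2 * k.+1)%N]mulnC exprM.
      by set u := (2 * _) ^+ D; set u' := (8 ^+ D) ^+ k.+1; ring.
    apply: ler_wpM2l; first exact: ltW.
    apply: lerXn2r => //; rewrite nnegrE.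
      by rewrite mulr_ge0 ?expR_ge0 // ltW.
    exact: ltW.
  apply: (@le_trans _ _ (\sum_(k < K) al * x ^+ k.+1 * #|E|%:R)).
    rewrite /Bad; apply: (big_rec2 (fun (A : {set E}) (r : R) => is_true (#|A|%:R <= r))); first by rewrite cards0.
    move=> k r A _ h; apply: le_trans (lerD (step k) h).
    by rewrite -natrD ler_nat leq_card_setU.
  rewrite -mulr_suml ler_wpM2r // -mulr_sumr.
  have xhalf : 0 <= x <= 1 / 2 by rewrite ltW //= ge_min lexx.
  apply: (le_trans (ler_wpM2l (ltW al0) (geometric_le K xhalf))).
  have : x <= eta / (2 * al) by rewrite ge_min lexx orbT.
  have al2 : 0 < 2 * al by apply: mulr_gt0.
  rewrite ler_pdivlMr // => h; apply: le_trans h.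
  by rewrite mulrCA [al * x]mulrC mulrCA.
apply: le_trans Bad_le; rewrite ler_nat; apply/subset_leq_card/fintype.subsetP => e.
rewrite inE => /asboolP[A [B [k0 [AT BT AB]]]].
apply: contraTT => eBad; rewrite -leNgt.
have good k A' B' : (k < K)%N -> A' \in nets k -> B' \in nets k ->
    mass q (symdiff A' B') <= 4 * 4^-1 ^+ k -> `|S A' e - S B' e| <= L * (3 / 4) ^+ k.
  move=> kK A'k B'k A'B'; rewrite leNgt; apply: contra eBad => h.
  apply/bigcupP; exists (Ordinal kK) => //; apply/bigcupP; exists A' => //.
  by apply/bigcupP; exists B'; rewrite ?B'k //= inE.
(* Downward induction from [K]: the constant 4 reproduces itself, as [4 * (3 / 4) + 1 = 4]. The 9 of
   the statement is [4 + 1 + 4], for two chains and one step inside net [k0]. *)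
have link k A' : (k <= K)%N -> A' \in traces v -> forall B', B' \in net k ->
    mass q (symdiff A' B') <= 4^-1 ^+ k -> `|S A' e - S B' e| <= 4 * L * (3 / 4) ^+ k.
  move=> kK A'T; have [i ->] : exists i, k = (K - i)%N by exists (K - k)%N; rewrite subKn.
  elim: i => [|i IH] B' B'k AB'.
    rewrite subn0 in AB' *; rewrite (S0 _ _ _ (KP _ AB')) subrr normr0.
    by rewrite !mulr_ge0 ?exprn_ge0 //; lra.
  have [Ki|iK] := leqP K i.
    have KiE : (K - i.+1 = K - i)%N by apply/eqP; rewrite eqn_leq leq_sub2l //= leq_subLR (leq_trans Ki) // leq_addr.
    by rewrite KiE in B'k AB' *; exact: IH.
  have kS : (K - i = (K - i.+1).+1)%N by rewrite subnSK.
  rewrite kS in IH; set k' := (K - i.+1)%N in IH B'k AB' *.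
  have [C Ck AC] := netP k'.+1 A' A'T.
  have CB : `|S C e - S B' e| <= L * (3 / 4) ^+ k'.
    have k'K : (k' < K)%N by rewrite ltn_subrL /= (leq_ltn_trans _ iK).
    apply: good => //; [by rewrite finset.in_setU Ck orbT|by rewrite finset.in_setU B'k|].
    apply: (le_trans (mass_symdiff_trans q0 A' _ _)); rewrite [symdiff C A']symdiffC.
    apply: (le_trans (lerD AC AB')); rewrite exprS; have := quarter0 k'; lra.
  have := ler_normD (S A' e - S C e) (S C e - S B' e).
  rewrite addrA subrK => /le_trans; apply; apply: (le_trans (lerD (IH C Ck AC) CB)).
  by rewrite exprS; lra.
have L0 : 0 <= L by apply: le_trans L1.
have [Kk|kK] := leqP K k0.
  rewrite (S0 A B) ?subrr ?normr0; first by rewrite !mulr_ge0 ?exprn_ge0 //; lra.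
  apply: KP; apply: (le_trans AB); apply: ler_wiXn2l => //; lra.
have [A' A'k AA'] := netP k0 A AT; have [B' B'k BB'] := netP k0 B BT.
have hA := link k0 A (ltnW kK) AT A' A'k AA'.
have hB := link k0 B (ltnW kK) BT B' B'k BB'.
have hAB : `|S A' e - S B' e| <= L * (3 / 4) ^+ k0.
  apply: good => //; [by rewrite finset.in_setU A'k|by rewrite finset.in_setU B'k|].
  apply: (le_trans (mass_symdiff_trans q0 A _ _)); rewrite [symdiff A' A]symdiffC.
  apply: (le_trans (lerD AA' (mass_symdiff_trans q0 B _ _))).
  apply: (le_trans (lerD (lexx _) (lerD AB BB'))); have := quarter0 k0; lra.
have := ler_normD (S A e - S A' e) (S A' e - S B e).
rewrite addrA subrK => /le_trans; apply.
have := ler_normD (S A' e - S B' e) (S B' e - S B e).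
rewrite addrA subrK distrC [`|S B' e - _|]distrC => hh.
apply: (le_trans (lerD hA (le_trans _ (lerD hAB hB)))); first by rewrite distrC in hh *.
lra.
Qed.

End ChainingBound.

Definition halfspace_ind {R : realType} {F : finType} (p v : F -> R) : R :=
  (0 <= affine_form p v)%R%:R.

Lemma sum_pair_bool {R : realType} {I : finType} (g : I * bool -> R) :
  \sum_z g z = \sum_i (g (i, true) + g (i, false)).
Proof.
rewrite (eq_bigr (fun z => g (z.1, z.2))); last by case.
by rewrite -(pair_bigA _ (fun i b => g (i, b))); apply: eq_bigr => i _; rewrite big_bool.
Qed.

(** The indices [(i, false)] and [(i, true)] are the two members of a pair. Chaining is applied to
    traces on both at once, with masses [w z ^+ 2 / K]. The increments are divided by
    [2 * Num.sqrt K] to absorb the factor 2 that the square of a difference costs, which turns 9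
    into 18. Since [L] precedes the sample, the bound is uniform over samples. *)
Lemma rademacher_halfspaces {R : realType} {F : finType} (eta : R) : 0 < eta ->
  exists2 L : R, 1 <= L & forall (I : finType) (v : I * bool -> F -> R)
    (w : I * bool -> R) (K : R), 0 < K -> \sum_z w z ^+ 2 <= K ->
  #|[set e : {ffun I -> bool} | `[< exists p p' k,
      \sum_z w z ^+ 2 * (halfspace_ind p (v z) - halfspace_ind p' (v z)) ^+ 2
         <= K * 4^-1 ^+ k /\
      L * Num.sqrt K * (3 / 4) ^+ k <
        `|\sum_i (-1) ^+ e i *
           (w (i, false) * (halfspace_ind p (v (i, false)) - halfspace_ind p' (v (i, false)))
          - w (i, true) * (halfspace_ind p (v (i, true)) - halfspace_ind p' (v (i, true))))| >]]%SET|%:R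
  <= eta * #|{ffun I -> bool}|%:R.
Proof.
move=> eta0; have [L L1 chain] := @chaining R F eta eta0.
exists (18 * L); first lra.
move=> I v w K K0 wK.
set sK := Num.sqrt K; have sK0 : 0 < sK by rewrite sqrtr_gt0.
have sK2 : sK ^+ 2 = K by rewrite sqr_sqrtr // ltW.
pose q z := w z ^+ 2 / K.
pose a (A : {set I * bool}) i := (w (i, false) * ((i, false) \in A)%:R
                                - w (i, true) * ((i, true) \in A)%:R) / (2 * sK).
pose S A e := rademacher_sum (a A) e.
have SB A B e : S A e - S B e = rademacher_sum (fun i => a A i - a B i) e.
  by rewrite /S /rademacher_sum -sumrB; apply: eq_bigr => i _; rewrite mulrBr.
have q0 z : 0 <= q z by rewrite divr_ge0 ?sqr_ge0 ?ltW.
have massE A B : mass q (symdiff A B) =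
    (\sum_z w z ^+ 2 * ((z \in A)%:R - (z \in B)%:R) ^+ 2) / K.
  rewrite /mass big_mkcond mulr_suml; apply: eq_bigr => z _; rewrite in_symdiff /q.
  by case: (z \in A); case: (z \in B) => /=; field; rewrite gt_eqF.
have a2 A B : \sum_i (a A i - a B i) ^+ 2 <= mass q (symdiff A B).
  rewrite massE mulr_suml sum_pair_bool.
  apply: ler_sum => i _; rewrite /a -mulrBl expr_div_n -mulrDl.
  rewrite ler_pdivrMr; last by rewrite exprn_gt0 // mulr_gt0.
  rewrite [(2 * sK) ^+ 2]exprMn sK2 -mulrA [K^-1 * _]mulrCA mulVf ?gt_eqF // mulr1 -!exprMn.
  set x := w (i, false); set y := w (i, true).
  set r1 := ((i, false) \in A)%:R; set r2 := ((i, false) \in B)%:R.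
  set r3 := ((i, true) \in A)%:R; set r4 := ((i, true) \in B)%:R.
  have := sqr_ge0 (x * (r1 - r2) + y * (r3 - r4)).
  have := sqr_ge0 (x * (r1 - r2)); have := sqr_ge0 (y * (r3 - r4)).
  nra.
have /chain := q0 => /(_ v _ S)/(_ _ _ _).
move=> H; apply: le_trans (H _ _ _); first last.
- move=> A B s t s0 t0 ABs.
  have := @rademacher_tail _ _ (fun i => a A i - a B i) s t s0 t0 (le_trans (a2 A B) ABs).
  apply: le_trans; rewrite ler_nat; apply/subset_leq_card/fintype.subsetP => e.
  by rewrite !inE SB.
- move=> A B e m0; apply/eqP; rewrite -subr_eq0 SB; apply/eqP; apply: big1 => i _.
  have : (a A i - a B i) ^+ 2 <= 0.
    rewrite -m0; apply: le_trans (a2 A B); rewrite (bigD1 i) //= lerDl.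
    by apply: sumr_ge0 => j _; apply: sqr_ge0.
  rewrite le_eqVlt ltNge sqr_ge0 orbF sqrf_eq0 => /eqP ->; exact: mulr0.
- by rewrite -mulr_suml ler_pdivrMr // mul1r.
rewrite ler_nat; apply/subset_leq_card/fintype.subsetP => e; rewrite !inE.
move=> [p [p' [k [h1 h2]]]].
pose tr (p : F -> R) : {set I * bool} := [set z | 0 <= affine_form p (v z)].
have trT r : tr r \in traces v by apply/tracesP; exists r => j; rewrite inE.
have trE r z : (z \in tr r)%:R = halfspace_ind r (v z) by rewrite inE.
exists (tr p), (tr p'), k; split => //.
  by rewrite massE ler_pdivrMr // mulrC; under eq_bigr do rewrite !trE.
rewrite SB.
have -> : rademacher_sum (fun i => a (tr p) i - a (tr p') i) e =
   (\sum_i (-1) ^+ e i *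
           (w (i, false) * (halfspace_ind p (v (i, false)) - halfspace_ind p' (v (i, false)))
          - w (i, true) * (halfspace_ind p (v (i, true)) - halfspace_ind p' (v (i, true))))) / (2 * sK).
  rewrite mulr_suml; apply: eq_bigr => i _; rewrite /a !trE -mulrBl -mulrA; congr (_ * (_ * _)).
  by ring.
rewrite normrM [`|_^-1|]ger0_norm; last by rewrite invr_ge0 mulr_ge0 // ltW.
rewrite ltr_pdivlMr ?mulr_gt0 //; apply: le_lt_trans h2.
by rewrite le_eqVlt; apply/orP; left; apply/eqP; ring.
Qed.

Local Open Scope classical_set_scope.
Local Open Scope ring_scope.
Import HBSimple.

(** * Independent samples *)

Section ProductSigmaAlgebra.
Context {d} {T : measurableType d} {J : finType}.

Definition cylinders : set (set (J -> T)) :=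
  [set A | exists2 B : J -> set T, (forall j, measurable (B j)) &
     A = [set x | forall j, B j (x j)]].

(** The product sigma-algebra on [J -> T], for any finite [J]: a single sample is indexed by ['I_n],
    a doubled one by ['I_n * bool]. *)
Definition families := g_sigma_algebraType cylinders.

Lemma setI_closed_cylinders : setI_closed cylinders.
Proof.
move=> _ _ [B mB ->] [B' mB' ->]; exists (fun j => B j `&` B' j).
  by move=> j; apply: measurableI.
by apply/seteqP; split => x /=; [move=> [h1 h2] j|move=> h; split => j; have [] := h j].
Qed.

Lemma families_ind (Q : set (J -> T) -> Prop) :
  (forall B : J -> set T, (forall j, measurable (B j)) -> Q [set x | forall j, B j (x j)]) ->
  (forall S : set families, measurable S -> Q S -> Q (~` S)) ->
  (forall S : (set families)^nat, (forall n, measurable (S n)) -> trivIset setT S ->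
     (forall n, Q (S n)) -> Q (\bigcup_n S n)) ->
  forall S : set families, measurable S -> Q S.
Proof.
move=> Qcyl QC QU S mS.
apply: (@dynkin_induction _ families cylinders Q) => //.
- exact: setI_closed_cylinders.
- by have := Qcyl (fun=> setT) (fun=> measurableT); congr Q; apply/seteqP.
- by move=> _ [B mB ->]; apply: Qcyl.
Qed.

Lemma measurable_eval (j : J) : measurable_fun setT (fun x : families => x j).
Proof.
move=> _ B mB; rewrite setTI; apply: sub_gen_smallest.
exists (fun i => if i == j then B else setT).
  by move=> i; case: ifP.
apply/seteqP; split => x /=; last by move=> /(_ j); rewrite eqxx.
by move=> Bx i; case: eqP => [->|].
Qed.

Lemma measurable_family {d'} {Omega : measurableType d'} (M : Omega -> J -> T) :
  (forall j, measurable_fun setT (M ^~ j)) -> measurable_fun setT (M : Omega -> families).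
Proof.
move=> mM; apply: (@measurability _ _ Omega families setT M cylinders) => //.
move=> _ [_ [B mB ->] <-]; rewrite setTI.
have -> : M @^-1` [set x | forall j, B j (x j)] =
    \bigcap_(j in [set: J]) (M ^~ j @^-1` B j).
  by apply/seteqP; split => w /=; [move=> h j _; exact: h|move=> h j; exact: h].
apply: fin_bigcap_measurable; first exact: finite_finset.
by move=> j _; rewrite -[X in measurable X]setTI; apply: mM.
Qed.

End ProductSigmaAlgebra.
Arguments cylinders {d} T J.
Arguments families {d} T J.

Lemma trivIset_preimage {T1 T2 : Type} (f : T1 -> T2) (S : (set T2)^nat) :
  trivIset setT S -> trivIset setT (fun n => f @^-1` (S n)).
Proof.
move=> /trivIsetP tS; apply/trivIsetP => i j _ _ ij.
by rewrite -preimage_setI tS // preimage_set0.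
Qed.

Section Independence.
Context {d} {T : measurableType d} {R : realType} {dd} {Omega : measurableType dd}.
Context (Pr : probability Omega R) (P : probability T R) (Xs : nat -> Omega -> T).

Definition iid_sequence := [/\ forall i, measurable_fun setT (Xs i),
  forall i B, measurable B -> Pr (Xs i @^-1` B) = P B &
  forall (I : seq nat) (B : nat -> set T), uniq I -> (forall i, measurable (B i)) ->
    Pr (\bigcap_(i in [set i | i \in I]) (Xs i @^-1` B i)) = (\prod_(i <- I) P (B i))%E].

Hypothesis iid : iid_sequence.

(** Blocks, the doubled sample and the exchange of its halves all arise by varying [iota]. *)
Definition sample {J : finType} (iota : J -> nat) (w : Omega) (j : J) : T := Xs (iota j) w.

Lemma measurable_Xs i : measurable_fun setT (Xs i).
Proof. by case: iid. Qed.

Lemma measurable_sample {J : finType} (iota : J -> nat) :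
  measurable_fun setT (sample iota : Omega -> families T J).
Proof. by apply: measurable_family => j; apply: measurable_Xs. Qed.

Lemma measurable_sample_preimage {J : finType} (iota : J -> nat) (S : set (families T J)) :
  measurable S -> measurable (sample iota @^-1` S).
Proof. by move=> mS; rewrite -[X in measurable X]setTI; apply: measurable_sample. Qed.

Lemma law_sample_cylinder {J : finType} (iota : J -> nat) (B : J -> set T) :
  injective iota -> (forall j, measurable (B j)) ->
  Pr (sample iota @^-1` [set x | forall j, B j (x j)]) = (\prod_j P (B j))%E.
Proof.
move=> inj mB; case: iid => _ _ indep.
pose B' i := if [pick j | iota j == i] is Some j then B j else setT.
have B'E j : B' (iota j) = B j.
  by rewrite /B'; case: pickP => [j' /eqP/inj ->|/(_ j)] //; rewrite eqxx.
have := indep (map iota (enum J)) B'; rewrite map_inj_uniq // enum_uniq => /(_ isT).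
have mB' i : measurable (B' i) by rewrite /B'; case: pickP => // j _; exact: mB.
move=> /(_ mB'); rewrite big_map big_enum /=; under eq_bigr do rewrite B'E.
move=> <-; congr (Pr _); apply/seteqP; split => w /=.
  by move=> h _ /mapP[j _ ->] /=; rewrite B'E; exact: h.
by move=> h j; have := h (iota j); rewrite /= B'E; apply; rewrite map_f // mem_enum.
Qed.

Lemma exchangeable {J : finType} (iota iota' : J -> nat) (S : set (families T J)) :
  injective iota -> injective iota' -> measurable S ->
  Pr (sample iota @^-1` S) = Pr (sample iota' @^-1` S).
Proof.
move=> inj inj'; move: S; apply: families_ind => [B mB|S mS E|S mS tS E].
- by rewrite !law_sample_cylinder.
- have pC i : Pr (sample i @^-1` (~` S)) = (1 - Pr (sample i @^-1` S))%E.
    by rewrite -probability_setC //; exact: measurable_sample_preimage.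
  by rewrite !pC E.
- have pU i : Pr (sample i @^-1` (\bigcup_n S n)) =
      (\sum_(0 <= n <oo) Pr (sample i @^-1` (S n)))%E.
    rewrite preimage_bigcup measure_bigcup.
    + by apply: eq_eseriesl => n; rewrite in_setT.
    + by move=> n _; apply: measurable_sample_preimage.
    + exact: trivIset_preimage.
  by rewrite !pU; apply: eq_eseriesr => n _; exact: E.
Qed.

(** [E] is an arbitrary event, so that the extension from cylinders can be carried out for one block
    at a time. *)
Lemma independent_dynkin {J : finType} (iota : J -> nat) (E : set Omega) :
  measurable E ->
  (forall B, (forall j, measurable (B j)) ->
    Pr (sample iota @^-1` [set x | forall j, B j (x j)] `&` E) =
    (Pr (sample iota @^-1` [set x | forall j, B j (x j)]) * Pr E)%E) ->
  forall S : set (families T J), measurable S ->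
  Pr (sample iota @^-1` S `&` E) = (Pr (sample iota @^-1` S) * Pr E)%E.
Proof.
move=> mE base; have [e Ee] : exists e, Pr E = e%:E.
  by exists (fine (Pr E)); rewrite fineK // fin_num_measure.
apply: families_ind => [//|S mS IH|S mS tS IH].
- have mpS := measurable_sample_preimage iota mS.
  have -> : sample iota @^-1` (~` S) `&` E = E `\` (sample iota @^-1` S).
    by rewrite preimage_setC setIC.
  have -> : Pr (sample iota @^-1` (~` S)) = (1 - Pr (sample iota @^-1` S))%E.
    by rewrite -probability_setC.
  have Efin : (Pr E < +oo)%E by rewrite Ee ltry.
  have -> : Pr (E `\` sample iota @^-1` S) = (Pr E - Pr (sample iota @^-1` S `&` E))%E.
    by rewrite setIC; exact: measureD.
  rewrite IH Ee; have [r ->] : exists r, Pr (sample iota @^-1` S) = r%:E.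
    by exists (fine (Pr (sample iota @^-1` S))); rewrite fineK // fin_num_measure.
  by rewrite -EFinM -!EFinB -EFinM mulrBl mul1r.
- have -> : Pr (sample iota @^-1` (\bigcup_n S n)) =
      (\sum_(0 <= n <oo) Pr (sample iota @^-1` (S n)))%E.
    rewrite preimage_bigcup measure_bigcup.
    + by apply: eq_eseriesl => n; rewrite in_setT.
    + by move=> n _; apply: measurable_sample_preimage.
    + exact: trivIset_preimage.
  have -> : Pr (sample iota @^-1` (\bigcup_n S n) `&` E) =
      (\sum_(0 <= n <oo) Pr (sample iota @^-1` (S n) `&` E))%E.
    rewrite preimage_bigcup setI_bigcupl measure_bigcup.
    + by apply: eq_eseriesl => n; rewrite in_setT.
    + by move=> n _; apply: measurableI => //; apply: measurable_sample_preimage.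
    + by apply: trivIset_setIr; exact: trivIset_preimage.
  rewrite muleC Ee -nneseriesZl; last by move=> n _; exact: measure_ge0.
  by apply: eq_eseriesr => n _; rewrite IH Ee muleC.
Qed.

Lemma independent_blocks {J1 J2 : finType} (iota1 : J1 -> nat) (iota2 : J2 -> nat)
    (S1 : set (families T J1)) (S2 : set (families T J2)) :
  injective iota1 -> injective iota2 -> (forall j1 j2, iota1 j1 <> iota2 j2) ->
  measurable S1 -> measurable S2 ->
  Pr (sample iota1 @^-1` S1 `&` sample iota2 @^-1` S2) =
  (Pr (sample iota1 @^-1` S1) * Pr (sample iota2 @^-1` S2))%E.
Proof.
move=> inj1 inj2 disj mS1 mS2.
apply: independent_dynkin => //; first exact: measurable_sample_preimage.
move=> B mB; rewrite setIC muleC; apply: independent_dynkin => //.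
  apply: measurable_sample_preimage; apply: sub_gen_smallest; by exists B.
move=> B' mB'; rewrite !law_sample_cylinder //.
pose iota (j : J2 + J1) := match j with inl j => iota2 j | inr j => iota1 j end.
pose BB (j : J2 + J1) := match j with inl j => B' j | inr j => B j end.
transitivity (\prod_j P (BB j))%E; last by rewrite big_sumType.
rewrite -(@law_sample_cylinder _ iota) //.
- congr (Pr _); apply/seteqP; split => w /=; first by move=> [h1 h2] [j|j]; [exact: h1|exact: h2].
  by move=> h; split => j; [exact: (h (inl j))|exact: (h (inr j))].
- move=> [j|j] [j'|j'] /=; [by move/inj2 ->| | |by move/inj1 ->].
    by move=> /esym/disj.
  by move=> /disj.
- by case.
Qed.

End Independence.

(** * Expectations under the common law and square integrability *)

Section Moments.
Context {d} {T : measurableType d} {R : realType} {dd} {Omega : measurableType dd}.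
Context (Pr : probability Omega R) (P : probability T R) (Xs : nat -> Omega -> T).
Hypothesis iid : iid_sequence Pr P Xs.

Let mX i : measurable_fun setT (Xs i) := measurable_Xs iid i.

Lemma markov_nonneg (Z : Omega -> R) (a : R) : measurable_fun setT Z ->
  (forall w, 0 <= Z w) -> 0 < a ->
  (Pr [set w | (a <= Z w)%R] <= a^-1%:E * \int[Pr]_w (Z w)%:E)%E.
Proof.
move=> mZ Z0 a0.
have mEZ : measurable_fun setT (EFin \o Z) by apply/measurable_EFinP.
have := le_integral_abse Pr measurableT mEZ a0.
rewrite setTI -lee_pdivlMl //; under eq_integral do rewrite /= ger0_norm //.
congr (_ <= _)%E; congr (Pr _); apply/seteqP; split => w /=; by rewrite lee_fin ger0_norm.
Qed.

Lemma ge0_integral_Xs i (f : T -> \bar R) : measurable_fun setT f ->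
  (forall x, (0 <= f x)%E) -> (\int[Pr]_w f (Xs i w) = \int[P]_x f x)%E.
Proof.
move=> mf f0; have := @ge0_integral_pushforward _ _ _ _ R _ (mX i) Pr setT f measurableT mf (fun x _ => f0 x).
rewrite preimage_setT => <-; apply: eq_measure_integral => A mA _.
by case: iid => _ law _; exact: law.
Qed.

Lemma integrable_Xs i (f : T -> \bar R) : P.-integrable setT f ->
  Pr.-integrable setT (f \o Xs i).
Proof.
move=> /integrableP[mf fi]; apply/integrableP; split; first exact: measurableT_comp.
rewrite (ge0_integral_Xs i (f := fun x => `|f x|%E)) //.
exact: measurableT_comp.
Qed.

Lemma integral_Xs i (f : T -> \bar R) : P.-integrable setT f ->
  (\int[Pr]_w f (Xs i w) = \int[P]_x f x)%E.
Proof.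
move=> fi; have /integrableP[mf _] := fi.
have := @integral_pushforward _ _ _ _ R _ (mX i) Pr setT f mf.
rewrite preimage_setT => /(_ (integrable_Xs i fi) measurableT) <-.
apply: eq_measure_integral => A mA _.
by case: iid => _ law _; exact: law.
Qed.

Lemma law_pair i j (S : set (T * T)) : i != j -> measurable S ->
  Pr ((fun w => (Xs i w, Xs j w)) @^-1` S) = (P \x P)%E S.
Proof.
move=> ij mS; have mp : measurable_fun setT (fun w => (Xs i w, Xs j w)).
  exact: measurable_fun_pair.
pose p : {mfun Omega >-> (T * T)%type} :=
  HB.pack (fun w => (Xs i w, Xs j w)) (isMeasurableFun.Build _ _ _ _ _ mp).
apply/esym/(@product_measure_unique _ _ _ _ _ P P (distribution Pr p)) => // A B mA mB.
rewrite /distribution /pushforward /=.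
case: iid => _ _ indep.
have := indep [:: i; j] (fun k => if k == i then A else B).
rewrite /= inE ij => /(_ isT) h; rewrite !big_cons big_nil eqxx eq_sym (negbTE ij) mule1 in h.
rewrite -h; last by move=> k; case: ifP.
congr (Pr _); apply/seteqP; split => w /=.
  move=> [wA wB] k /=; rewrite !inE => /orP[/eqP->|/eqP->]; rewrite ?eqxx //.
  by rewrite eq_sym (negbTE ij).
move=> h'; split; [have := h' i|have := h' j]; rewrite /= !inE !eqxx ?orbT => /(_ isT) //.
by rewrite eq_sym (negbTE ij).
Qed.

(** Fubini's theorem under [P \x P], the joint law of [Xs i] and [Xs j]. Integrability of the
    product comes from Tonelli's theorem and the integrability of [h]. *)
Lemma integral_cross i j (h : T -> R) : i != j -> measurable_fun setT h ->
  P.-integrable setT (EFin \o h) -> \int[P]_x h x = 0 ->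
  Pr.-integrable setT (fun w => (h (Xs i w) * h (Xs j w))%:E) /\
  (\int[Pr]_w (h (Xs i w) * h (Xs j w))%:E = 0)%E.
Proof.
move=> ij mh ih h0.
have mp : measurable_fun setT (fun w => (Xs i w, Xs j w)) by exact: measurable_fun_pair.
pose p : {mfun Omega >-> (T * T)%type} :=
  HB.pack (fun w => (Xs i w, Xs j w)) (isMeasurableFun.Build _ _ _ _ _ mp).
have Ih0 : (\int[P]_x (h x)%:E = 0)%E.
  by rewrite -[LHS]fineK ?integrable_fin_num //; congr (_%:E).
pose H (z : T * T) := (h z.1 * h z.2)%:E.
have mH : measurable_fun setT H.
  by apply/measurable_EFinP; apply: measurable_funM; apply: measurableT_comp.
have iH : (P \x P)%E.-integrable setT H.
  apply/integrable12ltyP => //.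
  have ih' : P.-integrable setT (fun x => `|h x|%:E) by exact: (integrable_norm ih).
  have [c cE] : exists c, (\int[P]_y `|h y|%:E = c%:E)%E.
    by exists (\int[P]_y `|h y|); rewrite fineK // integrable_fin_num.
  rewrite (_ : (fun x => _) = (fun x => `|h x|%:E * c%:E)%E).
    by rewrite integralZr // cE -EFinM ltry.
  apply/funext => x; rewrite -cE -ge0_integralZl_EFin //.
    by apply: eq_integral => y _; rewrite -EFinM /H /= normrM.
  by case/integrableP: ih'.
have pE : forall S, measurable S -> distribution Pr p S = (P \x P)%E S.
  by move=> S mS; exact: law_pair.
have ip : Pr.-integrable setT (H \o p).
  apply/integrableP; split; first exact: measurableT_comp.
  have mH' : measurable_fun setT (fun z => `|H z|%E) by exact: measurableT_comp.
  have := @ge0_integral_distribution _ _ _ _ _ Pr p (fun z => `|H z|%E) mH' (fun=> abse_ge0 _).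
  rewrite /comp => <-.
  have /integrableP[_] := iH; congr (_ < _)%E; apply/esym.
  by apply: eq_measure_integral => S mS _; exact: pE.
split; first exact: ip.
transitivity (\int[distribution Pr p]_z H z)%E.
  by rewrite (integral_distribution _ ip).
transitivity (\int[P \x P]_z H z)%E.
  by apply: eq_measure_integral => S mS _; exact: pE.
rewrite -integral12_prod_meas1 //; apply: integral0_eq => x _.
rewrite /fubini_F /H /=; under eq_integral do rewrite EFinM.
by rewrite integralZl // Ih0 mule0.
Qed.

End Moments.

Section SquareIntegrable.
Context {d} {T : measurableType d} {R : realType} (P : probability T R).

Definition square_integrable (g : T -> R) :=
  measurable_fun setT g /\ P.-integrable setT (fun x => (g x ^+ 2)%:E).

Lemma integrable_cst_prob (c : R) : P.-integrable setT (fun=> c%:E).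
Proof. exact: finite_measure_integrable_cst. Qed.

Lemma Rintegral_cst_prob (c : R) : \int[P]_x c = c.
Proof.
by rewrite /Rintegral integral_cst //; rewrite [X in (_ * X)%E](_ : _ = 1%E) ?mule1 //; exact: probability_setT.
Qed.

Lemma square_integrableM (f g : T -> R) : square_integrable f -> square_integrable g ->
  P.-integrable setT (fun x => (f x * g x)%:E).
Proof.
move=> [mf if2] [mg ig2].
apply: (le_integrable measurableT _ _ (integrableD measurableT if2 ig2)).
  by apply/measurable_EFinP; exact: measurable_funM.
move=> x _; rewrite /= lee_fin [leRHS]ger0_norm; last by rewrite addr_ge0 ?sqr_ge0.
rewrite normrM -[f x ^+ 2]real_normK ?num_real // -[g x ^+ 2]real_normK ?num_real //.
set a := `|f x|; set b := `|g x|; have := sqr_ge0 (a - b).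
have : 0 <= a * b by rewrite mulr_ge0 ?normr_ge0.
nra.
Qed.

Lemma square_integrable_cst (c : R) : square_integrable (fun=> c).
Proof. by split; [exact: measurable_cst|exact: integrable_cst_prob]. Qed.

Lemma square_integrable1 (g : T -> R) : square_integrable g ->
  P.-integrable setT (EFin \o g).
Proof.
move=> g2; have := square_integrableM g2 (square_integrable_cst 1).
by under eq_fun do rewrite mulr1.
Qed.

Lemma square_integrableD (f g : T -> R) : square_integrable f -> square_integrable g ->
  square_integrable (fun x => f x + g x).
Proof.
move=> f2 g2; have [mf if2] := f2; have [mg ig2] := g2; split; first exact: measurable_funD.
have := integrableD measurableT (integrableD measurableT if2 ig2)
  (integrableD measurableT (square_integrableM f2 g2) (square_integrableM f2 g2)).
apply: eq_integrable => // x _ /=; rewrite -!EFinD; congr (_%:E); ring.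
Qed.

Lemma square_integrableZ (c : R) (g : T -> R) : square_integrable g ->
  square_integrable (fun x => c * g x).
Proof.
move=> [mg ig2]; split; first exact: measurable_funM.
have := integrableZl measurableT (c ^+ 2) ig2.
by apply: eq_integrable => // x _ /=; rewrite -EFinM exprMn.
Qed.

Lemma square_integrableB_cst (g : T -> R) (c : R) : square_integrable g ->
  square_integrable (fun x => g x - c).
Proof. by move=> g2; apply: square_integrableD => //; exact: square_integrable_cst. Qed.

Lemma square_integrable_le (f g : T -> R) : measurable_fun setT f -> square_integrable g ->
  (forall x, `|f x| <= `|g x|) -> square_integrable f.
Proof.
move=> mf [mg ig2] fg; split => //.
apply: (le_integrable measurableT _ _ ig2).
  by apply/measurable_EFinP; exact: measurable_funX.
move=> x _; rewrite /= lee_fin !normrX; apply: lerXn2r; rewrite ?nnegrE //.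
Qed.

Lemma centered_sqr_le (g : T -> R) : square_integrable g ->
  \int[P]_x (g x - \int[P]_y g y) ^+ 2 <= \int[P]_x (g x ^+ 2).
Proof.
move=> g2; have [mg ig2] := g2; set m := \int[P]_y g y.
have ig := square_integrable1 g2.
have E x : (g x - m) ^+ 2 = g x ^+ 2 - (2 * m * g x - m ^+ 2) by ring.
have i1 : P.-integrable setT (EFin \o (fun x => 2 * m * g x)).
  by have := integrableZl measurableT (2 * m) ig; apply: eq_integrable => // x _; rewrite /= EFinM.
have i2 : P.-integrable setT (EFin \o (fun=> m ^+ 2)) by exact: integrable_cst_prob.
under eq_Rintegral do rewrite E.
rewrite RintegralB //; last first.
  by have := integrableB measurableT i1 i2; apply: eq_integrable => // x _; rewrite /= EFinB.
rewrite RintegralB // RintegralZl // Rintegral_cst_prob -/m.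
rewrite lerBlDr lerDl; have := sqr_ge0 m; nra.
Qed.

End SquareIntegrable.

Section LevelSets.
Context {d} {T : measurableType d} {R : realType}.

Lemma measurable_set_ge (f : T -> R) (a : R) : measurable_fun setT f ->
  measurable [set x | a <= f x].
Proof.
move=> mf; rewrite (_ : [set x | _] = setT `&` f @^-1` `[a, +oo[%classic).
  exact: mf.
by apply/seteqP; split => x /=; rewrite in_itv /= andbT; [|case].
Qed.

Lemma measurable_set_gt (f : T -> R) (a : R) : measurable_fun setT f ->
  measurable [set x | a < f x].
Proof.
move=> mf; rewrite (_ : [set x | _] = setT `&` f @^-1` `]a, +oo[%classic).
  exact: mf.
by apply/seteqP; split => x /=; rewrite in_itv /= andbT; [|case].
Qed.

End LevelSets.

(** * Chebyshev's inequality and the weak law of large numbers *)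

Section Chebyshev.
Context {d} {T : measurableType d} {R : realType} {dd} {Omega : measurableType dd}.
Context (Pr : probability Omega R) (P : probability T R) (Xs : nat -> Omega -> T).
Hypothesis iid : iid_sequence Pr P Xs.

Let mX i : measurable_fun setT (Xs i) := measurable_Xs iid i.

Lemma integral_sum_sqr {J : finType} (iota : J -> nat) (h : T -> R) :
  injective iota -> square_integrable P h -> \int[P]_x h x = 0 ->
  (\int[Pr]_w ((\sum_j h (Xs (iota j) w)) ^+ 2)%:E =
   (#|J|%:R * \int[P]_x (h x ^+ 2))%:E)%E.
Proof.
move=> inj h2 h0; have [mh ih2] := h2; have ih := square_integrable1 h2.
pose f (z : J * J) (w : Omega) := (h (Xs (iota z.1) w) * h (Xs (iota z.2) w))%:E.
have fE w : ((\sum_j h (Xs (iota j) w)) ^+ 2)%:E = (\sum_z f z w)%E.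
  rewrite expr2 big_distrl /= sumEFin; congr (_%:E).
  under eq_bigr do rewrite big_distrr /=.
  by rewrite pair_bigA.
have fi z : Pr.-integrable setT (f z) /\
    (\int[Pr]_w f z w = ((z.1 == z.2)%:R * \int[P]_x (h x ^+ 2))%:E)%E.
  case: z => i j; rewrite /f /=; have [<-|ij] := eqVneq i j.
    have E : (fun w => (h (Xs (iota i) w) * h (Xs (iota i) w))%:E) =
        (fun x => (h x ^+ 2)%:E) \o Xs (iota i) by [].
    rewrite E; split; first exact: (integrable_Xs iid).
    by rewrite (integral_Xs iid _ ih2) mul1r fineK // integrable_fin_num.
  rewrite mul0r; apply: (integral_cross iid) => //.
  by apply: contra ij => /eqP/inj ->.
under eq_integral do rewrite fE.
rewrite integral_sum //; last by move=> z; exact: (fi z).1.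
under eq_bigr do rewrite (fi _).2.
rewrite sumEFin -mulr_suml; congr ((_ * _)%:E).
rewrite -natr_sum -(pair_bigA _ (fun i j => (i == j : nat))) /= -sum1_card; congr (_%:R).
apply: eq_bigr => i _; rewrite (bigD1 i) //= eqxx big1 ?addn0 // => j /negbTE.
by rewrite eq_sym => ->.
Qed.

Lemma measurable_sum_Xs {J : finType} (iota : J -> nat) (h : T -> R) :
  measurable_fun setT h -> measurable_fun setT (fun w => \sum_j h (Xs (iota j) w)).
Proof.
move=> mh; apply: measurable_sum => j; exact: measurableT_comp.
Qed.

Lemma chebyshev_sum {J : finType} (iota : J -> nat) (g : T -> R) (a : R) :
  injective iota -> square_integrable P g -> 0 < a ->
  (Pr [set w | (a <= `|\sum_j (g (Xs (iota j) w) - \int[P]_x g x)|)%R] <=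
   (#|J|%:R * \int[P]_x (g x ^+ 2) / a ^+ 2)%:E)%E.
Proof.
move=> inj g2 a0; set m := \int[P]_x g x.
pose h x := g x - m; have h2 : square_integrable P h by exact: square_integrableB_cst.
have h0 : \int[P]_x h x = 0.
  rewrite /h RintegralB //; first by rewrite Rintegral_cst_prob subrr.
  - exact: square_integrable1.
  - exact: integrable_cst_prob.
have mS : measurable_fun setT (fun w => (\sum_j h (Xs (iota j) w)) ^+ 2).
  by apply: measurable_funX; apply: (measurable_sum_Xs iota (h := h)); case: h2.
have := markov_nonneg Pr mS (fun w => sqr_ge0 _) (exprn_gt0 2 a0).
rewrite (integral_sum_sqr inj h2 h0) => H; apply: le_trans (le_trans H _).
  apply/le_measure; rewrite ?inE.
  + apply: measurable_set_ge; apply: measurableT_comp => //.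
    by apply: (measurable_sum_Xs iota (h := h)); case: h2.
  + exact: (measurable_set_ge _ mS).
  move=> w /= aw; rewrite -[leRHS]real_normK ?num_real //.
  by rewrite ler_pXn2r // nnegrE ltW.
rewrite -EFinM lee_fin mulrC ler_wpM2r ?invr_ge0 ?sqr_ge0 // ler_wpM2l //.
exact: centered_sqr_le.
Qed.

Lemma bounded_square_integrable (g : {sfun T >-> R}) : square_integrable P (fun x => g x).
Proof.
have [M gM] : exists M, forall x, `|g x| <= M.
  have [M [_ /= bdM]] := simple_bounded g.
  by exists (M + 1) => x; apply: bdM => //; rewrite ltrDl.
apply: (square_integrable_le _ (square_integrable_cst P M)) => // x.
by apply: le_trans (gM x) (ler_norm _).
Qed.

(** Approximate [f] in L^1 by a simple function [g]: Markov's inequality handles [f - g],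
    Chebyshev's the bounded [g]. Only first moments may be used, because the law is applied to
    [w ^+ 2] with [w] merely square integrable. *)
Lemma wlln (f : T -> R) (eps eta : R) : measurable_fun setT f ->
  P.-integrable setT (EFin \o f) -> 0 < eps -> 0 < eta ->
  exists n0, forall (J : finType) (iota : J -> nat), injective iota -> (n0 <= #|J|)%N ->
  (Pr [set w | (eps * #|J|%:R <= `|\sum_j (f (Xs (iota j) w) - \int[P]_x f x)|)%R] <= eta%:E)%E.
Proof.
move=> mf fi eps0 eta0.
(* The deviation splits as [eps / 4 + eps / 2 + eps / 4], for [f - g], for [g] and for the
   difference of the means. The second bound on [del] makes Markov's inequality yield [eta / 2]. *)
pose del := Num.min (eps / 4) (eta * eps / 8).
have del0 : 0 < del by rewrite lt_min !divr_gt0 // mulr_gt0.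
have [g gdel] : exists g : {sfun T >-> R}, (\int[P]_x `|f x - g x|%:E <= del%:E)%E.
  have [gs [_ _ /fine_cvgP[gfin gcvg]]] := approximation_sfun_integrable measurableT fi.
  pose I k := (\int[P]_x `|(f x)%:E - (gs k x)%:E|)%E.
  have [k [kfin kdel]] : exists k, I k \is a fin_num /\ `|fine (I k)| < del.
    have dl : \forall k \near \oo, `|fine (I k)| < del := cvgr0_norm_lt _ gcvg _ del0.
    near \oo => k; exists k; split; near: k; [exact: gfin|exact: dl].
  exists (gs k); have -> : (\int[P]_x `|f x - gs k x|%:E = I k)%E.
    by apply: eq_integral => x _; rewrite -EFinB abse_EFin.
  by rewrite -(fineK kfin) lee_fin (le_trans (ler_norm _)) // ltW.
have g2 := bounded_square_integrable g; have gi := square_integrable1 g2.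
pose m := \int[P]_x f x; pose mg := \int[P]_x g x; pose V := \int[P]_x (g x ^+ 2).
have V0 : 0 <= V by apply: Rintegral_ge0 => x _; exact: sqr_ge0.
have fgi : P.-integrable setT (EFin \o (fun x => f x - g x)).
  by have := integrableB measurableT fi gi; apply: eq_integrable => // x _; rewrite /= EFinB.
have mgm : `|mg - m| <= del.
  rewrite distrC -RintegralB //; apply: le_trans (le_normr_Rintegral _ fgi) _ => //.
  rewrite -lee_fin fineK //; apply: integrable_fin_num => //.
  exact: (integrable_norm fgi).
(* Chebyshev's inequality gives [4 * V / (eps ^+ 2 * N)], which is at most [eta / 2] from here
   on. *)
exists (Num.bound (8 * V / (eps ^+ 2 * eta))).+1 => J iota inj nJ.
set N : R := #|J|%:R.
have NV : 8 * V / (eps ^+ 2 * eta) <= N.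
  apply: (le_trans (ltW (archi_boundP _))).
    by rewrite divr_ge0 ?mulr_ge0 ?sqr_ge0 // ltW.
  by rewrite ler_nat; apply: leq_trans nJ.
have N0 : 0 < N by rewrite ltr0n; apply: leq_trans nJ.
pose S1 w := \sum_j `|f (Xs (iota j) w) - g (Xs (iota j) w)|.
pose S2 w := `|\sum_j (g (Xs (iota j) w) - mg)|.
have mfg : measurable_fun setT (fun x => `|f x - g x|).
  by apply: measurableT_comp => //; apply: measurable_funB.
have mS1 : measurable_fun setT S1 by exact: (measurable_sum_Xs iota mfg).
have mS2 : measurable_fun setT S2.
  apply: measurableT_comp => //; apply: (measurable_sum_Xs iota (h := fun x => g x - mg)).
  exact: measurable_funB.
have E1 : (Pr [set w | (eps / 4 * N <= S1 w)%R] <= (eta / 2)%:E)%E.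
  have en : 0 < eps / 4 * N by rewrite mulr_gt0 // divr_gt0.
  have S10 w : 0 <= S1 w by apply: sumr_ge0.
  apply: (le_trans (markov_nonneg Pr mS1 S10 en)).
  have IS1 : (\int[Pr]_w (S1 w)%:E <= (N * del)%:E)%E.
    under eq_integral do rewrite /S1 -sumEFin.
    rewrite ge0_integral_sum //; last by move=> j; apply/measurable_EFinP; exact: (measurableT_comp mfg).
    have fgE : measurable_fun setT (fun x => `|f x - g x|%:E) by apply/measurable_EFinP.
    under eq_bigr do rewrite (ge0_integral_Xs iid _ fgE) //.
    apply: (@le_trans _ _ (\sum_(j in J) del%:E)%E); first exact: lee_sum.
    by rewrite sumEFin sumr_const mulr_natl.
  apply: (le_trans (lee_wpmul2l _ IS1)); first by rewrite lee_fin invr_ge0 ltW.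
  rewrite -EFinM lee_fin ler_pdivrMl //.
  have : del <= eta * eps / 8 by rewrite ge_min lexx orbT.
  move=> /(ler_wpM2l (ltW N0)); lra.
have E2 : (Pr [set w | (eps / 2 * N <= S2 w)%R] <= (eta / 2)%:E)%E.
  have en : 0 < eps / 2 * N by rewrite mulr_gt0 // divr_gt0.
  apply: (le_trans (chebyshev_sum inj g2 en)); rewrite lee_fin -/N -/V.
  move: NV; rewrite ler_pdivrMr ?mulr_gt0 ?exprn_gt0 // => NV.
  rewrite ler_pdivrMr ?exprn_gt0 // !exprMn.
  have := ler_wpM2l (ltW N0) NV; rewrite expr2; set e2 := eps ^+ 2; nra.
have sub : [set w | (eps * N <= `|\sum_j (f (Xs (iota j) w) - m)|)%R] `<=`
    [set w | (eps / 4 * N <= S1 w)%R] `|` [set w | (eps / 2 * N <= S2 w)%R].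
  move=> w /=; have [|h1] := leP (eps / 4 * N) (S1 w); first by left.
  have [|h2] := leP (eps / 2 * N) (S2 w); first by right.
  have -> : \sum_j (f (Xs (iota j) w) - m) = \sum_j (f (Xs (iota j) w) - g (Xs (iota j) w)) +
     \sum_j (g (Xs (iota j) w) - mg) + N * (mg - m).
    by rewrite /N mulr_natl -sumr_const -!big_split /=; apply: eq_bigr => j _; ring.
  move=> h; exfalso; move: h; apply/negP; rewrite -ltNge.
  apply: (le_lt_trans (ler_normD _ _)); apply: (le_lt_trans (lerD (ler_normD _ _) (lexx _))).
  rewrite normrM [`|N|]ger0_norm ?ltW // -/(S2 w).
  have d4 : del <= eps / 4 by rewrite ge_min lexx.
  have := ler_wpM2l (ltW N0) (le_trans mgm d4).
  have : `|\sum_j (f (Xs (iota j) w) - g (Xs (iota j) w))| <= S1 w by apply: ler_norm_sum.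
  lra.
apply: le_trans (_ : _ <= (eta / 2)%:E + (eta / 2)%:E)%E _; last by rewrite -EFinD lee_fin; lra.
apply: le_trans (leeD E1 E2); apply: le_trans (le_measure _ _ _ sub) _.
- apply/mem_set/measurable_set_ge; apply: measurableT_comp => //.
  apply: (measurable_sum_Xs iota (h := fun x => f x - m)); exact: measurable_funB.
- by apply/mem_set/measurableU; apply: measurable_set_ge.
by apply: measureU2; apply: measurable_set_ge.
Unshelve. all: by end_near. Qed.

End Chebyshev.

(** * Symmetrization *)

Section Symmetrization.
Context {d} {T : measurableType d} {R : realType} {dd} {Omega : measurableType dd}.
Context (Pr : probability Omega R) (P : probability T R) (Xs : nat -> Omega -> T).
Hypothesis iid : iid_sequence Pr P Xs.

Lemma measurable_seqDU {d'} {S : measurableType d'} (A : (set S)^nat) k :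
  (forall n, measurable (A n)) -> measurable (seqDU A k).
Proof.
move=> mA; apply: measurableD => //; apply: bigsetU_measurable => i _; exact: mA.
Qed.

Lemma measurable_exists_gt {d'} {S : measurableType d'} (f : nat -> S -> R) (t : R) :
  (forall k, measurable_fun setT (f k)) -> measurable [set x | exists k, t < f k x].
Proof.
move=> mf; rewrite (_ : [set x | _] = \bigcup_k [set x | t < f k x]).
  by apply: bigcup_measurable => k _; exact: measurable_set_gt.
by apply/seteqP; split => x /=; [move=> [k ?]; exists k|move=> [k _ ?]; exists k].
Qed.

Lemma measurable_sum_eval {J : finType} (h : T -> R) :
  measurable_fun setT h -> measurable_fun setT (fun x : families T J => \sum_j h (x j)).
Proof.
move=> mh; apply: measurable_sum => j.
by apply: (measurableT_comp mh); exact: measurable_eval.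
Qed.

(* A second sample, independent of the first, stays within [t/2] of its mean at
   the first index [k] where the first sample deviates by more than [t]. *)
Lemma symmetrization (n : nat) (g : nat -> T -> R) (t : R) :
  (forall k, square_integrable P (g k)) -> 0 < t ->
  (forall k, 8 * n%:R * \int[P]_x (g k x ^+ 2) <= t ^+ 2) ->
  (Pr [set w | exists k, (t < `|\sum_(i < n) (g k (Xs i w) - \int[P]_x g k x)|)%R] <=
   2%:E * Pr [set w | exists k,
     (t / 2 < `|\sum_(i < n) (g k (Xs i w) - g k (Xs (n + i) w))|)%R])%E.
Proof.
move=> g2 t0 gt.
pose m k := \int[P]_x g k x.
pose i1 (i : 'I_n) : nat := i; pose i2 (i : 'I_n) := (n + i)%N.
have inj1 : injective i1 by move=> i j; exact: val_inj.
have inj2 : injective i2 by move=> i j /addnI; exact: val_inj.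
have disj j j' : i1 j <> i2 j' by rewrite /i1 /i2 => E; have := ltn_ord j; rewrite E; lia.
pose S k (x : families T 'I_n) := `|\sum_i (g k (x i) - m k)|.
have mS k : measurable_fun setT (S k).
  apply: measurableT_comp => //; have [mg _] := g2 k.
  apply: (measurable_sum_eval (h := fun x => g k x - m k)).
  exact: measurable_funB.
(* [B k] says that [k] is the first index with a deviation above [t]. The disjointness of these
   events lets independence be used index by index. *)
pose A k := [set x | t < S k x]; pose B := seqDU A; pose C k := [set x | S k x <= t / 2].
have mA k : measurable (A k : set (families T 'I_n)) by exact: measurable_set_gt.
have mB k : measurable (B k : set (families T 'I_n)) by exact: measurable_seqDU.
have mC k : measurable (C k : set (families T 'I_n)).
  rewrite (_ : C k = ~` [set x | t / 2 < S k x]); first exact/measurableC/measurable_set_gt.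
  by rewrite /C; apply/seteqP; split => x /=; rewrite leNgt => /negP.
(* Chebyshev's inequality at [t / 2] costs a factor 4, and the 8 of the hypothesis leaves one
   half. *)
have PC k : ((2^-1)%:E <= Pr (sample Xs i2 @^-1` C k))%E.
  have mp : measurable (sample Xs i2 @^-1` C k) by exact: (measurable_sample_preimage iid).
  rewrite -[Pr _]fineK ?fin_num_measure // lee_fin.
  have : (Pr (~` (sample Xs i2 @^-1` C k)) <= (2^-1)%:E)%E.
    have th : 0 < t / 2 by rewrite divr_gt0.
    apply: le_trans (le_trans (chebyshev_sum iid inj2 (g2 k) th) _).
      apply: le_measure; rewrite ?inE; [exact: measurableC| |].
        apply: measurable_set_ge; apply: measurableT_comp => //; have [mg _] := g2 k.
        apply: (measurable_sum_Xs iid i2 (h := fun x => g k x - m k)).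
        exact: measurable_funB.
      by move=> w /= /negP; rewrite -ltNge => /ltW.
    rewrite lee_fin card_ord ler_pdivrMr ?exprn_gt0 // expr_div_n.
    have := gt k; set v := \int[P]_x _; set n' := n%:R; nra.
  rewrite probability_setC // -[Pr _]fineK ?fin_num_measure // -EFinB lee_fin.
  lra.
set G := [set w | exists k, t / 2 < _].
have mG : measurable G.
  apply: (measurable_exists_gt (f := fun k w => `|\sum_(i < n) (g k (Xs i w) - g k (Xs (n + i) w))|)) => k.
  apply: measurableT_comp => //; apply: measurable_sum => i; have [mg _] := g2 k.
  by apply: measurable_funB; apply: measurableT_comp => //; apply: (measurable_Xs iid).
have -> : [set w | exists k, t < `|\sum_(i < n) (g k (Xs i w) - m k)|] =
    \bigcup_k sample Xs i1 @^-1` (B k).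
  rewrite -preimage_bigcup -seqDU_bigcup_eq.
  by apply/seteqP; split => w /=; [move=> [k h]; exists k|move=> [k _ h]; exists k].
have tB : trivIset setT (fun k => sample Xs i1 @^-1` B k).
  exact/trivIset_preimage/trivIset_seqDU.
have mpB k : measurable (sample Xs i1 @^-1` B k) by exact: (measurable_sample_preimage iid).
have mpC k : measurable (sample Xs i2 @^-1` C k) by exact: (measurable_sample_preimage iid).
have -> : Pr (\bigcup_k sample Xs i1 @^-1` B k) =
    (\sum_(0 <= k <oo) Pr (sample Xs i1 @^-1` B k))%E.
  by rewrite measure_bigcup //; apply: eq_eseriesl => k; rewrite in_setT.
apply: (@le_trans _ _ (\sum_(0 <= k <oo) 2%:E * Pr (sample Xs i1 @^-1` B k `&` sample Xs i2 @^-1` C k))%E).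
  apply: lee_nneseries => [k _ _|k _]; first exact: measure_ge0.
  rewrite (independent_blocks iid) // muleA [(2%:E * _)%E]muleC -muleA.
  rewrite -[leLHS]mule1; apply: lee_wpmul2l; first exact: measure_ge0.
  have := lee_wpmul2l (_ : (0 <= 2%:E)%E) (PC k); rewrite lee_fin => /(_ (ler0n _ _)).
  by rewrite -EFinM divff ?pnatr_eq0.
rewrite nneseriesZl; last by move=> k _; exact: measure_ge0.
apply: lee_wpmul2l; first by rewrite lee_fin.
have -> : (\sum_(0 <= k <oo) Pr (sample Xs i1 @^-1` B k `&` sample Xs i2 @^-1` C k) =
   Pr (\bigcup_k (sample Xs i1 @^-1` B k `&` sample Xs i2 @^-1` C k)))%E.
  rewrite measure_bigcup; first by apply: eq_eseriesl => k; rewrite in_setT.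
  - by move=> k _; exact: measurableI.
  - exact: trivIset_setIr.
apply: le_measure; rewrite ?inE //.
  by apply: bigcup_measurable => k _; exact: measurableI.
move=> w [k _ [h1 h2]]; exists k; move: (subset_seqDU h1) h2 => {h1}; rewrite /A /C /S /= => h1 h2.
have -> : \sum_(i < n) (g k (Xs i w) - g k (Xs (n + i) w)) =
  \sum_i (g k (sample Xs i1 w i) - m k) - \sum_i (g k (sample Xs i2 w i) - m k).
  by rewrite -sumrB; apply: eq_bigr => i _; rewrite /sample /i1 /i2; ring.
apply: (@lt_le_trans _ _ (`|\sum_i (g k (sample Xs i1 w i) - m k)| - `|\sum_i (g k (sample Xs i2 w i) - m k)|)).
  by lra.
exact: lerB_dist.
Qed.

Definition swap {I : finType} (e : {ffun I -> bool}) (y : I * bool -> T) (z : I * bool) : T :=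
  y (z.1, z.2 (+) e z.1).

(** By exchangeability every swap of the doubled sample has the same law, so [Pr] of [A] is the
    average over [e] of the swapped events. A bound on the number of bad [e], valid for each fixed
    [y], therefore bounds the probability. *)
Lemma swap_bound {I : finType} (iota : I * bool -> nat) (A : set (families T (I * bool)%type))
    (eta : R) : injective iota -> measurable A -> 0 <= eta ->
  (forall y, #|[set e | `[< A (swap e y) >]]%SET|%:R <= eta * #|{ffun I -> bool}|%:R) ->
  (Pr (sample Xs iota @^-1` A) <= eta%:E)%E.
Proof.
move=> inj mA eta0 hA.
pose s (e : {ffun I -> bool}) (z : I * bool) := (z.1, z.2 (+) e z.1).
have sK e : involutive (s e) by move=> [i b]; rewrite /s /= -addbA addbb addbF.
pose Ae e := sample Xs (iota \o s e) @^-1` A.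
have mAe e : measurable (Ae e) by exact: (measurable_sample_preimage iid).
have PAe e : Pr (Ae e) = Pr (sample Xs iota @^-1` A).
  by apply: (exchangeable iid) => //; apply: inj_comp => //; exact/inv_inj/sK.
have [r rE] : exists r, Pr (sample Xs iota @^-1` A) = r%:E.
  by exists (fine (Pr (sample Xs iota @^-1` A))); rewrite fineK // fin_num_measure //;
    exact: (measurable_sample_preimage iid).
set N : R := #|{ffun I -> bool}|%:R.
have N0 : 0 < N by rewrite ltr0n; apply/card_gt0P; exists [ffun=> false].
have : (N%:E * r%:E <= (eta * N)%:E)%E.
  have -> : (N%:E * r%:E = \sum_(e : {ffun I -> bool}) Pr (Ae e))%E.
    under eq_bigr do rewrite PAe rE.
    by rewrite sumEFin sumr_const -EFinM /N mulr_natl.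
  have -> : (\sum_e Pr (Ae e) = \int[Pr]_w (\sum_e (\1_(Ae e) w)%:E))%E.
    rewrite ge0_integral_sum //; first by apply: eq_bigr => e _; rewrite integral_indic // setIT.
  - by move=> e; apply/measurable_EFinP; exact: measurable_indic.
  rewrite -[leRHS](_ : (\int[Pr]_w (cst (eta * N)%:E w) = _)%E); last first.
    by rewrite integral_cst // [X in (_ * X)%E](_ : _ = 1%E) ?mule1 //; exact: probability_setT.
  apply: ge0_le_integral => //.
  - by move=> w _; apply: sume_ge0 => e _; rewrite lee_fin.
  - by apply: emeasurable_sum => e; apply/measurable_EFinP; exact: measurable_indic.
  move=> w _; rewrite sumEFin lee_fin; apply: le_trans (hA (sample Xs iota w)).
  rewrite -sum1_card natr_sum [leRHS]big_mkcond /=; apply: ler_sum => e _.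
  rewrite indicE inE; case: asboolP; case: (boolP (w \in Ae e)) => //.
  by rewrite inE => h1 h2; exfalso; apply: h2.
by rewrite rE -EFinM !lee_fin mulrC ler_pM2r.
Qed.

End Symmetrization.

(** * The empirical process of weighted halfspaces *)

Section Halfspaces.
Context {d} {T : measurableType d} {R : realType} {F : finType}.
Variables (phi : F -> T -> R) (k0 : F).
Hypothesis mphi : forall k, measurable_fun setT (phi k).
Hypothesis phi_k0 : forall x, phi k0 x = 1.

Definition feature (x : T) : F -> R := fun k => phi k x.

Definition hs (p : F -> R) (x : T) : R := halfspace_ind p (feature x).

Lemma hsE p x : hs p x = if 0 <= affine_form p (feature x) then 1 else 0.
Proof. by rewrite /hs /halfspace_ind; case: ifP. Qed.

Lemma measurable_affine_form p : measurable_fun setT (fun x => affine_form p (feature x)).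
Proof.
by apply: measurable_sum => k; apply: measurable_funM => //; exact: mphi.
Qed.

Lemma measurable_hs p : measurable_fun setT (hs p).
Proof.
rewrite (_ : hs p = \1_[set x | 0 <= affine_form p (feature x)]).
  exact/measurable_indic/measurable_set_ge/measurable_affine_form.
by apply/funext => x; rewrite indicE /hs /halfspace_ind; congr (_ %:R); congr nat_of_bool;
  apply/idP/idP => [/mem_set|/set_mem].
Qed.

(* The threshold is relaxed by [t], which dominates the rounding error [t^2]
   of the coefficients, so that boundary points stay inside. *)
Lemma rational_halfspaces (p : F -> R) : exists q : nat -> {ffun F -> rat},
  (forall r, 0 < r -> \forall m \near \oo, forall k, `|ratr (q m k) - p k| < r) /\
  (forall x, \forall m \near \oo, hs (fun k => ratr (q m k)) x = hs p x).
Proof.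
pose t (m : nat) : R := m.+1%:R^-1.
have t0 m : 0 < t m by rewrite invr_gt0.
have t1 m : t m <= 1 by rewrite invf_le1 // ler1n.
have tlt (r : R) : 0 < r -> \forall m \near \oo, t m < r.
  by move=> r0; have := near_infty_natSinv_lt (PosNum r0); apply.
pose a m k : R := p k + (k == k0)%:R * t m.
have ex m k : exists q : rat, `|ratr q - a m k| < t m ^+ 2.
  have [|q] := @rat_in_itvoo R (a m k - t m ^+ 2) (a m k + t m ^+ 2).
    by rewrite ltrD2l gtrN ?exprn_gt0.
  by rewrite in_itv /= => h; exists q; rewrite ltr_distl.
pose q m : {ffun F -> rat} := [ffun k => sval (cid (ex m k))].
have qP m k : `|ratr (q m k) - a m k| < t m ^+ 2 by rewrite ffunE; case: cid.
exists q; split.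
  move=> r r0; have r2 : 0 < r / 2 by rewrite divr_gt0.
  near=> m => k; have tm : t m < r / 2 by near: m; exact: tlt.
  have -> : ratr (q m k) - p k = (ratr (q m k) - a m k) + (k == k0)%:R * t m by rewrite /a; ring.
  apply: (le_lt_trans (ler_normD _ _)); rewrite normrM [`|t m|]gtr0_norm //.
  have := qP m k; have : t m ^+ 2 <= t m by rewrite expr2 ler_piMl // ltW.
  have : `|(k == k0)%:R| * t m <= t m.
    by case: (k == k0); rewrite ?normr1 ?mul1r // normr0 mul0r ltW.
  lra.
move=> x; pose C := \sum_k `|phi k x|; pose l := affine_form p (feature x).
have C0 : 0 <= C by apply: sumr_ge0.
have err m : `|affine_form (fun k => ratr (q m k)) (feature x) - (l + t m)| <= t m ^+ 2 * C.
  have -> : affine_form (fun k => ratr (q m k)) (feature x) - (l + t m) =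
      \sum_k (ratr (q m k) - a m k) * phi k x.
    have -> : t m = \sum_k (k == k0)%:R * t m * phi k x.
      rewrite (bigD1 k0) //= eqxx phi_k0 mulr1 mul1r big1 ?addr0 // => k /negbTE ->.
      by rewrite !mul0r.
    rewrite /l /affine_form -big_split -sumrB /=; apply: eq_bigr => k _.
    by rewrite /a /feature; ring.
  apply: (le_trans (ler_norm_sum _ _ _)); rewrite mulr_sumr; apply: ler_sum => k _.
  by rewrite normrM ler_wpM2r // ltW.
have tl : \forall m \near \oo, l < 0 -> t m < - l / 2.
  have [l0|l0] := leP 0 l; first by near=> m.
  by near=> m => _; near: m; apply: tlt; rewrite divr_gt0 // oppr_gt0.
near=> m; rewrite /hs /halfspace_ind -/l; congr (_%:R); congr nat_of_bool.
have tC : t m < (C + 1)^-1 by near: m; apply: tlt; rewrite invr_gt0 ltr_wpDl.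
have {}tC : t m * C <= 1.
  rewrite -[leRHS](mulVf (x := C + 1)) ?gt_eqF ?ltr_wpDl //.
  by apply: ler_pM => //; [exact: ltW|exact: ltW|rewrite lerDl].
have e1 : t m ^+ 2 * C <= t m.
  by rewrite expr2 -mulrA ler_piMr // ltW.
have := err m; rewrite ler_norml; set z := affine_form _ _ => /andP[h1 h2].
move: h1 h2 e1; set t2 := t m ^+ 2 * C => h1 h2 e1.
have [l0|l0] := leP 0 l; first by apply/idP; lra.
apply/negbTE; rewrite -ltNge.
have : t m < - l / 2 by apply: (near tl m).
lra.
Unshelve. all: by end_near. Qed.

End Halfspaces.

(** * The empirical process and its rational approximation *)

Section Equicontinuity.
Context {d} {T : measurableType d} {R : realType} {dd} {Omega : measurableType dd}.
Context (Pr : probability Omega R) (P : probability T R) (Xs : nat -> Omega -> T).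
Hypothesis iid : iid_sequence Pr P Xs.
Context {F : finType} (phi : F -> T -> R) (k0 : F).
Hypothesis mphi : forall k, measurable_fun setT (phi k).
Hypothesis phi_k0 : forall x, phi k0 x = 1.

Local Notation hs := (hs phi).

Definition emp_proc (n : nat) (g : T -> R) (w : Omega) : R :=
  Num.sqrt n%:R * (n%:R^-1 * (\sum_(i < n) g (Xs i w)) - \int[P]_x g x).

Lemma emp_procE n g w : (0 < n)%N ->
  emp_proc n g w = (\sum_(i < n) (g (Xs i w) - \int[P]_x g x)) / Num.sqrt n%:R.
Proof.
move=> n0; have n0' : 0 < n%:R :> R by rewrite ltr0n.
have s0 : 0 < Num.sqrt n%:R :> R by rewrite sqrtr_gt0.
have := sqr_sqrtr (ltW n0'); move: s0; rewrite /emp_proc; set s := Num.sqrt _ => s0 E.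
rewrite sumrB sumr_const card_ord -(mulr_natl (\int[P]_x g x) n) -E.
by field; rewrite gt_eqF.
Qed.

(* The inclusion is required for all nearby coefficients, so that it survives the
   approximation by rational ones. *)
Definition in_strip (S : set T) (p p' : F -> R) := exists2 r : R, 0 < r &
  forall q q' : F -> R, (forall k, `|q k - p k| < r) -> (forall k, `|q' k - p' k| < r) ->
  forall x, hs q x != hs q' x -> S x.

Lemma hs_le1 p x : 0 <= hs p x <= 1.
Proof. by rewrite hsE; case: ifP => _; rewrite lexx ler01. Qed.

Lemma square_integrable_hs (w : T -> R) p p' : square_integrable P w ->
  square_integrable P (fun x => w x * (hs p x - hs p' x)).
Proof.
move=> w2; apply: (square_integrable_le _ w2).
  case: w2 => mw _; apply: measurable_funM => //.
  by apply: measurable_funB; exact: measurable_hs.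
move=> x; rewrite normrM ler_piMr //; have := hs_le1 p x; have := hs_le1 p' x.
by rewrite ler_norml; lra.
Qed.

Lemma hs_sqr_le (S : set T) p p' (w : T -> R) x : (hs p x != hs p' x -> S x) ->
  (w x * (hs p x - hs p' x)) ^+ 2 <= w x ^+ 2 * \1_S x.
Proof.
move=> h; rewrite exprMn ler_wpM2l ?sqr_ge0 //; move: h; rewrite indicE.
have [->|pp'] := eqVneq (hs p x) (hs p' x); first by rewrite subrr expr0n.
move=> /(_ isT) Sx; rewrite mem_set //= !hsE.
by case: ifP; case: ifP => _ _; rewrite ?subrr ?subr0 ?sub0r ?sqrrN ?expr0n ?expr1n /= ?ler01 ?lexx.
Qed.

Definition rat_fun (q : {ffun F -> rat}) : F -> R := fun k => ratr (q k).

(** The approximating indicators agree with their limits from some index on at each of the finitely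
    many sample points, and the means converge by dominated convergence with bound [|w|]. *)
Lemma strip_limit (n : nat) (w : T -> R) (S : set T) (t : R) (om : Omega) :
  square_integrable P w ->
  (forall q q' : {ffun F -> rat},
    (forall x, hs (rat_fun q) x != hs (rat_fun q') x -> S x) ->
    `|\sum_(i < n) (w (Xs i om) * (hs (rat_fun q) (Xs i om) - hs (rat_fun q') (Xs i om)) -
      \int[P]_x (w x * (hs (rat_fun q) x - hs (rat_fun q') x)))| <= t) ->
  forall p p', in_strip S p p' ->
    `|\sum_(i < n) (w (Xs i om) * (hs p (Xs i om) - hs p' (Xs i om)) -
      \int[P]_x (w x * (hs p x - hs p' x)))| <= t.
Proof.
move=> w2 H p p' [r r0 strip].
have [q [qp qhs]] := rational_halfspaces phi_k0 p.
have [q' [q'p q'hs]] := rational_halfspaces phi_k0 p'.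
pose g m x := w x * (hs (rat_fun (q m)) x - hs (rat_fun (q' m)) x).
pose g0 x := w x * (hs p x - hs p' x).
have gg0 x : \forall m \near \oo, g m x = g0 x.
  by near=> m; rewrite /g /g0 (near (qhs x) m) // (near (q'hs x) m).
have sq m : square_integrable P (g m) by exact: square_integrable_hs.
have sq0 : square_integrable P g0 by exact: square_integrable_hs.
have Ig : \int[P]_x g m x @[m --> \oo] --> \int[P]_x g0 x.
  apply: fine_cvg; rewrite fineK; last by apply: integrable_fin_num => //; exact: square_integrable1.
  apply: (@dominated_cvg _ _ _ P setT measurableT (fun m x => (g m x)%:E) (fun x => (g0 x)%:E)
    (fun x => `|w x|%:E)) => //.
  - by move=> m; apply/measurable_EFinP; case: (sq m).
  - move=> x _; apply: cvg_near_cst; near=> m; congr (_%:E); exact: (near (gg0 x) m).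
  - exact: (integrable_norm (square_integrable1 w2)).
  move=> m x _; rewrite /= lee_fin /g normrM ler_piMr //.
  have := hs_le1 (rat_fun (q m)) x; have := hs_le1 (rat_fun (q' m)) x.
  by rewrite ler_norml; lra.
have sumE m : \sum_(i < n) (g m (Xs i om) - \int[P]_x g m x) =
    \sum_(i < n) g m (Xs i om) - n%:R * \int[P]_x g m x.
  by rewrite sumrB sumr_const card_ord mulr_natl.
have sumE0 : \sum_(i < n) (g0 (Xs i om) - \int[P]_x g0 x) =
    \sum_(i < n) g0 (Xs i om) - n%:R * \int[P]_x g0 x.
  by rewrite sumrB sumr_const card_ord mulr_natl.
rewrite sumE0.
have cv : `|\sum_(i < n) g0 (Xs i om) - n%:R * \int[P]_x g m x| @[m --> \oo] -->
    `|\sum_(i < n) g0 (Xs i om) - n%:R * \int[P]_x g0 x|.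
  apply: cvg_norm; apply: cvgB; first exact: cvg_cst.
  by apply: cvgM => //; exact: cvg_cst.
apply: (cvgr_to_le cv).
have all_gg0 : \forall m \near \oo, forall i : 'I_n, g m (Xs i om) = g0 (Xs i om).
  by apply: filter_forall => i; exact: gg0.
near=> m.
have -> : \sum_(i < n) g0 (Xs i om) = \sum_(i < n) g m (Xs i om).
  by apply: eq_bigr => i _; rewrite (near all_gg0 m).
rewrite -sumE; apply: H => x; apply: strip => k; [exact: (near (qp r r0) m)|exact: (near (q'p r r0) m)].
Unshelve. all: by end_near. Qed.

End Equicontinuity.

Lemma bigcup_fin_type (I : finType) (U : Type) (f : I -> set U) :
  \bigcup_i f i = \big[setU/set0]_i f i.
Proof.
have := @bigcup_pred I U predT f; rewrite /= => <-.
by apply: eq_bigcupl; split => i.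
Qed.

Lemma measure_bigsetU_le {d} {S : measurableType d} {R : realType}
    (mu : {measure set S -> \bar R}) (I : finType) (A : I -> set S) :
  (forall i, measurable (A i)) -> (mu (\big[setU/set0]_i A i) <= \sum_i mu (A i))%E.
Proof.
move=> mA.
suff [] : measurable (\big[setU/set0]_i A i) /\ (mu (\big[setU/set0]_i A i) <= \sum_i mu (A i))%E by [].
apply: (big_rec2 (fun (B : set S) (s : \bar R) => measurable B /\ (mu B <= s)%E)).
  by rewrite measure0.
move=> i s B _ [mB Bs]; split; first exact: measurableU.
by apply: (le_trans (measureU2 _ _ _)) => //; exact: leeD.
Qed.

(** * Asymptotic equicontinuity over weighted halfspaces *)

Section EquicontinuityBound.
Context {d} {T : measurableType d} {R : realType} {dd} {Omega : measurableType dd}.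
Context (Pr : probability Omega R) (P : probability T R) (Xs : nat -> Omega -> T).
Hypothesis iid : iid_sequence Pr P Xs.
Context {F : finType} (phi : F -> T -> R) (k0 : F).
Hypothesis mphi : forall k, measurable_fun setT (phi k).
Hypothesis phi_k0 : forall x, phi k0 x = 1.

Local Notation hs := (hs phi).

Definition double_index (n : nat) (z : 'I_n * bool) : nat := if z.2 then (n + z.1)%N else z.1.

Lemma double_index_inj n : injective (@double_index n).
Proof.
move=> [i b] [j c]; rewrite /double_index /=.
have := ltn_ord i; have := ltn_ord j; case: b; case: c => /= hj hi.
- by move/addnI/val_inj ->.
- by move=> E; rewrite -E in hj; lia.
- by move=> E; rewrite E in hi; lia.
- by move/val_inj ->.
Qed.

(* The [2 n] terms have total mean at most [n K / 2]. *)
Lemma double_sample_lln (f : T -> R) (K eta : R) : measurable_fun setT f ->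
  P.-integrable setT (EFin \o f) -> 0 < K -> 0 < eta -> 4 * \int[P]_x f x <= K ->
  exists n0, forall n, (n0 <= n)%N ->
    (Pr [set w | (n%:R * K < \sum_z f (sample Xs (@double_index n) w z))%R] <= eta%:E)%E.
Proof.
move=> mf fi K0 eta0 fK; have K4 : 0 < K / 4 by rewrite divr_gt0.
have [n0 h] := wlln iid mf fi K4 eta0; exists n0 => n nn.
have := h _ (@double_index n) (@double_index_inj n).
rewrite card_prod card_ord card_bool => H; apply: le_trans (H _); last by lia.
apply: le_measure; rewrite ?inE.
- apply: measurable_set_gt; exact: (measurable_sum_Xs iid (@double_index n) mf).
- apply: measurable_set_ge; apply: measurableT_comp => //.
  apply: (measurable_sum_Xs iid (@double_index n) (h := fun x => f x - \int[P]_x f x)).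
  by apply: measurable_funB => //; exact: measurable_cst.
move=> w /= h1; apply: le_trans (ler_norm _).
rewrite sumrB sumr_const card_prod card_ord card_bool -(mulr_natl (\int[P]_x f x)) natrM.
move: h1; rewrite /sample; set A := \sum_z _; set n' := n%:R => h1.
have : 0 <= n' :> R by [].
move=> n0'; have := ler_wpM2l n0' fK; lra.
Qed.

Definition rat_pair (k : nat) : {ffun F -> rat} * {ffun F -> rat} :=
  odflt ([ffun=> 0], [ffun=> 0]) (unpickle k).

Lemma rat_pair_surj q q' : exists k, rat_pair k = (q, q').
Proof. by exists (pickle (q, q')); rewrite /rat_pair pickleK. Qed.

(** [L] is fixed before [w], [K], [k] and the sets [S i], so that [k] can later be taken large
    enough to make the bound small. The 4 is what the law of large numbers on the doubled sample
    requires; the 8 also serves the variance condition of symmetrization. *)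
Theorem equicontinuity (eta : R) : 0 < eta -> exists2 L : R, 1 <= L &
  forall (w : T -> R) (K : R) (k : nat) (I : finType) (S : I -> set T),
  square_integrable P w -> 0 < K -> 4 * \int[P]_x (w x ^+ 2) <= K ->
  (forall i, measurable (S i)) ->
  (forall i, 8 * \int[P]_x (w x ^+ 2 * \1_(S i) x) <= K * 4^-1 ^+ k) ->
  exists n0, forall n, (n0 <= n)%N -> exists2 Bad : set Omega,
    measurable Bad /\ (Pr Bad <= eta%:E)%E &
    forall om, ~ Bad om -> forall i p p', in_strip phi (S i) p p' ->
      `|emp_proc P Xs n (fun x => w x * (hs p x - hs p' x)) om| <=
      2 * L * Num.sqrt K * (3 / 4) ^+ k.
Proof.
move=> eta0; have eta8 : 0 < eta / 8 by rewrite divr_gt0.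
have [L L1 rad] := @rademacher_halfspaces R F _ eta8.
exists L => // w K k I S w2 K0 wK mS SK.
have [mw iw2] := w2.
have K4 : 0 < K * 4^-1 ^+ k by rewrite mulr_gt0 // exprn_gt0.
have mw2 : measurable_fun setT (fun x => w x ^+ 2) by exact: measurable_funX.
have mSw i : measurable_fun setT (fun x => w x ^+ 2 * \1_(S i) x).
  by apply: measurable_funM => //; exact: measurable_indic.
have iSw i : P.-integrable setT (EFin \o (fun x => w x ^+ 2 * \1_(S i) x)).
  apply: (le_integrable measurableT _ _ iw2); first exact/measurable_EFinP.
  move=> x _; rewrite /= lee_fin normrM ler_piMr // indicE.
  by case: (x \in S i); rewrite ?normr1 ?normr0.
have ISw0 i : 0 <= \int[P]_x (w x ^+ 2 * \1_(S i) x).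
  by apply: Rintegral_ge0 => x _; rewrite mulr_ge0 ?sqr_ge0.
(* The [#|I| + 1] laws of large numbers together fail with probability at most [eta / 8], and so
   does the Rademacher bound; symmetrization doubles the sum. *)
pose e1 := eta / (8 * #|I|.+1%:R).
have e10 : 0 < e1 by rewrite divr_gt0 // mulr_gt0.
have [n1 h1] := double_sample_lln mw2 iw2 K0 e10 wK.
have SK' i : 4 * \int[P]_x (w x ^+ 2 * \1_(S i) x) <= K * 4^-1 ^+ k.
  by apply: le_trans (SK i); rewrite ler_wpM2r // ler_nat.
have n2P i := double_sample_lln (mSw i) (iSw i) K4 e10 (SK' i).
have [n2 h2] := choice n2P.
exists (maxn 1 (maxn n1 (\max_i n2 i))) => n.
rewrite !geq_max => /andP[n_gt0 /andP[nn1 nn2]].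
have n0 : 0 < n%:R :> R by rewrite ltr0n.
pose ok (m : nat) := exists i, forall x,
  hs (rat_fun (rat_pair m).1) x != hs (rat_fun (rat_pair m).2) x -> S i x.
(* Pairs that differ outside every [S i] are replaced by 0. This keeps the family indexed by all of
   [nat]; the test does not depend on the sample. *)
pose g m x := if `[< ok m >] then
  w x * (hs (rat_fun (rat_pair m).1) x - hs (rat_fun (rat_pair m).2) x) else 0.
have g2 m : square_integrable P (g m).
  rewrite /g; case: asboolP => _; first exact: square_integrable_hs.
  exact: square_integrable_cst.
have mg m : measurable_fun setT (g m) by case: (g2 m).
(* Symmetrization halves the deviation: [t / 2] is the Rademacher bound when the squares sum to at
   most [n%:R * K]. *)
pose t := 2 * L * Num.sqrt (n%:R * K) * (3 / 4) ^+ k.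
have L0 : 0 < L by apply: lt_le_trans L1.
have sK0 : 0 < Num.sqrt (n%:R * K) by rewrite sqrtr_gt0 mulr_gt0.
have t0 : 0 < t by rewrite !mulr_gt0 // exprn_gt0 // divr_gt0.
have gt m : 8 * n%:R * \int[P]_x (g m x ^+ 2) <= t ^+ 2.
  have gK : 8 * \int[P]_x (g m x ^+ 2) <= K * 4^-1 ^+ k.
    have [[i oki]|nok] := pselect (ok m); last first.
      rewrite (_ : \int[P]_x _ = 0) ?mulr0 ?ltW //.
      rewrite -[RHS](Rintegral_cst_prob P 0); apply: eq_Rintegral => x _.
      by rewrite /g asboolF // expr0n.
    apply: le_trans (SK i); rewrite ler_wpM2l //; apply: le_Rintegral => //.
    - by case: (g2 m).
    - by move=> x _; rewrite /g asboolT; [apply: hs_sqr_le; exact: oki|exists i].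
  have -> : t ^+ 2 = 4 * L ^+ 2 * (n%:R * K) * (9 / 16) ^+ k.
    rewrite /t exprMn [(2 * L * _) ^+ 2]exprMn [(2 * L) ^+ 2]exprMn.
    rewrite sqr_sqrtr; last by rewrite mulr_ge0 ?ltW.
    rewrite -exprM mulnC exprM; have -> : (3 / 4 : R) ^+ 2 = 9 / 16 by lra.
    by have -> : (2 : R) ^+ 2 = 4 by lra.
  have h := ler_wpM2l (ltW n0) gK.
  apply: (@le_trans _ _ (n%:R * (K * 4^-1 ^+ k))); first by apply: le_trans h; rewrite mulrA [n%:R * 8]mulrC.
  rewrite -[4 * L ^+ 2 * _ * _]mulrA -[n%:R * K * _]mulrA.
  have q9 : 4^-1 ^+ k <= (9 / 16) ^+ k :> R by apply: lerXn2r; rewrite ?nnegrE ?divr_ge0 ?invr_ge0 //; lra.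
  apply: (@le_trans _ _ (n%:R * (K * (9 / 16) ^+ k))).
    by do 2 (apply: ler_wpM2l; first exact: ltW).
  apply: ler_peMl; first by rewrite !mulr_ge0 ?exprn_ge0 // ltW.
  have : 1 <= L ^+ 2 by rewrite exprn_ege1.
  lra.
pose Y := sample Xs (@double_index n).
pose Gd (m : nat) (y : families T ('I_n * bool)%type) := `|\sum_i (g m (y (i, false)) - g m (y (i, true)))|.
pose D1 := [set y : families T ('I_n * bool)%type | n%:R * K < \sum_z w (y z) ^+ 2].
pose D2 i := [set y : families T ('I_n * bool)%type |
  n%:R * (K * 4^-1 ^+ k) < \sum_z w (y z) ^+ 2 * \1_(S i) (y z)].
pose D := D1 `|` \big[setU/set0]_i D2 i.
pose A := [set y : families T ('I_n * bool)%type | exists m, t / 2 < Gd m y] `\` D.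
have mD1 : measurable D1.
  by apply: measurable_set_gt; apply: (measurable_sum_eval (h := fun x => w x ^+ 2)).
have mD2 i : measurable (D2 i).
  by apply: measurable_set_gt; apply: (measurable_sum_eval (h := fun x => w x ^+ 2 * \1_(S i) x)).
have mD : measurable D by apply: measurableU => //; apply: bigsetU_measurable => i _.
have mG : measurable [set y : families T ('I_n * bool)%type | exists m, t / 2 < Gd m y].
  apply: measurable_exists_gt => m; apply: measurableT_comp => //.
  apply: measurable_sum => i; apply: measurable_funB.
    by apply: (measurableT_comp (mg m)); exact: measurable_eval.
  by apply: (measurableT_comp (mg m)); exact: measurable_eval.
have mA : measurable A by exact: measurableD.
have PA : (Pr (Y @^-1` A) <= (eta / 8)%:E)%E.
  apply: (swap_bound iid (@double_index_inj n) mA (ltW eta8)) => y.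
  (* Sums over both halves are invariant under swaps, so [D] contains all swaps of [y] or none; in
     the second case the counting bound applies to [y]. *)
  have sum_swap (f : T -> R) e : \sum_z f (swap e y z) = \sum_z f (y z).
    rewrite (reindex_inj (h := fun z : 'I_n * bool => (z.1, z.2 (+) e z.1))) /=; last first.
      by apply: inv_inj => -[i b]; rewrite /= -addbA addbb addbF.
    by apply: eq_bigr => -[i b] _; rewrite /swap /= -addbA addbb addbF.
  have [yD|yD] := pselect (D y).
    suff -> : [set e : {ffun 'I_n -> bool} | `[< A (swap e y) >]]%SET = finset.set0.
      by rewrite cards0 mulr_ge0 // ltW.
    apply/setP => e; rewrite [in RHS]inE; apply/negbTE/negP; rewrite inE => /asboolP [_ nD]; apply: nD.
    case: yD => [D1y|]; first by left; rewrite /D1 /= (sum_swap (fun x => w x ^+ 2)).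
    rewrite -bigcup_fin_type => -[i _ Dy].
    right; rewrite -bigcup_fin_type; exists i => //.
    by rewrite /D2 /= (sum_swap (fun x => w x ^+ 2 * \1_(S i) x)).
  have y1 : \sum_z w (y z) ^+ 2 <= n%:R * K.
    by rewrite leNgt; apply/negP => h; apply: yD; left.
  have y2 i : \sum_z w (y z) ^+ 2 * \1_(S i) (y z) <= n%:R * (K * 4^-1 ^+ k).
    rewrite leNgt; apply/negP => h; apply: yD; right.
    by rewrite -bigcup_fin_type; exists i.
  apply: le_trans (rad 'I_n (fun z => feature phi (y z)) (fun z => w (y z)) _ (mulr_gt0 n0 K0) y1).
  rewrite ler_nat; apply/subset_leq_card/fintype.subsetP => e; rewrite !inE.
  move=> [[m Gm] _].
  have [[i oki]|nok] := pselect (ok m); last first.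
    move: Gm; rewrite /Gd /g asboolF // big1; last by move=> i _; rewrite subrr.
    by rewrite normr0 ltNge ltW // divr_gt0.
  have okm : `[< ok m >] = true by apply: asboolT; exists i.
  exists (rat_fun (rat_pair m).1), (rat_fun (rat_pair m).2), k; split.
    rewrite -mulrA; apply: le_trans (y2 i); apply: ler_sum => z _.
    rewrite -exprMn; apply: hs_sqr_le; exact: oki.
  have -> : L * Num.sqrt (n%:R * K) * (3 / 4) ^+ k = t / 2 by rewrite /t; field.
  apply: (lt_le_trans Gm); rewrite /Gd le_eqVlt; apply/orP; left; apply/eqP; congr (`| _ |).
  apply: eq_bigr => i' _; rewrite /g okm /swap /= /hs.
  by case: (e i'); rewrite /= ?expr1 ?expr0; ring.
have PD : (Pr (Y @^-1` D) <= (eta / 8)%:E)%E.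
  have mpD1 : measurable (Y @^-1` D1) by exact: (measurable_sample_preimage iid).
  have mpD2 i : measurable (Y @^-1` D2 i) by exact: (measurable_sample_preimage iid).
  have -> : Y @^-1` D = (Y @^-1` D1) `|` \big[setU/set0]_i (Y @^-1` D2 i).
    by rewrite /D preimage_setU -!bigcup_fin_type preimage_bigcup.
  apply: (@le_trans _ _ (e1%:E + \sum_(i : I) e1%:E)%E).
    apply: le_trans (measureU2 _ _ _) _ => //; first exact: bigsetU_measurable.
    apply: leeD; first exact: h1.
    apply: le_trans (measure_bigsetU_le _ mpD2) _; apply: lee_sum => i _.
    by apply: h2; apply: leq_trans nn2; exact: leq_bigmax.
  rewrite sumEFin sumr_const -EFinD lee_fin -mulrS -mulr_natl /e1.
  by rewrite le_eqVlt; apply/orP; left; apply/eqP; field; rewrite ?natr1 ?nat1r ?pnatr_eq0.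
pose Bad := [set om | exists m, t < `|\sum_(i < n) (g m (Xs i om) - \int[P]_x g m x)|].
exists Bad.
  split.
    apply: measurable_exists_gt => m; apply: measurableT_comp => //.
    apply: measurable_sum => i; apply: measurable_funB; last exact: measurable_cst.
    by apply: measurableT_comp => //; exact: (measurable_Xs iid).
  apply: (le_trans (symmetrization iid g2 t0 gt)).
  apply: (@le_trans _ _ (2%:E * ((eta / 8)%:E + (eta / 8)%:E))%E); last first.
    by rewrite -EFinD -EFinM lee_fin; lra.
  apply: lee_wpmul2l; first by rewrite lee_fin.
  apply: le_trans (leeD PA PD).
  apply: (@le_trans _ _ (Pr (Y @^-1` A `|` Y @^-1` D))); last first.
    by apply: measureU2; exact: (measurable_sample_preimage iid).
  apply: le_measure; rewrite ?inE.
  - apply: (measurable_exists_gt (f := fun m om => `|\sum_(i < n) (g m (Xs i om) - g m (Xs (n + i) om))|)) => m.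
    apply: measurableT_comp => //; apply: measurable_sum => i.
    by apply: measurable_funB; apply: measurableT_comp => //; exact: (measurable_Xs iid).
  - by apply: measurableU; exact: (measurable_sample_preimage iid).
  move=> om [m hm]; have [Dom|nDom] := pselect (D (Y om)); first by right.
  by left; split => //; exists m.
move=> om nBad i p p' strip.
rewrite emp_procE // normrM normfV [`|Num.sqrt _|]ger0_norm ?sqrtr_ge0 // ler_pdivrMr ?sqrtr_gt0 //.
have -> : 2 * L * Num.sqrt K * (3 / 4) ^+ k * Num.sqrt n%:R = t.
  by rewrite /t sqrtrM ?ltW //; ring.
apply: (strip_limit mphi phi_k0 w2 _ strip) => q q' hqq'.
have [m mE] := rat_pair_surj q q'.
have okm : ok m by exists i; rewrite mE.
rewrite leNgt; apply/negP => h; apply: nBad; exists m.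
by rewrite /g asboolT // mE.
Qed.

End EquicontinuityBound.

(** * Square roots of positive definite matrices *)

Section QuadraticForms.
Context {R : realType} {d : nat}.
Implicit Types (x y : 'cV[R]_d) (A B S : 'M[R]_d).

Definition bilin B x y : R := (x^T *m B *m y) 0 0.
Definition dot x y : R := (x^T *m y) 0 0.

Lemma dotE x y : dot x y = \sum_k x k 0 * y k 0.
Proof. by rewrite /dot mxE; apply: eq_bigr => k _; rewrite mxE. Qed.

Lemma sqnormE x : sqnorm x = dot x x.
Proof. by rewrite dotE; apply: eq_bigr => k _; rewrite expr2. Qed.

Lemma sqnorm_ge0 x : 0 <= sqnorm x.
Proof. by apply: sumr_ge0 => k _; apply: sqr_ge0. Qed.

Lemma sqnorm_coord x k : x k 0 ^+ 2 <= sqnorm x.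
Proof.
by rewrite /sqnorm (bigD1 k) //= lerDl; apply: sumr_ge0 => j _; apply: sqr_ge0.
Qed.

Lemma unit_coord (u : 'cV[R]_d) : sqnorm u = 1 -> forall k, `|u k 0| <= 1.
Proof.
move=> u1 k; rewrite -(@ler_pXn2r _ 2) ?nnegrE // expr1n real_normK ?num_real // -u1.
exact: sqnorm_coord.
Qed.

Lemma sqnorm_eq0 x : sqnorm x = 0 -> x = 0.
Proof.
move=> x0; apply/colP => k; rewrite mxE; apply/eqP; rewrite -sqrf_eq0 eq_le sqr_ge0 andbT -x0.
exact: sqnorm_coord.
Qed.

Lemma bilinE B x y : bilin B x y = dot x (B *m y).
Proof. by rewrite /bilin /dot mulmxA. Qed.

Lemma bilin_sum B x y : bilin B x y = \sum_i \sum_j x i 0 * B i j * y j 0.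
Proof.
rewrite bilinE dotE; apply: eq_bigr => i _; rewrite mxE big_distrr /=.
by apply: eq_bigr => j _; rewrite mulrA.
Qed.

Lemma dotC x y : dot x y = dot y x.
Proof. by rewrite !dotE; apply: eq_bigr => k _; rewrite mulrC. Qed.

Lemma bilin_sym B x y : B^T = B -> bilin B x y = bilin B y x.
Proof.
move=> Bt; rewrite !bilin_sum exchange_big /=; apply: eq_bigr => i _; apply: eq_bigr => j _.
by rewrite -[in LHS]Bt mxE; ring.
Qed.

Lemma dotDr x y z : dot x (y + z) = dot x y + dot x z.
Proof. by rewrite /dot mulmxDr mxE. Qed.

Lemma dotZr (c : R) x y : dot x (c *: y) = c * dot x y.
Proof. by rewrite /dot -scalemxAr mxE. Qed.

Lemma dotDl x y z : dot (x + y) z = dot x z + dot y z.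
Proof. by rewrite dotC dotDr !(dotC z). Qed.

Lemma dotZl (c : R) x y : dot (c *: x) y = c * dot x y.
Proof. by rewrite dotC dotZr dotC. Qed.

Lemma bilinDl B x y z : bilin B (x + y) z = bilin B x z + bilin B y z.
Proof. by rewrite !bilinE dotDl. Qed.

Lemma bilinDr B x y z : bilin B x (y + z) = bilin B x y + bilin B x z.
Proof. by rewrite !bilinE mulmxDr dotDr. Qed.

Lemma bilinZl B (c : R) x y : bilin B (c *: x) y = c * bilin B x y.
Proof. by rewrite !bilinE dotZl. Qed.

Lemma bilinZr B (c : R) x y : bilin B x (c *: y) = c * bilin B x y.
Proof. by rewrite !bilinE -scalemxAr dotZr. Qed.

(** The discriminant of the quadratic form along [x + t *: y]. Since [B] may be degenerate, a
    vanishing leading coefficient is treated apart. *)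
Lemma psd_cauchy_schwarz B x y : psdmx B ->
  bilin B x y ^+ 2 <= bilin B x x * bilin B y y.
Proof.
move=> [Bt Bp]; set a := bilin B x x; set b := bilin B x y; set c := bilin B y y.
have h t : 0 <= a + 2 * t * b + t ^+ 2 * c.
  have := Bp (x + t *: y); rewrite -/(bilin _ _ _) bilinDl !bilinDr bilinZl !bilinZr bilinZl.
  by rewrite (bilin_sym y x Bt) -/a -/b -/c; congr (0 <= _); ring.
have c0 : 0 <= c by exact: Bp.
have [c0'|cn0] := eqVneq c 0.
  have [->|b0] := eqVneq b 0; first by rewrite expr0n mulr_ge0 //; exact: Bp.
  have := h (- (a + 1) / (2 * b)); rewrite c0' mulr0 addr0.
  have -> : 2 * (- (a + 1) / (2 * b)) * b = - (a + 1) by field.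
  by rewrite opprD addrA subrr add0r oppr_ge0 ler10.
have cp : 0 < c by rewrite lt0r cn0.
have := h (- b / c); have -> : a + 2 * (- b / c) * b + (- b / c) ^+ 2 * c = (a * c - b ^+ 2) / c.
  by field.
by rewrite pmulr_lge0 ?invr_gt0 // subr_ge0.
Qed.

Definition entry_sum A : R := \sum_i \sum_j `|A i j|.

Lemma entry_sum_ge0 A : 0 <= entry_sum A.
Proof. by apply: sumr_ge0 => i _; apply: sumr_ge0. Qed.

Lemma bilin_le A x : `|bilin A x x| <= entry_sum A * sqnorm x.
Proof.
rewrite bilin_sum mulr_suml; apply: (le_trans (ler_norm_sum _ _ _)); apply: ler_sum => i _.
rewrite mulr_suml; apply: (le_trans (ler_norm_sum _ _ _)); apply: ler_sum => j _.
rewrite !normrM mulrAC mulrC ler_wpM2l //.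
have := sqnorm_coord x i; have := sqnorm_coord x j.
rewrite -[x i 0 ^+ 2]real_normK ?num_real // -[x j 0 ^+ 2]real_normK ?num_real //.
by have := sqr_ge0 (`|x i 0| - `|x j 0|); nra.
Qed.

(** Cauchy-Schwarz for [S] at [x] and [invmx S *m x] gives [sqnorm x ^+ 2 <= bilin S x x * bilin V x
    x], and the last factor is at most [C * sqnorm x]. This replaces the smallest eigenvalue. *)
Lemma psd_unit_coercive S : psdmx S -> S \in unitmx ->
  exists2 l : R, 0 < l & forall x, l * sqnorm x <= bilin S x x.
Proof.
move=> Sp Su; pose V := invmx S; pose C := entry_sum V + 1.
have C0 : 0 < C by rewrite ltr_wpDl // sumr_ge0 // => i _; apply: sumr_ge0.
exists C^-1; first by rewrite invr_gt0.
move=> x; rewrite ler_pdivrMl //.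
have [->|xn0] := eqVneq (sqnorm x) 0; first by apply: mulr_ge0; [exact: ltW|case: Sp => _; apply].
have xp : 0 < sqnorm x by rewrite lt0r xn0 sqnorm_ge0.
have := psd_cauchy_schwarz x (V *m x) Sp.
rewrite [bilin S x (V *m x)]bilinE mulmxA mulmxV // mul1mx -sqnormE.
rewrite [bilin S (V *m x) _]bilinE mulmxA mulmxV // mul1mx dotC -bilinE.
have Sx0 : 0 <= bilin S x x by case: Sp => _; apply.
have := bilin_le V x; rewrite ler_norml => /andP[_ h1] h2.
have h3 : bilin V x x <= C * sqnorm x by apply: (le_trans h1); apply: ler_wpM2r; [exact: ltW|rewrite lerDl].
have : sqnorm x ^+ 2 <= bilin S x x * (C * sqnorm x) by apply: (le_trans h2); apply: ler_wpM2l.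
by rewrite expr2 mulrA ler_pM2r // mulrC.
Qed.

(** Here [r] bounds the square of the operator norm. *)
Definition op_bounded (A : 'M[R]_d) (r : R) := forall x, sqnorm (A *m x) <= r * sqnorm x.

Lemma op_boundedM A B (r s : R) : 0 <= r -> op_bounded A r -> op_bounded B s ->
  op_bounded (A *m B) (r * s).
Proof.
move=> r0 hA hB x; rewrite -mulmxA; apply: (le_trans (hA _)).
by rewrite -mulrA ler_wpM2l.
Qed.

(* The squared norm is convex, so averages need no triangle inequality. *)
Lemma op_bounded_half A B (r s : R) : op_bounded A r -> op_bounded B s ->
  op_bounded (2^-1 *: (A + B)) ((r + s) / 2).
Proof.
move=> hA hB x; have h1 := hA x; have h2 := hB x.
rewrite -scalemxAl mulmxDl; set a := A *m x in h1 *; set b := B *m x in h2 *.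
have : sqnorm (2^-1 *: (a + b)) <= (sqnorm a + sqnorm b) / 2.
  rewrite /sqnorm -big_split /= mulr_suml; apply: ler_sum => k _.
  rewrite mxE [(a + b) k 0]mxE; have := sqr_ge0 (a k 0 - b k 0).
  move: (a k 0) (b k 0) => u v; nra.
by move=> /le_trans; apply; lra.
Qed.

Lemma op_bounded_entry A (r : R) i j : op_bounded A r -> A i j ^+ 2 <= r.
Proof.
move=> h; have := h (delta_mx j 0).
have -> : sqnorm (delta_mx j 0 : 'cV[R]_d) = 1.
  rewrite /sqnorm (bigD1 j) //= mxE !eqxx expr1n big1 ?addr0 // => k /negbTE kj.
  by rewrite mxE kj expr0n.
rewrite mulr1; apply: le_trans; apply: le_trans (sqnorm_coord _ i).
by rewrite -colE mxE.
Qed.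

(** Cauchy-Schwarz at [B *m x] and [x], after which one factor [sqnorm (B *m x)] cancels. *)
Lemma psd_op_bounded B (r : R) : psdmx B -> 0 <= r ->
  (forall x, bilin B x x <= r * sqnorm x) -> op_bounded B (r ^+ 2).
Proof.
move=> Bp r0 Br x; have := psd_cauchy_schwarz (B *m x) x Bp.
rewrite [bilin B (B *m x) x]bilinE -sqnormE; set s := sqnorm (B *m x).
have [->|sn0] := eqVneq s 0; first by rewrite mulr_ge0 ?sqr_ge0 ?sqnorm_ge0.
have sp : 0 < s by rewrite lt0r sn0 sqnorm_ge0.
have h0 : 0 <= bilin B x x by case: Bp => _; apply.
move=> h; have : s ^+ 2 <= (r * s) * (r * sqnorm x).
  apply: (le_trans h); apply: ler_pM => //.
  by case: Bp => _; apply.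
have -> : (r * s) * (r * sqnorm x) = (r ^+ 2 * sqnorm x) * s by ring.
by rewrite [s ^+ 2]expr2 ler_pM2r.
Qed.

End QuadraticForms.

(** * Existence of the positive semidefinite square root *)

Section SquareRoot.
Context {R : realType} {d : nat}.
Implicit Types (x y : 'cV[R]_d) (A B S : 'M[R]_d).

Lemma cvg_sumr (I : Type) (s : seq I) (u : I -> nat -> R) (l : I -> R) :
  (forall i, u i n @[n --> \oo] --> l i) ->
  \sum_(i <- s) u i n @[n --> \oo] --> \sum_(i <- s) l i.
Proof.
move=> h; elim: s => [|i s IH].
  by rewrite big_nil; under eq_fun do rewrite big_nil; exact: cvg_cst.
rewrite big_cons; under eq_fun do rewrite big_cons; exact: cvgD.
Qed.

(* [I - Y] squares to [I - B] when [Y = (B + Y^2) / 2], and this fixed point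
   equation is a contraction on matrices of norm at most [r < 1]. *)
Lemma sqrt_contraction B (r : R) : psdmx B -> 0 <= r < 1 ->
  (forall x, bilin B x x <= r * sqnorm x) ->
  exists Y : 'M[R]_d, [/\ Y^T = Y, forall x, bilin Y x x <= sqnorm x &
    Y *+ 2 = B + Y *m Y].
Proof.
move=> Bp /andP[r0 r1] Br; have Bop := psd_op_bounded Bp r0 Br.
pose Y := fix Y k : 'M[R]_d := if k is k'.+1 then 2^-1 *: (B + Y k' *m Y k') else 0.
have r2 : 0 <= r ^+ 2 by apply: sqr_ge0.
have r21 : r ^+ 2 <= 1 by rewrite exprn_ile1 // ltW.
have Yop k : op_bounded (Y k) (r ^+ 2).
  elim: k => [|k IH] x.
    have -> : sqnorm (Y 0%N *m x) = 0 by rewrite mul0mx; apply: big1 => i _; rewrite mxE expr0n.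
    by apply: mulr_ge0 => //; exact: sqnorm_ge0.
  have := op_bounded_half Bop (op_boundedM r2 IH IH) x.
  move=> /le_trans; apply; rewrite ler_wpM2r ?sqnorm_ge0 //.
  have : r ^+ 2 * r ^+ 2 <= r ^+ 2 by rewrite ler_piMl.
  lra.
have Yt k : (Y k)^T = Y k.
  elim: k => [|k IH]; first by rewrite trmx0.
  by rewrite /= linearZ /= linearD /= trmx_mul IH; case: Bp => ->.
have Dop k : op_bounded (Y k.+1 - Y k) ((r ^+ 2) ^+ k.+1).
  elim: k => [|k IH].
    rewrite subr0 expr1; exact: Yop.
  (* [a^2 - b^2 = a (a - b) + (a - b) b] holds without commutation. Both factors are bounded by [r],
     so increments shrink by [r], hence by [r ^+ 2] in squared norm. *)
  have -> : Y k.+2 - Y k.+1 = 2^-1 *: (Y k.+1 *m (Y k.+1 - Y k) + (Y k.+1 - Y k) *m Y k).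
    rewrite [Y k.+2]/= -[Y k.+1 in X in _ - X]/(2^-1 *: (B + Y k *m Y k)) -scalerBr.
    by rewrite mulmxBr mulmxBl addrA subrK opprD addrACA subrr add0r.
  have := op_bounded_half (op_boundedM r2 (Yop k.+1) IH)
    (op_boundedM (exprn_ge0 k.+1 r2) IH (Yop k)).
  move=> h x; apply: (le_trans (h x)); rewrite ler_wpM2r ?sqnorm_ge0 //.
  by rewrite [_ ^+ k.+2]exprS; set z := _ ^+ k.+1; lra.
(* [Dop] bounds squared norms, so entries of the increments are at most [r ^+ k.+1] and the
   telescoping series converges absolutely. *)
have ent i j : cvgn (fun k => Y k i j).
  have E : (fun k => Y k i j) = series (telescope (fun k => Y k i j)).
    by rewrite telescopeK; apply/funext => k; rewrite /= mxE subr0.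
  rewrite E; apply: normed_cvg.
  apply: (@series_le_cvg _ _ (geometric r r)).
  - by move=> k; exact: normr_ge0.
  - by move=> k; rewrite /= mulr_ge0 // exprn_ge0.
  - move=> k; rewrite /telescope /= -exprS.
    have DE : (Y k.+1 - Y k) i j = Y k.+1 i j - Y k i j.
      by move: (Y k.+1) (Y k) => U V; rewrite !mxE.
    have := op_bounded_entry i j (Dop k); rewrite DE -exprM mulnC exprM.
    rewrite -[leLHS]real_normK ?num_real //.
    by rewrite ler_pXn2r // nnegrE ?normr_ge0 ?exprn_ge0.
  - by apply: is_cvg_geometric_series; rewrite ger0_norm.
pose Z : 'M[R]_d := \matrix_(i, j) limn (fun k => Y k i j).
have YZ i j : Y k i j @[k --> \oo] --> Z i j by rewrite mxE; exact: ent.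
exists Z; split.
- apply/matrixP => i j; rewrite mxE.
  have E : (fun k => Y k j i) = (fun k => Y k i j).
    by apply/funext => k; rewrite -{1}(Yt k) mxE.
  have c1 : Y k i j @[k --> \oo] --> Z j i by rewrite -E.
  exact: (cvg_unique _ c1 (YZ i j)).
- move=> x; have cb : bilin (Y k) x x @[k --> \oo] --> bilin Z x x.
    rewrite bilin_sum; under eq_fun do rewrite bilin_sum.
    apply: cvg_sumr => i; apply: cvg_sumr => j.
    by apply: cvgMl; apply: cvgMr.
  apply: (cvgr_to_le cb); near=> k.
  have := psd_cauchy_schwarz x (Y k *m x) (_ : psdmx 1%:M).
  have p1 : @psdmx R d 1%:M.
    split; first exact: trmx1.
    by move=> y; rewrite mulmx1 -/(dot _ _) -sqnormE sqnorm_ge0.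
  move=> /(_ p1); rewrite !bilinE !mul1mx -!sqnormE => h.
  have h' : dot x (Y k *m x) ^+ 2 <= sqnorm x ^+ 2.
    apply: (le_trans h); rewrite expr2 ler_wpM2l ?sqnorm_ge0 //.
    by apply: (le_trans (Yop k x)); rewrite ler_piMl ?sqnorm_ge0.
  have [h0|h0] := leP (dot x (Y k *m x)) 0; first by apply: (le_trans h0); exact: sqnorm_ge0.
  by rewrite -(@ler_pXn2r _ 2) // nnegrE ?sqnorm_ge0 ?ltW.
- apply/matrixP => i j; rewrite mulr2n mxE [RHS]mxE.
  have c1 : Y k.+1 i j @[k --> \oo] --> Z i j.
    by rewrite (cvg_shiftS (fun k => Y k i j)); exact: YZ.
  have c2 : 2^-1 * (B i j + \sum_l Y k i l * Y k l j) @[k --> \oo] -->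
      2^-1 * (B i j + \sum_l Z i l * Z l j).
    apply: cvgMr; apply: cvgD; first exact: cvg_cst.
    by apply: cvg_sumr => l; apply: cvgM.
  have E : (fun k => Y k.+1 i j) = (fun k => 2^-1 * (B i j + \sum_l Y k i l * Y k l j)).
    by apply/funext => k; rewrite mxE mxE [(Y k *m Y k) i j]mxE.
  rewrite E in c1; have -> : Z i j = 2^-1 * (B i j + \sum_l Z i l * Z l j).
    exact: (cvg_unique _ c1 c2).
  by rewrite [(Z *m Z) i j]mxE; lra.
Unshelve. all: by end_near. Qed.

(** As forms, [S / M] lies between [l / M] and 1, so the contraction applies to [1 - S / M]; the
    root is that of [S / M] scaled back by [Num.sqrt M]. *)
Lemma exists_psd_sqrt S (l : R) : S^T = S -> 0 < l ->
  (forall x, l * sqnorm x <= bilin S x x) -> exists B, psdmx B /\ B *m B = S.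
Proof.
move=> St l0 Sl; pose M := entry_sum S + l + 1.
have es0 : 0 <= entry_sum S by apply: sumr_ge0 => i _; apply: sumr_ge0.
have M0 : 0 < M by rewrite /M; lra.
have SM x : bilin S x x <= M * sqnorm x.
  have := bilin_le S x; rewrite ler_norml => /andP[_ h]; apply: (le_trans h).
  by rewrite ler_wpM2r ?sqnorm_ge0 // /M; lra.
pose B := 1%:M - M^-1 *: S.
have BE x : bilin B x x = sqnorm x - M^-1 * bilin S x x.
  by rewrite !bilinE /B mulmxBl mul1mx -scalemxAl dotDr -sqnormE -scaleN1r dotZr dotZr mulN1r.
have [|||Y [Yt Y1 YE]] := @sqrt_contraction B (1 - l / M).
- split; first by rewrite /B linearB /= trmx1 linearZ /= St.
  by move=> x; rewrite -/(bilin B x x) BE subr_ge0 ler_pdivrMl.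
- rewrite subr_ge0 ltrBlDr ltrDl ler_pdivrMr // mul1r divr_gt0 // andbT /M; lra.
- move=> x; rewrite BE mulrBl mul1r lerB // -mulrA mulrCA.
  by apply: ler_wpM2l; [rewrite invr_ge0 ltW|exact: Sl].
exists (Num.sqrt M *: (1%:M - Y)); split.
  split; first by rewrite linearZ /= linearB /= trmx1 Yt.
  move=> x; rewrite -/(bilin _ x x) bilinE -scalemxAl dotZr mulr_ge0 ?sqrtr_ge0 //.
  by rewrite mulmxBl mul1mx dotDr -sqnormE -scaleN1r dotZr mulN1r -bilinE subr_ge0.
rewrite -scalemxAl -scalemxAr scalerA -expr2 sqr_sqrtr ?ltW //.
rewrite mulmxBl mul1mx mulmxBr mulmx1.
have -> : 1%:M - Y - (Y - Y *m Y) = 1%:M - (Y *+ 2 - Y *m Y).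
  by rewrite mulr2n -addrA -opprD addrA.
by rewrite YE addrK /B opprB addrCA subrr addr0 scalerA divff ?gt_eqF // scale1r.
Qed.

End SquareRoot.

(** * Continuity of the inverse square root *)

Section InverseSquareRoot.
Context {R : realType} {d : nat}.
Implicit Types (x y : 'cV[R]_d) (A B D S : 'M[R]_d).

Lemma sqrtmxP S : (exists B, psdmx B /\ B *m B = S) ->
  psdmx (sqrtmx S) /\ sqrtmx S *m sqrtmx S = S.
Proof. by rewrite /sqrtmx; case: pselect => // h _; case: cid. Qed.

Definition frob A : R := \sum_j \sum_i A i j ^+ 2.

Lemma frob_col A : frob A = \sum_j sqnorm (col j A).
Proof.
by apply: eq_bigr => j _; apply: eq_bigr => i _; rewrite mxE.
Qed.

Lemma frob_ge0 A : 0 <= frob A.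
Proof. by apply: sumr_ge0 => j _; apply: sumr_ge0 => i _; apply: sqr_ge0. Qed.

Lemma trace_bilin B D : \tr (D^T *m B *m D) = \sum_j bilin B (col j D) (col j D).
Proof.
apply: eq_bigr => j _; rewrite /bilin mxE [RHS]mxE; apply: eq_bigr => i _.
congr (_ * _); last by rewrite mxE.
by rewrite mxE [RHS]mxE; apply: eq_bigr => k _; rewrite !mxE.
Qed.

(* With [D = B - B0], expand [tr (D (B^2 - B0^2)) = tr (D B D) + tr (D B0 D)]. *)
Lemma sqrt_lipschitz B B0 (l : R) : psdmx B -> psdmx B0 -> 0 < l ->
  (forall x, l * sqnorm x <= bilin B0 x x) ->
  l ^+ 2 * frob (B - B0) <= frob (B *m B - B0 *m B0).
Proof.
move=> [Bt Bp] [B0t B0p] l0 B0l; set D := B - B0; set E := B *m B - B0 *m B0.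
have Dt : D^T = D by rewrite linearB /= Bt B0t.
have EE : E = B *m D + D *m B0 by rewrite /D mulmxBr mulmxBl addrA subrK.
have tE : \tr (D^T *m E) = \tr (D^T *m B *m D) + \tr (D^T *m B0 *m D).
  rewrite EE mulmxDr mxtraceD mulmxA; congr (_ + _).
  by rewrite [in RHS]mxtrace_mulC Dt.
have h1 : 0 <= \tr (D^T *m B *m D) by rewrite trace_bilin; apply: sumr_ge0 => j _; exact: Bp.
have h2 : l * frob D <= \tr (D^T *m B0 *m D).
  by rewrite trace_bilin frob_col mulr_sumr; apply: ler_sum.
(* Young's inequality with weight [l], so that half of the lower bound [h2] absorbs the first
   term. *)
have h3 : \tr (D^T *m E) <= l / 2 * frob D + frob E / (2 * l).
  rewrite /frob mulr_sumr mulr_suml -big_split /=; apply: ler_sum => j _.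
  rewrite mxE mulr_sumr mulr_suml -big_split /=; apply: ler_sum => i _.
  rewrite mxE; move: (D i j) (E i j) => a b.
  rewrite -subr_ge0; have -> : l / 2 * a ^+ 2 + b ^+ 2 / (2 * l) - a * b =
      (l * a - b) ^+ 2 / (2 * l) by field; rewrite gt_eqF.
  by rewrite divr_ge0 ?sqr_ge0 // mulr_ge0 // ltW.
have h4 : l / 2 * frob D <= frob E / (2 * l) by lra.
move: h4; rewrite ler_pdivlMr ?mulr_gt0 //.
by have -> : l / 2 * frob D * (2 * l) = l ^+ 2 * frob D by field.
Qed.

Lemma dot_sqr_le x y : dot x y ^+ 2 <= sqnorm x * sqnorm y.
Proof.
have p1 : @psdmx R d 1%:M.
  split; first exact: trmx1.
  by move=> z; rewrite mulmx1 -/(dot _ _) -sqnormE sqnorm_ge0.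
by have := psd_cauchy_schwarz x y p1; rewrite !bilinE !mul1mx -!sqnormE.
Qed.

Lemma frob_op_bounded A : op_bounded A (frob A).
Proof.
move=> x; rewrite /frob exchange_big /= mulr_suml /sqnorm; apply: ler_sum => i _.
have -> : (A *m x) i 0 = dot (row i A)^T x.
  by rewrite dotE mxE; apply: eq_bigr => k _; rewrite !mxE.
apply: (le_trans (dot_sqr_le _ _)); rewrite ler_wpM2r ?sqnorm_ge0 //.
by apply: ler_sum => k _; rewrite !mxE.
Qed.

Lemma coercive_unitmx B (m : R) : B^T = B -> 0 < m ->
  (forall x, m * sqnorm x <= bilin B x x) -> B \in unitmx.
Proof.
move=> Bt m0 Bm; rewrite -row_free_unit; apply: inj_row_free => v vB.
have := Bm v^T; rewrite /bilin trmxK vB mul0mx mxE => h.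
have /sqnorm_eq0/(congr1 trmx) : sqnorm v^T = 0.
  apply/eqP; rewrite eq_le sqnorm_ge0 andbT; move: h; rewrite pmulr_rle0 //.
by rewrite trmxK trmx0.
Qed.

(** With [y] the preimage of [x], coercivity gives [m * sqnorm y <= dot y x], and Young's inequality
    returns half of the left side. *)
Lemma invmx_op_bounded B (m : R) : B \in unitmx -> 0 < m ->
  (forall x, m * sqnorm x <= bilin B x x) -> op_bounded (invmx B) (m ^- 2).
Proof.
move=> Bu m0 Bm x; set y := invmx B *m x.
have : m * sqnorm y <= dot y x.
  by have := Bm y; rewrite bilinE /y mulmxA mulmxV // mul1mx.
have : dot y x <= m / 2 * sqnorm y + sqnorm x / (2 * m).
  rewrite dotE /sqnorm mulr_sumr mulr_suml -big_split /=; apply: ler_sum => k _.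
  move: (y k 0) (x k 0) => a b.
  rewrite -subr_ge0; have -> : m / 2 * a ^+ 2 + b ^+ 2 / (2 * m) - a * b =
      (m * a - b) ^+ 2 / (2 * m) by field; rewrite gt_eqF.
  by rewrite divr_ge0 ?sqr_ge0 // mulr_ge0 // ltW.
move=> h1 h2; have h3 : m / 2 * sqnorm y <= sqnorm x / (2 * m) by lra.
rewrite ler_pdivlMl ?exprn_gt0 //; move: h3; rewrite ler_pdivlMr ?mulr_gt0 //.
by have -> : m / 2 * sqnorm y * (2 * m) = m ^+ 2 * sqnorm y by field.
Qed.

Lemma psd_unit_sqrt S : psdmx S -> S \in unitmx ->
  [/\ psdmx (sqrtmx S), sqrtmx S *m sqrtmx S = S & sqrtmx S \in unitmx].
Proof.
move=> Sp Su; have [l l0 Sl] := psd_unit_coercive Sp Su.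
have [Bp BB] := sqrtmxP (exists_psd_sqrt Sp.1 l0 Sl).
by split => //; move: Su; rewrite -{1}BB unitmx_mul => /andP[].
Qed.

Lemma invsqrtmx_unit S : psdmx S -> S \in unitmx -> invsqrtmx S \in unitmx.
Proof. by move=> Sp Su; rewrite unitmx_inv; have [] := psd_unit_sqrt Sp Su. Qed.

(** [S] is assumed symmetric only: closeness to [S0] makes it coercive, which provides its root. The
    roots are close by the Lipschitz estimate, so the root of [S] is coercive too, and the inverses
    are compared by [B^-1 - B0^-1 = B^-1 (B0 - B) B0^-1]. *)
Theorem invsqrtmx_continuous S0 (eps : R) : psdmx S0 -> S0 \in unitmx -> 0 < eps ->
  exists2 del : R, 0 < del & forall S, S^T = S ->
    (forall i j, `|S i j - S0 i j| < del) ->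
    forall i j, `|invsqrtmx S i j - invsqrtmx S0 i j| < eps.
Proof.
move=> S0p S0u eps0; have [l l0 S0l] := psd_unit_coercive S0p S0u.
have [B0p BB0 B0u] := psd_unit_sqrt S0p S0u; set B0 := sqrtmx S0 in B0p BB0 B0u.
have [lam lam0 B0l] := psd_unit_coercive B0p B0u.
pose dn : R := d%:R + 1; have dn0 : 0 < dn by rewrite ltr_wpDl.
(* The first bound leaves [B] coercive with constant [lam / 2]; the second makes the product of the
   three squared norms at most [eps ^+ 2 / 4]. *)
pose tau := Num.min (lam / 2) (eps * lam ^+ 2 / 4).
have tau0 : 0 < tau by rewrite lt_min !divr_gt0 ?mulr_gt0 ?exprn_gt0.
(* The first bound leaves [S] coercive with constant [l / 2]; the second makes the squared Frobenius
   distance of [S] and [S0] at most [(lam * tau) ^+ 2]. *)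
pose del := Num.min (l / (2 * dn ^+ 2)) (lam * tau / dn).
have del0 : 0 < del by rewrite lt_min !divr_gt0 ?mulr_gt0 ?exprn_gt0.
exists del => // S St Sdel.
have del1 : del <= l / (2 * dn ^+ 2) by rewrite ge_min lexx.
have del2 : del <= lam * tau / dn by rewrite ge_min lexx orbT.
have sumd (f : 'I_d -> 'I_d -> R) (c : R) : 0 <= c -> (forall i j, f i j <= c) ->
    \sum_i \sum_j f i j <= c * dn ^+ 2.
  move=> c0 fc; apply: (@le_trans _ _ (\sum_(i < d) \sum_(j < d) c)).
    by apply: ler_sum => i _; apply: ler_sum.
  rewrite !sumr_const card_ord -mulrnA -mulr_natr ler_wpM2l // natrM /dn.
  by have : 0 <= d%:R :> R by []; nra.
have Sl x : l / 2 * sqnorm x <= bilin S x x.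
  have E : bilin S x x = bilin S0 x x + bilin (S - S0) x x.
    by rewrite !bilinE mulmxBl -dotDr addrC subrK.
  have es : entry_sum (S - S0) <= l / 2.
    apply: (@le_trans _ _ (del * dn ^+ 2)).
      by apply: sumd; [exact: ltW|move=> i j; rewrite !mxE ltW].
    move: del1; rewrite ler_pdivlMr ?mulr_gt0 ?exprn_gt0 //; lra.
  have := bilin_le (S - S0) x; rewrite ler_norml => /andP[h _].
  have := ler_wpM2r (sqnorm_ge0 x) es; have := S0l x; rewrite E; lra.
have l20 : 0 < l / 2 by rewrite divr_gt0.
have [Bp BB] := sqrtmxP (exists_psd_sqrt St l20 Sl); set B := sqrtmx S in Bp BB.
set D := B - B0.
have Dtau : frob D <= tau ^+ 2.
  have := sqrt_lipschitz Bp B0p lam0 B0l; rewrite BB BB0 -/D => h.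
  rewrite -(@ler_pM2l _ (lam ^+ 2)) ?exprn_gt0 //; apply: (le_trans h).
  apply: (@le_trans _ _ (del ^+ 2 * dn ^+ 2)).
    apply: sumd; first exact: sqr_ge0.
    move=> j i; have -> : (S - S0) i j = S i j - S0 i j by rewrite !mxE.
    rewrite -[leLHS]real_normK ?num_real //.
    by apply: lerXn2r; [rewrite nnegrE|rewrite nnegrE ltW|apply/ltW/Sdel].
  rewrite -!exprMn; apply: lerXn2r.
  - by rewrite nnegrE; apply: mulr_ge0; exact: ltW.
  - by rewrite nnegrE; apply: mulr_ge0; exact: ltW.
  by move: del2; rewrite ler_pdivlMr.
have m0 : 0 < lam / 2 by rewrite divr_gt0.
have Bm x : lam / 2 * sqnorm x <= bilin B x x.
  have E : bilin B x x = bilin B0 x x + dot x (D *m x).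
    by rewrite !bilinE /D mulmxBl -dotDr addrC subrK.
  have h : dot x (D *m x) ^+ 2 <= (tau * sqnorm x) ^+ 2.
    apply: (le_trans (dot_sqr_le _ _)).
    have -> : (tau * sqnorm x) ^+ 2 = sqnorm x * (tau ^+ 2 * sqnorm x) by ring.
    apply: ler_wpM2l; first exact: sqnorm_ge0.
    by apply: (le_trans (frob_op_bounded D x)); rewrite ler_wpM2r ?sqnorm_ge0.
  have {}h : `|dot x (D *m x)| <= tau * sqnorm x.
    rewrite -(@ler_pXn2r _ 2) // ?nnegrE ?mulr_ge0 ?sqnorm_ge0 ?(ltW tau0) //.
    by rewrite real_normK ?num_real.
  have tl : tau <= lam / 2 by rewrite ge_min lexx.
  have := ler_wpM2r (sqnorm_ge0 x) tl; have := B0l x.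
  move: h; rewrite E ler_norml => /andP[h _]; lra.
have Bu : B \in unitmx by apply: (coercive_unitmx Bp.1 m0).
have e1 : invmx B - invmx B0 = invmx B *m (- D) *m invmx B0.
  by rewrite /D opprB mulmxBr mulmxBl mulVmx // mul1mx -mulmxA mulmxV // mulmx1.
have opA := op_boundedM (_ : 0 <= (lam / 2) ^- 2 * frob (- D))
  (op_boundedM (_ : 0 <= (lam / 2) ^- 2) (invmx_op_bounded Bu m0 Bm) (frob_op_bounded (- D)))
  (invmx_op_bounded B0u lam0 B0l).
move=> i j; have ei0 : 0 <= (lam / 2) ^- 2 by rewrite invr_ge0 exprn_ge0 // ltW.
have := op_bounded_entry i j (opA (mulr_ge0 ei0 (frob_ge0 _)) ei0).
rewrite -e1 => h.
have -> : invsqrtmx S i j - invsqrtmx S0 i j = (invmx B - invmx B0) i j.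
  by rewrite mxE [X in _ = _ + X]mxE.
rewrite -(@ltr_pXn2r _ 2) // ?nnegrE ?(ltW eps0) // real_normK ?num_real //.
apply: (le_lt_trans h).
have -> : frob (- D) = frob D.
  by apply: eq_bigr => k _; apply: eq_bigr => k' _; rewrite mxE sqrrN.
have te : tau <= eps * lam ^+ 2 / 4 by rewrite ge_min lexx orbT.
have te2 : tau ^+ 2 <= (eps * lam ^+ 2 / 4) ^+ 2 by apply: lerXn2r; rewrite ?nnegrE ?(ltW tau0) // divr_ge0 // mulr_ge0 ?sqr_ge0 ?(ltW eps0).
have fD := le_trans Dtau te2.
apply: (@le_lt_trans _ _ ((lam / 2) ^- 2 * (eps * lam ^+ 2 / 4) ^+ 2 * lam ^- 2)).
  by rewrite ler_wpM2r ?invr_ge0 ?sqr_ge0 // ler_wpM2l.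
have -> : (lam / 2) ^- 2 * (eps * lam ^+ 2 / 4) ^+ 2 * lam ^- 2 = eps ^+ 2 / 4.
  by field; rewrite gt_eqF.
have := exprn_gt0 2 eps0; lra.
Qed.

End InverseSquareRoot.

(** * Hyperplanes and strips *)

Section Hyperplanes.
Context {R : realType} {d : nat}.
Implicit Types (a x y : 'cV[R]_d).

(* The measurable sets of [Rd] are definitionally those of [borelRd]. *)
Definition Rd := g_sigma_algebraType [set U : set 'cV[R]_d | open U].

Lemma measurable_coord k : measurable_fun setT (fun x : Rd => x k 0).
Proof.
apply: (measurability _ (RGenOpens.measurableE R)) => //.
move=> _ [_ [a [b ->]] <-]; rewrite setTI; apply: sub_gen_smallest => /=.
by apply: open_comp; [move=> x _; exact: coord_continuous|exact: interval_open].
Qed.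

Lemma measurable_dot a : measurable_fun setT (fun x : Rd => dot a x).
Proof.
rewrite (_ : (fun x => _) = (fun x : Rd => \sum_k a k 0 * x k 0)); last first.
  by apply/funext => x; exact: dotE.
apply: measurable_sum => k.
by apply: measurable_funM => //; exact: measurable_coord.
Qed.

Lemma eseries_finite (u : nat -> \bar R) n : (forall k, (0 <= u k)%E) ->
  (forall k, (n <= k)%N -> u k = 0%E) ->
  (\sum_(0 <= k <oo) u k = \sum_(0 <= k < n) u k)%E.
Proof.
move=> u0 un; rewrite (nneseries_split 0 n) // add0n [X in (_ + X)%E]eseries0 ?adde0 //.
by move=> k nk _; exact: un.
Qed.

Lemma floor_cell (m : nat) (y : R) : 0 <= y <= m%:R -> exists i : 'I_m.+1, i%:R <= y <= i.+1%:R.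
Proof.
move=> /andP[y0 ym]; have /andP[h1 h2] := truncn_itv y0.
have lt : (Num.Def.trunc y < m.+1)%N.
  by rewrite truncn_lt_nat //; apply: (le_lt_trans ym); rewrite ltr_nat.
by exists (Ordinal lt); rewrite /= h1 ltW.
Qed.

(* Cut all coordinates but [k0] into cells of side [h]: over each cell the
   hyperplane is a graph of oscillation at most [C h], so the volumes of the
   boxes add up to [O(h)].  Cells are indexed by functions [f] with [f k0 = 0];
   for the other [f] the box is flat. *)
Lemma bounded_hyperplane_null a (c N : R) : a != 0 -> 0 < N ->
  lebesgue_null [set x | dot a x = c /\ forall k, `|x k 0| <= N].
Proof.
move=> a0 N0 eps eps0.
have [k0 ak0] : exists k, a k 0 != 0.
  apply/existsP; apply: contraR a0 => /existsPn h; apply/eqP/colP => k.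
  by rewrite mxE; apply/eqP; have := h k; rewrite negbK.
pose C := \sum_(l | l != k0) `|a l 0 / a k0 0|.
have C0 : 0 <= C by apply: sumr_ge0.
(* The total volume is at most [2 * (C * h) * (4 * N) ^+ d.-1], which is below [V / m] for
   [h = 2 * N / m]; [C + 1] keeps [V] positive. *)
pose V := 2 * (C + 1) * (2 * N) * (4 * N) ^+ d.-1.
have V0 : 0 < V by rewrite !mulr_gt0 // ?exprn_gt0 ?mulr_gt0 // ltr_wpDl.
pose m := (Num.bound (V / eps)).+1.
pose h := 2 * N / m%:R.
have m0 : 0 < m%:R :> R by rewrite ltr0n.
have h0 : 0 < h by rewrite divr_gt0 // mulr_gt0.
pose I := {ffun 'I_d -> 'I_m.+1}.
pose lo (f : I) k := - N + (f k)%:R * h.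
pose ctr (f : I) := (c - \sum_(l | l != k0) a l 0 * lo f l) / a k0 0.
pose wd (f : I) := if f k0 == ord0 then C * h else 0.
have wd0 f : 0 <= wd f by rewrite /wd; case: ifP => // _; rewrite mulr_ge0 // ltW.
pose A (f : I) : 'cV[R]_d := \col_k if k == k0 then ctr f - wd f else lo f k.
pose B (f : I) : 'cV[R]_d := \col_k if k == k0 then ctr f + wd f else lo f k + h.
pose side k (i : 'I_m.+1) : R := if k == k0 then if i == ord0 then 2 * (C * h) else 0 else h.
have volE f : box_vol (A f) (B f) = \prod_k side k (f k).
  apply: eq_bigr => k _; rewrite !mxE /side; case: eqP => [->|_].
    have -> : ctr f + wd f - (ctr f - wd f) = 2 * wd f by ring.
    have w2 : 0 <= 2 * wd f by rewrite mulr_ge0.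
    rewrite (max_idPr w2).
    by rewrite /wd; case: ifP => _; rewrite ?mulr0.
  by rewrite addrAC subrr add0r max_r // ltW.
have vol_sum : \sum_(f : I) box_vol (A f) (B f) < eps.
  under eq_bigr do rewrite volE.
  rewrite -bigA_distr_bigA (bigD1 k0) //=.
  have -> : \sum_i side k0 i = 2 * (C * h).
    by rewrite (bigD1 ord0) //= /side eqxx eqxx big1 ?addr0 // => i /negbTE ->.
  have -> : \prod_(k < d | k != k0) \sum_i side k i = (m.+1%:R * h) ^+ d.-1.
    rewrite (eq_bigr (fun=> m.+1%:R * h)); last first.
      by move=> k /negbTE kk0; rewrite /side kk0 sumr_const card_ord mulr_natl.
    rewrite prodr_const; congr (_ ^+ _).
    by have := cardC1 k0; rewrite card_ord => <-; apply: eq_card => k; rewrite !inE.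
  have mh : m.+1%:R * h <= 4 * N.
    rewrite /h mulrA ler_pdivrMr // -natr1.
    have : 1 <= m%:R :> R by rewrite ler1n.
    by have := ltW N0; nra.
  have b1 : (m.+1%:R * h) ^+ d.-1 <= (4 * N) ^+ d.-1.
    by apply: lerXn2r; rewrite ?nnegrE ?mulr_ge0 ?(ltW h0) ?(ltW N0).
  apply: (@le_lt_trans _ _ (V / m%:R)).
    have -> : V / m%:R = 2 * ((C + 1) * h) * (4 * N) ^+ d.-1.
      by rewrite /V /h; field; rewrite gt_eqF.
    have Ch : 0 <= C * h by rewrite mulr_ge0 // ltW.
    apply: ler_pM => //; [by rewrite mulr_ge0|by rewrite exprn_ge0 // mulr_ge0 // ltW|].
    by rewrite ler_wpM2l // ler_wpM2r ?(ltW h0) // lerDl.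
  rewrite ltr_pdivrMr // mulrC -ltr_pdivrMr //.
  apply: (lt_trans (archi_boundP _)); first by rewrite divr_ge0 // ltW.
  by rewrite ltr_nat.
(* The finite list of boxes is continued by a single point. Its volume is 0 because [d] is positive;
   the empty product would be 1. *)
pose dflt : 'cV[R]_d := const_mx 0.
pose ith n : option I := nth None (map Some (enum {: I})) n.
exists (fun n => if ith n is Some f then A f else dflt), (fun n => if ith n is Some f then B f else dflt).
have d0 : (0 < d)%N by apply: leq_trans (ltn_ord k0).
split.
  move=> x [xc xN].
  have cell k : exists i : 'I_m.+1, i%:R <= (x k 0 + N) / h <= i.+1%:R.
    apply: floor_cell; have := xN k; rewrite ler_norml => /andP[x1 x2].
    rewrite divr_ge0 ?(ltW h0) //=; last by lra.
    rewrite ler_pdivrMr // /h mulrCA divff ?gt_eqF // mulr1; lra.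
  have [i iP] := choice cell.
  pose f : I := [ffun k => if k == k0 then ord0 else i k].
  have lof l : l != k0 -> lo f l <= x l 0 <= lo f l + h.
    move=> lk; rewrite /lo ffunE (negbTE lk); have := iP l.
    rewrite ler_pdivlMr // ler_pdivrMr // -natr1 mulrDl mul1r => /andP[]; lra.
  exists (index f (enum {: I})) => //=.
  have -> : ith (index f (enum {: I})) = Some f.
    by rewrite /ith (nth_map f) ?index_mem ?mem_enum // nth_index // mem_enum.
  move=> k; rewrite !mxE; case: eqP => [->|/eqP]; last exact: lof.
  have xk0 : x k0 0 - ctr f = - \sum_(l | l != k0) a l 0 / a k0 0 * (x l 0 - lo f l).
    have -> : x k0 0 = (c - \sum_(l | l != k0) a l 0 * x l 0) / a k0 0.
      by rewrite -xc dotE (bigD1 k0) //= addrK mulrAC divff // mul1r.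
    rewrite /ctr -mulrBl; set S1 := \sum_(l | _) _; set S2 := \sum_(l | _) _.
    have -> : c - S1 - (c - S2) = S2 - S1 by ring.
    by rewrite -sumrB mulr_suml -sumrN; apply: eq_bigr => l _; field.
  have : `|x k0 0 - ctr f| <= wd f.
    rewrite xk0 normrN /wd ffunE eqxx eqxx mulr_suml.
    apply: (le_trans (ler_norm_sum _ _ _)); apply: ler_sum => l lk.
    rewrite normrM ler_wpM2l //; have /andP[l1 l2] := lof l lk.
    by rewrite ler_norml; lra.
  by rewrite ler_distl.
rewrite (@eseries_finite _ #|{: I}|).
- rewrite sumEFin lte_fin; apply: le_lt_trans vol_sum.
  rewrite le_eqVlt; apply/orP; left; apply/eqP.
  rewrite -[in RHS]big_enum /= (big_nth [ffun=> ord0]) -cardE.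
  rewrite [LHS]big_nat [RHS]big_nat; apply: eq_bigr => n /= nI.
  by rewrite /ith (nth_map [ffun=> ord0]) // -cardE.
- move=> n; rewrite lee_fin; case: (ith n) => [f|]; apply: prodr_ge0 => k _; by rewrite le_max lexx.
- move=> n nI; have nI' : (size (map Some (enum {: I})) <= n)%N by rewrite size_map -cardE.
  rewrite /ith nth_default // /box_vol.
  rewrite (eq_bigr (fun=> 0)); last by move=> k _; rewrite subrr maxxx.
  by rewrite prodr_const card_ord expr0n eqn0Ngt d0.
Qed.

(** Absolute continuity is applied to the bounded pieces of the hyperplane, which countable
    subadditivity of [P] reassembles. *)
Lemma hyperplane_prob0 (P : probability Rd R) a (c : R) :
  (forall B, borelRd B -> lebesgue_null B -> P B = 0%E) -> a != 0 ->
  P [set x | dot a x = c] = 0%E.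
Proof.
move=> Pac a0.
pose H (n : nat) : set Rd := [set x | dot a x = c /\ forall k, `|x k 0| <= n.+1%:R].
have mc (f : Rd -> R) (r : R) : measurable_fun setT f -> measurable [set x | f x <= r].
  move=> mf; rewrite (_ : [set x | _] = ~` [set x | r < f x]).
    exact/measurableC/measurable_set_gt.
  by apply/seteqP; split => x /=; rewrite leNgt => /negP.
have mdot : measurable [set x : Rd | dot a x = c].
  rewrite (_ : [set x | _] = [set x : Rd | dot a x <= c] `&` [set x : Rd | c <= dot a x]).
    by apply: measurableI; [apply: mc|apply: measurable_set_ge]; exact: measurable_dot.
  apply/seteqP; split => x /=; first by move=> ->.
  by move=> [h1 h2]; apply/eqP; rewrite eq_le h1 h2.
have mH n : measurable (H n).
  rewrite (_ : H n = [set x : Rd | dot a x = c] `&`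
      \bigcap_(k in [set: 'I_d]) [set x : Rd | `|x k 0| <= n.+1%:R]).
    apply: measurableI => //; apply: fin_bigcap_measurable; first exact: finite_finset.
    move=> k _; apply: mc; apply: measurableT_comp => //; exact: measurable_coord.
  by apply/seteqP; split => x /= [h1 h2]; split => // k; [move=> _; exact: h2|exact: h2].
apply/eqP; rewrite eq_le measure_ge0 andbT.
have sub : [set x : Rd | dot a x = c] `<=` \bigcup_n H n.
  move=> x xc; pose M := \sum_k `|x k 0|.
  have M0 : 0 <= M by apply: sumr_ge0.
  exists (Num.bound M) => //; split => // k.
  apply: (@le_trans _ _ M); first by rewrite /M (bigD1 k) //= lerDl; apply: sumr_ge0.
  by apply: (le_trans (ltW (archi_boundP M0))); rewrite ler_nat.
apply: (le_trans (measure_sigma_subadditive P mH mdot sub)).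
rewrite eseries0 // => n _ _; apply: Pac; first exact: mH.
exact: bounded_hyperplane_null.
Qed.

End Hyperplanes.

(** * Strips of small weight *)

Section Shrinking.
Context {d} {T : measurableType d} {R : realType} (P : probability T R).

(** Dominated convergence with bound [w ^+ 2]. It serves both the tails of the norm, which shrink to
    the empty set, and the slabs, which shrink to a hyperplane. *)
Lemma shrinking_integral (w : T -> R) (F : nat -> set T) (kappa : R) :
  square_integrable P w -> (forall n, measurable (F n)) ->
  (forall n m, (n <= m)%N -> F m `<=` F n) -> P (\bigcap_n F n) = 0%E -> 0 < kappa ->
  exists n, \int[P]_x (w x ^+ 2 * \1_(F n) x) <= kappa.
Proof.
move=> [mw iw2] mF decF PF kappa0.
have mw2 : measurable_fun setT (fun x => w x ^+ 2) by exact: measurable_funX.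
have mcap : measurable (\bigcap_n F n) by exact: bigcapT_measurable.
have mwF A : measurable A -> measurable_fun setT (fun x => w x ^+ 2 * \1_A x).
  by move=> mA; apply: measurable_funM => //; exact: measurable_indic.
have iwF A : measurable A -> P.-integrable setT (EFin \o (fun x => w x ^+ 2 * \1_A x)).
  move=> mA; apply: (le_integrable measurableT _ _ iw2); first exact/measurable_EFinP/mwF.
  move=> x _; rewrite /= lee_fin normrM ler_piMr // indicE.
  by case: (x \in A); rewrite ?normr1 ?normr0.
have lim0 : \int[P]_x (w x ^+ 2 * \1_(\bigcap_n F n) x) = 0.
  have E : (fun x => w x ^+ 2 * \1_(\bigcap_n F n) x) = (fun x => w x ^+ 2) \_ (\bigcap_n F n).
    apply/funext => x; rewrite patchE indicE; case: ifP => _; rewrite ?mulr1 ?mulr0 //.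
  rewrite E -Rintegral_mkcond /Rintegral null_set_integral //.
  exact/measurable_EFinP/measurable_funTS.
have cv : \int[P]_x (w x ^+ 2 * \1_(F n) x) @[n --> \oo] --> (0 : R).
  rewrite -lim0; apply: fine_cvg; rewrite fineK; last by apply: integrable_fin_num => //; exact: iwF.
  apply: (@dominated_cvg _ _ _ P setT measurableT (fun n x => (w x ^+ 2 * \1_(F n) x)%:E)
    (fun x => (w x ^+ 2 * \1_(\bigcap_n F n) x)%:E) (fun x => (w x ^+ 2)%:E)) => //.
  - by move=> n; exact/measurable_EFinP/mwF.
  - move=> x _; apply: cvg_near_cst.
    have [Fx|] := pselect ((\bigcap_n F n) x).
      by near=> n; rewrite !indicE !mem_set //; exact: Fx.
    rewrite -existsNP => -[n0 /not_implyP[_ nF]].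
    near=> n; rewrite !indicE !memNset //.
      by move=> h; apply: nF; exact: h.
    move=> h; apply: nF; apply: (decF n0 n) => //; near: n; exact: nbhs_infty_ge.
  - move=> n x _; rewrite /= lee_fin normrM (ger0_norm (sqr_ge0 _)) ler_piMr ?sqr_ge0 // indicE.
    by case: (x \in F n); rewrite ?normr1 ?normr0.
have := cvgr_lt 0 cv kappa kappa0.
by move=> [n _ h]; exists n; apply/ltW/h => /=.
Unshelve. all: by end_near. Qed.

End Shrinking.

Section Strips.
Context {R : realType} {d : nat}.
Variables (P : probability (@Rd R d) R) (A : 'M[R]_d) (mu : 'cV[R]_d).
Hypothesis Pac : forall B, borelRd B -> lebesgue_null B -> P B = 0%E.
Hypothesis Au : A \in unitmx.

Definition norm1 (x : 'cV[R]_d) : R := \sum_k `|x k 0|.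

Lemma norm1_coord (x : 'cV[R]_d) k : `|x k 0| <= norm1 x.
Proof. by rewrite /norm1 (bigD1 k) //= lerDl; apply: sumr_ge0. Qed.

Lemma norm1_ge0 (x : 'cV[R]_d) : 0 <= norm1 x.
Proof. exact: sumr_ge0. Qed.

Definition level (u x : 'cV[R]_d) : R := bilin A u (x - mu).

Lemma level_dot u x : level u x = dot (A^T *m u) x - dot (A^T *m u) mu.
Proof.
have -> : level u x = dot (A^T *m u) (x - mu) by rewrite /level /bilin /dot trmx_mul trmxK.
by rewrite -scaleN1r dotDr dotZr mulN1r.
Qed.

Lemma measurable_level u : measurable_fun setT (level u : @Rd R d -> R).
Proof.
rewrite (_ : level u = (fun x => dot (A^T *m u) x - dot (A^T *m u) mu)); last exact/funext/level_dot.
by apply: measurable_funB; [exact: measurable_dot|exact: measurable_cst].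
Qed.

Lemma level_prob0 u c : u != 0 -> P [set x | level u x = c] = 0%E.
Proof.
move=> u0; rewrite (_ : [set x | _] = [set x | dot (A^T *m u) x = c + dot (A^T *m u) mu]).
  apply: hyperplane_prob0 => //; apply: contra u0 => /eqP Au0.
  by rewrite -[u]mul1mx -(mulVmx (_ : A^T \in unitmx)) ?unitmx_tr // -mulmxA Au0 mulmx0.
by apply/seteqP; split => x /=; rewrite level_dot; lra.
Qed.

Lemma level_le (u x : 'cV[R]_d) : (forall k, `|u k 0| <= 1) -> `|level u x| <= entry_sum A * (norm1 x + norm1 mu).
Proof.
move=> u1; rewrite /level bilin_sum mulr_suml; apply: (le_trans (ler_norm_sum _ _ _)).
apply: ler_sum => i _; rewrite mulr_suml; apply: (le_trans (ler_norm_sum _ _ _)).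
apply: ler_sum => j _; rewrite !normrM.
have h : `|(x - mu) j 0| <= norm1 x + norm1 mu.
  rewrite mxE [(- mu) j 0]mxE; apply: (le_trans (ler_normB _ _)).
  by apply: lerD; exact: norm1_coord.
by apply: ler_pM => //; rewrite ler_piMl.
Qed.

Lemma level_diff (u u' x : 'cV[R]_d) (r : R) : (forall k, `|u k 0 - u' k 0| <= r) ->
  `|level u x - level u' x| <= r * (entry_sum A * (norm1 x + norm1 mu)).
Proof.
move=> ur.
have [r0|r0] := ltP 0 r; last first.
  suff -> : u = u'.
    rewrite subrr normr0.
    (* In dimension 0 the hypothesis leaves [r] free to be negative, but [entry_sum A] vanishes. *)
    have [d0|d0] := posnP d; last first.
      have := le_trans (normr_ge0 _) (ur (Ordinal d0)).
      move=> r0'; have -> : r = 0 by apply/eqP; rewrite eq_le r0 r0'.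
      by rewrite mul0r.
    rewrite /entry_sum big1 ?mul0r ?mulr0 // => i _.
    by have := leq_trans (ltn_ord i) (eq_leq d0).
  by apply/colP => k; apply/eqP; rewrite -subr_eq0 -normr_le0 (le_trans (ur k)).
have -> : level u x - level u' x = r * level (r^-1 *: (u - u')) x.
  rewrite /level bilinZl mulrA divff ?gt_eqF // mul1r bilinDl; congr (_ + _).
  by rewrite -(scaleN1r u') bilinZl mulN1r.
rewrite normrM (gtr0_norm r0) ler_pM2l //; apply: level_le => k.
rewrite mxE normrM normfV (gtr0_norm r0) ler_pdivrMl // mulr1.
by rewrite mxE [(- u') k 0]mxE.
Qed.

Lemma finite_lower_bound (I : finType) (f : I -> R) : (forall i, 0 < f i) ->
  exists2 e, 0 < e & forall i, e <= f i.
Proof.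
move=> f0; pose s := 1 + \sum_i (f i)^-1.
have s0 : 0 < s by rewrite ltr_wpDr // sumr_ge0 // => i _; rewrite invr_ge0 ltW.
exists s^-1; first by rewrite invr_gt0.
move=> i; rewrite invf_ple ?posrE // /s (bigD1 i) //= addrCA lerDl.
by rewrite addr_ge0 // sumr_ge0 // => j _; rewrite invr_ge0 ltW.
Qed.

(** The width grows with [norm1 x] because changing the coefficients by [del] moves an affine form
    by up to [del * (1 + norm1 x)]. *)
Definition strip (del : R) (u : 'cV[R]_d) (c : R) : set 'cV[R]_d :=
  [set x | `|level u x - c| <= del * (1 + norm1 x)].

Lemma measurable_set_le (f : @Rd R d -> R) (r : R) : measurable_fun setT f ->
  measurable [set x | f x <= r].
Proof.
move=> mf; rewrite (_ : [set x | _] = ~` [set x | r < f x]).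
  exact/measurableC/measurable_set_gt.
by apply/seteqP; split => x /=; rewrite leNgt => /negP.
Qed.

Lemma measurable_norm1 : measurable_fun setT (norm1 : @Rd R d -> R).
Proof.
by apply: measurable_sum => k; apply: measurableT_comp => //; exact: measurable_coord.
Qed.

(** Strips widen at infinity and thresholds are unbounded, so a compact sphere is not enough. Every
    set contains [Tail], where [norm1 x] exceeds [M]. Elsewhere levels of unit directions are at
    most [Q], so a strip with [|c| > Q + 1] lies in [Tail], and the other pairs [(u, c)] form a
    compact set. *)
Lemma strip_net (w : @Rd R d -> R) (kappa : R) : square_integrable P w -> 0 < kappa ->
  exists2 del : R, 0 < del & exists (I : finType) (S : I -> set (@Rd R d)),
    (forall i, measurable (S i) /\ \int[P]_x (w x ^+ 2 * \1_(S i) x) <= kappa) /\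
    (forall u c, sqnorm u = 1 -> exists i, strip del u c `<=` S i).
Proof.
move=> w2 kappa0; have [mw iw2] := w2.
have k2 : 0 < kappa / 2 by rewrite divr_gt0.
have mw2 : measurable_fun setT (fun x => w x ^+ 2) by exact: measurable_funX.
have iwF B : measurable B -> P.-integrable setT (EFin \o (fun x => w x ^+ 2 * \1_B x)).
  move=> mB; apply: (le_integrable measurableT _ _ iw2).
    by apply/measurable_EFinP; apply: measurable_funM => //; exact: measurable_indic.
  move=> x _; rewrite /= lee_fin normrM ler_piMr // indicE.
  by case: (x \in B); rewrite ?normr1 ?normr0.
pose tail (M : nat) : set (@Rd R d) := [set x | M%:R < norm1 x].
have mtail M : measurable (tail M) by apply: measurable_set_gt; exact: measurable_norm1.
have [M tailM] : exists M : nat, \int[P]_x (w x ^+ 2 * \1_(tail M) x) <= kappa / 2.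
  apply: (shrinking_integral w2 mtail _ _ k2).
  - by move=> n m nm x; rewrite /tail /=; apply: le_lt_trans; rewrite ler_nat.
  - rewrite (_ : \bigcap_n _ = set0) ?measure0 //.
    apply/seteqP; split => // x h; have := h (Num.bound (norm1 x)) I.
    by rewrite /tail /= ltNge ltW // archi_boundP // norm1_ge0.
set Tail := tail M in tailM.
have mTail : measurable Tail by exact: mtail.
pose M1 : R := M%:R + 1; have M10 : 0 < M1 by rewrite ltr_wpDl.
pose Q := entry_sum A * (M1 + norm1 mu).
have es0 := entry_sum_ge0 A.
have Q0 : 0 <= Q by rewrite mulr_ge0 // addr_ge0 ?norm1_ge0 // ltW.
pose slab (p : 'rV[R]_d * R) (r : R) : set (@Rd R d) := [set x | `|level p.1^T x - p.2| <= r].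
have mslab p r : measurable (slab p r).
  apply: measurable_set_le; apply: measurableT_comp => //; apply: measurable_funB.
    exact: measurable_level.
  exact: measurable_cst.
(* Half of the thickness [2 * r] is spent on moving [p] inside its neighbourhood, half on the width
   of the strip. Pairs off the sphere get the dummy radius 1. *)
have rad (p : 'rV[R]_d * R) : exists r, 0 < r /\
    (sqnorm p.1^T = 1 -> \int[P]_x (w x ^+ 2 * \1_(slab p (2 * r)) x) <= kappa / 2).
  have [p1|p1] := eqVneq (sqnorm p.1^T) 1; last first.
    by exists 1; split => //; move=> /eqP; rewrite (negbTE p1).
  have [n hn] : exists n : nat, \int[P]_x (w x ^+ 2 * \1_(slab p n.+1%:R^-1) x) <= kappa / 2.
    apply: (@shrinking_integral _ (@Rd R d) R P w (fun n => slab p n.+1%:R^-1)) => //.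
    - move=> n m nm x; rewrite /slab /= => /le_trans; apply; rewrite lef_pV2 ?posrE //.
      by rewrite ler_nat.
    - rewrite (_ : \bigcap_n _ = [set x | level p.1^T x = p.2]).
        apply: level_prob0; apply/eqP => p0; move: p1; rewrite p0.
        rewrite /sqnorm big1 => [/esym/eqP|k _]; last by rewrite mxE expr0n.
        by rewrite oner_eq0.
      apply/seteqP; split => x /=; last by move=> h n _; rewrite /slab /= h subrr normr0.
      move=> h; apply/eqP; rewrite -subr_eq0 -normr_le0 leNgt; apply/negP => h0.
      have := h (Num.bound (`|level p.1^T x - p.2|^-1)) I; rewrite /slab /=.
      rewrite leNgt => /negP; apply; rewrite invf_plt ?posrE //.
      apply: (lt_trans (archi_boundP _)); first by rewrite invr_ge0.
      by rewrite ltr_nat.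
  exists (n.+1%:R^-1 / 2); split; first by rewrite divr_gt0.
  by move=> _; rewrite mulrC divfK.
have [r rP] := choice rad.
have r0 p : 0 < r p by case: (rP p).
pose K : set ('rV[R]_d * R) := [set v | sqnorm v^T = 1] `*` `[- (Q + 1), Q + 1]%classic.
have Kc : compact K.
  apply: compact_setX; last exact: segment_compact.
  apply: (@subclosed_compact _ _ [set v : 'rV[R]_d | forall i, v ord0 i \in `[(-1 : R), (1 : R)]]).
  - have sqE (v : 'rV[R]_d) : sqnorm v^T = \sum_k v 0 k ^+ 2.
      by apply: eq_bigr => k _; rewrite mxE.
    have -> : [set v : 'rV[R]_d | sqnorm v^T = 1] =
        (fun v : 'rV[R]_d => \sum_k v 0 k ^+ 2) @^-1` [set 1].
      by apply/seteqP; split => v /=; rewrite sqE.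
    apply: closed_comp; last exact: closed_eq.
    move=> v _; apply: cvg_big; [exact: add_continuous|exact: nbhs_filter|].
    move=> k _; apply: (cvg_comp (fun v : 'rV[R]_d => v 0 k) (fun y : R => y ^+ 2)).
      exact: coord_continuous.
    exact: exprn_continuous.
  - by apply: (@rV_compact _ _ (fun=> `[(-1 : R), (1 : R)]%classic)) => _; exact: segment_compact.
  - move=> v /= v1 i; rewrite /= in_itv /= -ler_norml.
    by have := unit_coord v1 i; rewrite mxE.
pose near_set (p : 'rV[R]_d * R) := [set p' : 'rV[R]_d * R | forall x, norm1 x <= M%:R ->
  `|(level p'.1^T x - p'.2) - (level p.1^T x - p.2)| <= r p].
have near_nbhs p : nbhs p (near_set p).
  pose eta := r p / (Q + 1); have eta0 : 0 < eta by rewrite divr_gt0 // ltr_wpDl.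
  have c1 (k : 'I_d) : \forall p' \near p, `|p.1 0 k - (p' : 'rV[R]_d * R).1 0 k| < eta.
    have h : (fun p' : 'rV[R]_d * R => p'.1 0 k) @ p --> p.1 0 k.
      apply: (@cvg_comp _ _ _ (@fst 'rV[R]_d R) (fun v : 'rV[R]_d => v 0 k)); first exact: cvg_fst.
      exact: coord_continuous.
    by move/cvgrPdist_lt : h; exact.
  have c2 : \forall p' \near p, `|p.2 - (p' : 'rV[R]_d * R).2| < eta.
    have h : (@snd 'rV[R]_d R) @ p --> p.2 by exact: cvg_snd.
    by move/cvgrPdist_lt : h; exact.
  have c1' : \forall p' \near p, forall k : 'I_d, `|p.1 0 k - (p' : 'rV[R]_d * R).1 0 k| < eta.
    apply: (@filter_forall _ 'I_d (fun (k : 'I_d) (p' : 'rV[R]_d * R) => `|p.1 0 k - p'.1 0 k| < eta) (nbhs p)) => k.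
    exact: c1.
  near=> p'; move=> x xM.
  have h1 : `|level p'.1^T x - level p.1^T x| <= eta * (entry_sum A * (norm1 x + norm1 mu)).
    apply: level_diff => k; rewrite !mxE distrC ltW //; exact: (near c1' p').
  have h2 : `|p.2 - p'.2| <= eta by apply: ltW; exact: (near c2 p').
  have -> : level p'.1^T x - p'.2 - (level p.1^T x - p.2) =
     (level p'.1^T x - level p.1^T x) + (p.2 - p'.2) by ring.
  apply: (le_trans (ler_normD _ _)); apply: (le_trans (lerD h1 h2)).
  apply: (@le_trans _ _ (eta * (Q + 1))).
    rewrite [eta * (Q + 1)]mulrDr mulr1 lerD2r ler_wpM2l ?(ltW eta0) // ler_wpM2l // lerD2r.
    by apply: (le_trans xM); rewrite lerDl.
  by rewrite /eta divfK // gt_eqF // ltr_wpDl.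
have : @cover_compact ('rV[R]_d * R : normedModType R)%type K.
  have <- := @compact_cover ('rV[R]_d * R : normedModType R)%type; exact: Kc.
move=> /(_ ('rV[R]_d * R)%type K (fun p => (near_set p)^°%classic)).
move=> [| |D DK Dcov].
- by move=> p _; exact: open_interior.
- by move=> p Kp; exists p => //; exact: near_nbhs.
have [e e0 eD] := @finite_lower_bound (seq_sub (finmap.enum_fset D)) (fun q => r (val q)) (fun q => r0 _).
(* Where [norm1 x <= M], a strip has width at most [Num.min e 1]: [e] is below every radius of the
   finite cover, and 1 is the margin between [Q] and the large thresholds. *)
pose del := Num.min e 1 / M1.
have del0 : 0 < del by rewrite divr_gt0 // lt_min e0 ltr01.
exists del => //.
pose S (i : option (seq_sub (finmap.enum_fset D))) : set (@Rd R d) :=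
  if i is Some q then slab (val q) (2 * r (val q)) `|` Tail else Tail.
exists (option (seq_sub (finmap.enum_fset D))), S; split.
  case=> [q|] /=; last by split => //; apply: (le_trans tailM); lra.
  have qK : K (val q) by apply: set_mem; apply: DK; exact: valP.
  split; first exact: measurableU.
  apply: (@le_trans _ _ (\int[P]_x (w x ^+ 2 * \1_(slab (val q) (2 * r (val q))) x
      + w x ^+ 2 * \1_Tail x))).
    apply: le_Rintegral => //.
    - by apply: iwF; exact: measurableU.
    - have := integrableD measurableT (iwF _ (mslab (val q) (2 * r (val q)))) (iwF _ mTail).
      by apply: eq_integrable => // x _; rewrite /= EFinD.
    move=> x _; rewrite -mulrDr ler_wpM2l ?sqr_ge0 // !indicE in_setU.
    by case: (x \in slab _ _); case: (x \in Tail) => /=; lra.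
  rewrite RintegralD //; [|exact: iwF|exact: iwF].
  have [_ /(_ qK.1) h] := rP (val q); lra.
move=> u c u1.
have delM x : norm1 x <= M%:R -> del * (1 + norm1 x) <= Num.min e 1.
  move=> xM; apply: (@le_trans _ _ (del * M1)); last by rewrite divfK ?gt_eqF.
  by rewrite ler_wpM2l ?(ltW del0) // /M1 addrC lerD2r.
have [cQ|cQ] := leP `|c| (Q + 1); last first.
  exists None => x /= hx; rewrite /Tail /tail /= ltNge; apply/negP => xM.
  have h1 := le_trans hx (delM _ xM).
  have h2 : Num.min e 1 <= 1 by rewrite ge_min lexx orbT.
  have h3 : `|level u x| <= Q.
    apply: (le_trans (level_le x (unit_coord u1))); rewrite ler_wpM2l // lerD2r.
    by apply: (le_trans xM); rewrite lerDl.
  have := ler_normB (level u x) (level u x - c); rewrite opprB addrC subrK.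
  lra.
have Kuc : K (u^T, c) by split => /=; [rewrite trmxK|rewrite in_itv /= -ler_norml].
have [q qD hq] := Dcov _ Kuc.
exists (Some (SeqSub qD)) => x hx /=.
have [xM|xM] := leP (norm1 x) M%:R; last by right.
left; have := interior_subset hq x xM; rewrite /= trmxK => h.
have h1 : `|level u x - c| <= r q.
  apply: (le_trans hx); apply: (le_trans (delM _ xM)); rewrite ge_min.
  by have := eD (SeqSub qD); rewrite /= => ->.
have := ler_normB (level u x - c) (level u x - c - (level q.1^T x - q.2)).
rewrite opprB addrC subrK /slab /=; lra.
Unshelve. all: by end_near. Qed.

End Strips.

(** * Asymptotics of the plug-in parameters *)

Section Likely.
Context {dd} {Omega : measurableType dd} {R : realType} (Pr : probability Omega R).

(* [Q n] need not be measurable, hence the exceptional set [Bad]. *)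
Definition likely (Q : nat -> Omega -> Prop) := forall eta : R, 0 < eta ->
  exists n0, forall n, (n0 <= n)%N -> exists2 Bad, measurable Bad /\ (Pr Bad <= eta%:E)%E &
  forall om, ~ Bad om -> Q n om.

Lemma likely_sub (Q Q' : nat -> Omega -> Prop) : (forall n om, Q n om -> Q' n om) ->
  likely Q -> likely Q'.
Proof.
move=> QQ' lQ eta eta0; have [n0 h] := lQ _ eta0; exists n0 => n n0n.
by have [Bad B hB] := h n n0n; exists Bad => // om /hB; exact: QQ'.
Qed.

Lemma likely_eventually (Q : nat -> Omega -> Prop) n0 :
  (forall n om, (n0 <= n)%N -> Q n om) -> likely Q.
Proof.
move=> h eta eta0; exists n0 => n n0n; exists set0; last by move=> om _; exact: h.
by split; [exact: measurable0|rewrite measure0 lee_fin ltW].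
Qed.

Lemma likely_forall (J : finType) (Q : J -> nat -> Omega -> Prop) :
  (forall j, likely (Q j)) -> likely (fun n om => forall j, Q j n om).
Proof.
move=> lQ eta eta0; pose e : R := eta / #|J|.+1%:R.
have e0 : 0 < e by rewrite divr_gt0.
have [N hN] := choice (fun j => lQ j e e0).
exists (\max_j N j) => n nN.
have ex j : exists Bad, (measurable Bad /\ (Pr Bad <= e%:E)%E) /\ forall om, ~ Bad om -> Q j n om.
  have [|Bad h1 h2] := hN j n; last by exists Bad.
  by apply: leq_trans nN; exact: leq_bigmax.
have [B hB] := choice ex.
have mB j : measurable (B j) by case: (hB j) => -[].
exists (\big[setU/set0]_j B j).
  split; first exact: bigsetU_measurable.
  apply: (le_trans (measure_bigsetU_le Pr mB)).
  apply: (@le_trans _ _ (\sum_(j : J) e%:E)%E).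
    by apply: lee_sum => j _; case: (hB j) => -[].
  rewrite sumEFin lee_fin sumr_const -[X in _ *+ X]/(#|J|) -mulr_natl /e mulrCA ler_piMr ?(ltW eta0) //.
  by rewrite ler_pdivrMr // mul1r ler_nat.
move=> om nB j; case: (hB j) => _; apply => Bj; apply: nB.
by rewrite -bigcup_fin_type; exists j.
Qed.

Lemma likely_and (Q Q' : nat -> Omega -> Prop) : likely Q -> likely Q' ->
  likely (fun n om => Q n om /\ Q' n om).
Proof.
move=> lQ lQ'.
have := @likely_forall bool (fun b => if b then Q else Q').
move=> /(_ _)/likely_sub; apply; last by case.
by move=> n om h; split; [exact: (h true)|exact: (h false)].
Qed.

(* It suffices to control the process up to a constant that depends on the
   allowed probability of failure. *)
Lemma likely_of_tight (Q : nat -> Omega -> Prop) :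
  (forall eta : R, 0 < eta -> exists Q' : nat -> Omega -> Prop, likely Q' /\
    exists n0, forall n, (n0 <= n)%N -> exists2 Bad, measurable Bad /\ (Pr Bad <= eta%:E)%E &
    forall om, ~ Bad om -> Q' n om -> Q n om) -> likely Q.
Proof.
move=> h eta eta0; have e0 : 0 < eta / 2 by rewrite divr_gt0.
have [Q' [lQ' [n0 hn]]] := h _ e0; have [n1 hn1] := lQ' _ e0.
exists (maxn n0 n1) => n; rewrite geq_max => /andP[n0n n1n].
have [B [mB PB] hB] := hn n n0n; have [B' [mB' PB'] hB'] := hn1 n n1n.
exists (B `|` B').
  split; first exact: measurableU.
  apply: (le_trans (measureU2 _ _ _)) => //; rewrite [eta]splitr EFinD; exact: leeD.
move=> om nB; apply: hB; first by move=> Bo; apply: nB; left.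
by apply: hB' => Bo; apply: nB; right.
Qed.

End Likely.

(** * The law of the observations *)

Section Law.
Context {R : realType} {d : nat} {dd} {Omega : measurableType dd} (Pr : probability Omega R).
Variable X : Omega -> 'cV[R]_d.
Hypothesis rX : random_vector X.

Lemma law_of_random_vector : exists P : probability (@Rd R d) R,
  [/\ forall B, P B = Pr (X @^-1` B),
      forall f : @Rd R d -> \bar R, measurable_fun setT f -> (forall x, (0 <= f x)%E) ->
        (\int[Pr]_w f (X w) = \int[P]_x f x)%E,
      forall f : @Rd R d -> \bar R, P.-integrable setT f ->
        (\int[Pr]_w f (X w) = \int[P]_x f x)%E &
      forall g : @Rd R d -> R, P.-integrable setT (EFin \o g) ->
        \int[Pr]_w g (X w) = \int[P]_x g x].
Proof.
have mX : measurable_fun setT (X : Omega -> @Rd R d).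
  by move=> _ B mB; rewrite setTI; exact: rX.
pose p : {mfun Omega >-> @Rd R d} := HB.pack X (isMeasurableFun.Build _ _ _ _ _ mX).
have nonneg (f : @Rd R d -> \bar R) : measurable_fun setT f -> (forall x, (0 <= f x)%E) ->
    (\int[Pr]_w f (X w) = \int[distribution Pr p]_x f x)%E.
  by move=> mf f0; rewrite -(@ge0_integral_distribution _ _ _ _ _ Pr p f).
have int (f : @Rd R d -> \bar R) : (distribution Pr p).-integrable setT f ->
    (\int[Pr]_w f (X w) = \int[distribution Pr p]_x f x)%E.
  move=> fi; have /integrableP[mf fi'] := fi.
  rewrite (@integral_distribution _ _ _ _ _ Pr p) //.
  apply/integrableP; split; first exact: measurableT_comp.
  by rewrite (nonneg (fun x => `|f x|%E)) //; exact: measurableT_comp.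
exists (distribution Pr p); split => //.
by move=> g gi; rewrite /Rintegral (int (EFin \o g)).
Qed.

Lemma iid_copies_sequence (P : probability (@Rd R d) R) Xs : (forall B, P B = Pr (X @^-1` B)) ->
  iid_copies Pr Xs X -> iid_sequence Pr P Xs.
Proof.
move=> PE [rXs [law indep]]; split.
- by move=> i _ B mB; rewrite setTI; exact: rXs.
- by move=> i B mB; rewrite PE; exact: law.
- move=> I B uI mB; rewrite indep //; apply: eq_bigr => i _; rewrite PE; exact: (law i (B i) (mB i)).
Qed.

Lemma square_integrable_coord (P : probability (@Rd R d) R) k :
  (forall f : @Rd R d -> \bar R, measurable_fun setT f -> (forall x, (0 <= f x)%E) ->
    (\int[Pr]_w f (X w) = \int[P]_x f x)%E) -> finite_second_moment Pr X ->
  square_integrable P (fun x => x k 0).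
Proof.
move=> nonneg; have mc := @measurable_coord R d.
have msq : measurable_fun setT (fun x : @Rd R d => (sqnorm x)%:E).
  by apply/measurable_EFinP; apply: measurable_sum => j; exact: measurable_funX.
rewrite /finite_second_moment (nonneg (fun x : @Rd R d => (sqnorm x)%:E)) //; last first.
  by move=> x; rewrite lee_fin sqnorm_ge0.
move=> fin; split => //; apply/integrableP; split.
  by apply/measurable_EFinP; exact: measurable_funX.
apply: le_lt_trans fin; apply: ge0_le_integral => //.
- by apply: measurableT_comp => //; apply/measurable_EFinP; exact: measurable_funX.
- by move=> x _; rewrite /= lee_fin ger0_norm ?sqr_ge0 // sqnorm_coord.
Qed.

End Law.

Section RintegralSum.
Context {d} {T : measurableType d} {R : realType} (P : probability T R).

Lemma Rintegral_sum (J : finType) (f : J -> T -> R) :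
  (forall j, P.-integrable setT (EFin \o f j)) ->
  P.-integrable setT (EFin \o (fun x => \sum_j f j x)) /\
  \int[P]_x (\sum_j f j x) = \sum_j \int[P]_x f j x.
Proof.
move=> fi; suff h (s : seq J) : P.-integrable setT (EFin \o (fun x => \sum_(j <- s) f j x)) /\
    \int[P]_x (\sum_(j <- s) f j x) = \sum_(j <- s) \int[P]_x f j x by exact: h.
elim: s => [|j s [si IH]].
  have E : (fun x => \sum_(i <- [::]) f i x) = fun=> 0 by apply/funext => x; rewrite big_nil.
  by rewrite E big_nil; split; [exact: integrable_cst_prob|exact: Rintegral_cst_prob].
have E : (fun x => \sum_(i <- j :: s) f i x) = (fun x => f j x + \sum_(i <- s) f i x).
  by apply/funext => x; rewrite big_cons.
rewrite E; split; first exact: (integrableD measurableT (fi j) si).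
by rewrite big_cons -IH RintegralD.
Qed.

End RintegralSum.

(** * Consistency of the empirical mean and covariance *)

Section Consistency.
Context {R : realType} {d : nat} {dd} {Omega : measurableType dd} (Pr : probability Omega R).
Variables (P : probability (@Rd R d) R) (Xs : nat -> Omega -> @Rd R d).
Variables (mu0 : 'cV[R]_d) (Sigma0 : 'M[R]_d).
Hypothesis iid : iid_sequence Pr P Xs.
Hypothesis coord2 : forall k, square_integrable P (fun x => x k 0).
Hypothesis mean : forall k, \int[P]_x x k 0 = mu0 k 0.
Hypothesis cov : forall k l,
  \int[P]_x ((x k 0 - mu0 k 0) * (x l 0 - mu0 l 0)) = Sigma0 k l.

Let centered2 k : square_integrable P (fun x => x k 0 - mu0 k 0).
Proof. exact: square_integrableB_cst. Qed.

Lemma covariance_psd : psdmx Sigma0.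
Proof.
split; first by apply/matrixP => k l; rewrite mxE -!cov; apply: eq_Rintegral => x _; rewrite mulrC.
move=> a; rewrite -/(bilin _ _ _) bilin_sum.
pose f (z : 'I_d * 'I_d) (x : @Rd R d) :=
  a z.1 0 * a z.2 0 * ((x z.1 0 - mu0 z.1 0) * (x z.2 0 - mu0 z.2 0)).
have fi z : P.-integrable setT (EFin \o (fun x : @Rd R d => (x z.1 0 - mu0 z.1 0) * (x z.2 0 - mu0 z.2 0))).
  by have := square_integrableM (centered2 z.1) (centered2 z.2).
have fi' z : P.-integrable setT (EFin \o f z).
  have := integrableZl measurableT (a z.1 0 * a z.2 0) (fi z).
  by apply: eq_integrable => // x _; rewrite /= -EFinM.
rewrite pair_bigA /= (_ : \sum_p _ = \sum_z \int[P]_x f z x); last first.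
  by apply: eq_bigr => z _; rewrite /f RintegralZl // cov; ring.
have [_ <-] := Rintegral_sum fi'.
apply: Rintegral_ge0 => x _.
rewrite (_ : \sum_z _ = (\sum_k a k 0 * (x k 0 - mu0 k 0)) ^+ 2) ?sqr_ge0 //.
rewrite expr2 big_distrlr /= pair_bigA /=; apply: eq_bigr => z _; rewrite /f; ring.
Qed.

Lemma likely_sample_mean (f : @Rd R d -> R) (del : R) : measurable_fun setT f ->
  P.-integrable setT (EFin \o f) -> 0 < del ->
  likely Pr (fun n om => `|n%:R^-1 * (\sum_(i < n) f (Xs i om)) - \int[P]_x f x| < del).
Proof.
move=> mf fi del0 eta eta0.
have [n0 h] := wlln iid mf fi del0 eta0.
exists n0.+1 => n n0n; have n1 : (0 < n)%N by exact: leq_ltn_trans n0n.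
exists [set w | (del * n%:R <= `|\sum_(i < n) (f (Xs i w) - \int[P]_x f x)|)%R].
  split.
    apply: measurable_set_ge; apply: measurableT_comp => //.
    apply: (@measurable_sum_Xs _ _ _ _ _ Pr P Xs iid 'I_n val (fun x => f x - \int[P]_y f y)).
    by apply: measurable_funB => //; exact: measurable_cst.
  have := h 'I_n val val_inj; rewrite card_ord; apply; exact: ltnW.
move=> om /negP; rewrite -ltNge => lt.
have n0' : 0 < n%:R :> R by rewrite ltr0n.
rewrite -(ltr_pM2r n0'); apply: le_lt_trans lt.
rewrite -[X in _ * X](gtr0_norm n0') -normrM mulrBl mulrAC mulVf ?mul1r ?gt_eqF //.
by rewrite sumrB sumr_const card_ord mulr_natr.
Qed.

Lemma emp_mean_coord n om k :
  emp_mean Xs n om k 0 = n%:R^-1 * \sum_(i < n) Xs i om k 0.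
Proof. by rewrite /emp_mean mxE summxE. Qed.

Lemma emp_cov_sym n om : (emp_cov Xs n om)^T = emp_cov Xs n om.
Proof.
rewrite /emp_cov linearZ /= linear_sum /=; congr (_ *: _).
by apply: eq_bigr => i _; rewrite trmx_mul trmxK.
Qed.

(** Centring at [mu0] makes the sum one of a fixed function of the observations, to which the law of
    large numbers applies; the correction is a product of two errors of the mean. *)
Lemma emp_cov_entry n om k l : (0 < n)%N -> emp_cov Xs n om k l =
  n%:R^-1 * \sum_(i < n) ((Xs i om k 0 - mu0 k 0) * (Xs i om l 0 - mu0 l 0)) -
  (emp_mean Xs n om k 0 - mu0 k 0) * (emp_mean Xs n om l 0 - mu0 l 0).
Proof.
move=> n0; have n0' : n%:R != 0 :> R by rewrite pnatr_eq0 -lt0n.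
rewrite /emp_cov mxE summxE.
set m := emp_mean Xs n om.
have sE j : \sum_(i < n) Xs i om j 0 = n%:R * m j 0.
  by rewrite /m emp_mean_coord mulrA divff // mul1r.
have E1 : \sum_(i < n) ((Xs i om - m) *m (Xs i om - m)^T) k l =
  \sum_(i < n) (Xs i om k 0 * Xs i om l 0) - n%:R * (m k 0 * m l 0).
  transitivity (\sum_(i < n) (Xs i om k 0 * Xs i om l 0 - m l 0 * Xs i om k 0
      - m k 0 * Xs i om l 0 + m k 0 * m l 0)).
    by apply: eq_bigr => i _; rewrite mxE big_ord1 !mxE; ring.
  rewrite !big_split /= !sumrN -!mulr_sumr !sE sumr_const card_ord -[_ *+ n]mulr_natl; ring.
have E2 : \sum_(i < n) ((Xs i om k 0 - mu0 k 0) * (Xs i om l 0 - mu0 l 0)) =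
  \sum_(i < n) (Xs i om k 0 * Xs i om l 0) - n%:R * (mu0 l 0 * m k 0) - n%:R * (mu0 k 0 * m l 0)
   + n%:R * (mu0 k 0 * mu0 l 0).
  transitivity (\sum_(i < n) (Xs i om k 0 * Xs i om l 0 - mu0 l 0 * Xs i om k 0
      - mu0 k 0 * Xs i om l 0 + mu0 k 0 * mu0 l 0)).
    by apply: eq_bigr => i _; ring.
  rewrite !big_split /= !sumrN -!mulr_sumr !sE sumr_const card_ord -[_ *+ n]mulr_natl; ring.
by rewrite E1 E2 !mulrDr ?mulrN; field.
Qed.

Lemma emp_mean_consistent (del : R) : 0 < del ->
  likely Pr (fun n om => forall k, `|emp_mean Xs n om k 0 - mu0 k 0| < del).
Proof.
move=> del0; apply: likely_forall => k.
have := likely_sample_mean (coord2 k).1 (square_integrable1 (coord2 k)) del0; apply: likely_sub => n om.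
by rewrite emp_mean_coord mean.
Qed.

Lemma emp_cov_consistent (del : R) : 0 < del ->
  likely Pr (fun n om => forall k l, `|emp_cov Xs n om k l - Sigma0 k l| < del).
Proof.
(* [e <= 1] makes the product of two errors of the mean smaller than [e] again. *)
move=> del0; pose e := Num.min (del / 2) 1.
have e0 : 0 < e by rewrite lt_min ltr01 divr_gt0.
have e2 : e <= del / 2 by rewrite ge_min lexx.
have e1 : e <= 1 by rewrite ge_min lexx orbT.
pose f (z : 'I_d * 'I_d) (x : @Rd R d) := (x z.1 0 - mu0 z.1 0) * (x z.2 0 - mu0 z.2 0).
have cross z : likely Pr (fun n om => `|n%:R^-1 * (\sum_(i < n) f z (Xs i om)) - \int[P]_x f z x| < e).
  apply: likely_sample_mean => //.
    by apply: measurable_funM; [case: (centered2 z.1)|case: (centered2 z.2)].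
  by have := square_integrableM (centered2 z.1) (centered2 z.2).
have pos : likely Pr (fun n om => (0 < n)%N) by apply: (@likely_eventually _ _ _ Pr _ 1%N).
have := likely_and pos (likely_and (likely_forall cross) (emp_mean_consistent e0)).
apply: likely_sub => n om [n0 [hc hm]] k l; rewrite emp_cov_entry //.
have := hc (k, l); rewrite /f /= cov => h1.
have h2 : `|(emp_mean Xs n om k 0 - mu0 k 0) * (emp_mean Xs n om l 0 - mu0 l 0)| < e.
  rewrite normrM; apply: (@le_lt_trans _ _ (`|emp_mean Xs n om k 0 - mu0 k 0| * 1)).
    by rewrite ler_wpM2l // ltW // (lt_le_trans (hm l)).
  by rewrite mulr1 hm.
rewrite addrAC; apply: (le_lt_trans (ler_normB _ _)).
apply: (lt_le_trans (ltrD h1 h2)); lra.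
Qed.

(* No control on the invertibility of [emp_cov] is needed: the junk values of
   [invsqrtmx] are excluded by continuity at [Sigma0]. *)
Lemma invsqrt_emp_cov_consistent (del : R) : Sigma0 \in unitmx -> 0 < del ->
  likely Pr (fun n om => forall k l,
    `|invsqrtmx (emp_cov Xs n om) k l - invsqrtmx Sigma0 k l| < del).
Proof.
move=> Su del0; have [e e0 he] := invsqrtmx_continuous covariance_psd Su del0.
by apply: likely_sub (emp_cov_consistent e0) => n om h; apply: he => //; exact: emp_cov_sym.
Qed.

End Consistency.

Lemma sum_option {V : zmodType} {I : finType} (f : option I -> V) :
  \sum_j f j = f None + \sum_i f (Some i).
Proof.
rewrite (bigD1 None) //=; congr (_ + _); rewrite (reindex_omap Some id) /=; last by case.
by apply: eq_bigl => i; rewrite eqxx.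
Qed.

(** * Coefficients of the affine forms and halfspaces *)

Section Coefficients.
Context {R : realType} {d : nat}.
Implicit Types (A : 'M[R]_d) (mu u v x : 'cV[R]_d) (c : R).

Definition coords (k : option 'I_d) : @Rd R d -> R :=
  if k is Some i then fun x => x i 0 else fun=> 1.

(* In the coordinates [(x_1, ..., x_d, 1)], [coef A mu u] is the affine form
   [u^T A (x - mu)] and [thr A mu u c] the halfspace where it is at least [c]. *)
Definition coef A mu u (k : option 'I_d) : R :=
  if k is Some i then (A^T *m u) i 0 else - dot (A^T *m u) mu.

Definition thr A mu u c (k : option 'I_d) : R := coef A mu u k - (if k is Some _ then 0 else c).

Lemma measurable_coords k : measurable_fun setT (coords k).
Proof. by case: k => [i|]; [exact: measurable_coord|exact: measurable_cst]. Qed.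

Lemma affine_coords (p : option 'I_d -> R) (x : @Rd R d) :
  affine_form p (feature coords x) = p None + \sum_i p (Some i) * x i 0.
Proof. by rewrite /affine_form sum_option /feature /= mulr1. Qed.

Lemma affine_coef A mu u (x : @Rd R d) :
  affine_form (coef A mu u) (feature coords x) = level A mu u x.
Proof. by rewrite affine_coords level_dot /= addrC [dot _ x]dotE. Qed.

Lemma affine_thr A mu u c (x : @Rd R d) :
  affine_form (thr A mu u c) (feature coords x) = level A mu u x - c.
Proof.
rewrite -affine_coef !affine_coords /thr.
by under eq_bigr do rewrite subr0; rewrite addrAC.
Qed.

Lemma ftheta_coef u v c A mu (x : @Rd R d) : ftheta u v c A mu x =
  \sum_k coef A mu (v - dot v u *: u) k * (coords k x * hs coords (thr A mu u c) x).
Proof.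
under eq_bigr do rewrite mulrA; rewrite -mulr_suml.
rewrite -/(affine_form (coef A mu (v - dot v u *: u)) (feature coords x)) affine_coef.
by rewrite hsE affine_thr subr_ge0.
Qed.

(** The threshold cancels, whence uniformity over the unbounded range of [c]. *)
Lemma thr_diff A mu u c A' mu' k : thr A mu u c k - thr A' mu' u c k = coef A mu u k - coef A' mu' u k.
Proof. by rewrite /thr; ring. Qed.

Lemma affine_coords_diff (p q : option 'I_d -> R) (r : R) (x : @Rd R d) :
  (forall k, `|p k - q k| <= r) ->
  `|affine_form p (feature coords x) - affine_form q (feature coords x)| <= r * (1 + norm1 x).
Proof.
move=> pq; rewrite !affine_coords.
rewrite (_ : _ - _ = (p None - q None) + \sum_i (p (Some i) - q (Some i)) * x i 0); last first.
  by under [X in _ = _ + X]eq_bigr do rewrite mulrBl; rewrite sumrB; ring.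
rewrite mulrDr mulr1; apply: (le_trans (ler_normD _ _)); apply: lerD => //.
rewrite /norm1 mulr_sumr; apply: (le_trans (ler_norm_sum _ _ _)); apply: ler_sum => i _.
by rewrite normrM ler_wpM2r.
Qed.

(** Half of [del] covers the estimation error, half the neighbourhood demanded by [in_strip]. Where
    two indicators differ, their forms have opposite signs, so the reference form, close to both, is
    small. *)
Lemma in_strip_thr A0 mu0 A mu u c (del : R) (S : set (@Rd R d)) : 0 < del ->
  (forall k, `|coef A mu u k - coef A0 mu0 u k| <= del / 2) ->
  strip A0 mu0 del u c `<=` S ->
  in_strip coords S (thr A mu u c) (thr A0 mu0 u c).
Proof.
move=> del0 close stripS; exists (del / 2) => [|q q' hq hq' x qq']; first by rewrite divr_gt0.
apply: stripS; rewrite /strip /= -affine_thr.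
have h1 : `|affine_form q (feature coords x) - affine_form (thr A0 mu0 u c) (feature coords x)| <= del * (1 + norm1 x).
  apply: affine_coords_diff => k.
  have -> : q k - thr A0 mu0 u c k = (q k - thr A mu u c k) + (thr A mu u c k - thr A0 mu0 u c k) by ring.
  rewrite thr_diff [del]splitr; apply: (le_trans (ler_normD _ _)); apply: lerD => //.
  exact: ltW.
have h2 : `|affine_form q' (feature coords x) - affine_form (thr A0 mu0 u c) (feature coords x)| <= del * (1 + norm1 x).
  apply: affine_coords_diff => k; apply: (le_trans (ltW (hq' k))); lra.
move: h1 h2 qq'; rewrite !hsE !ler_norml.
case: (leP 0 (affine_form q _)) => a1; case: (leP 0 (affine_form q' _)) => a2;
  rewrite ?eqxx // => /andP[h1 h2] /andP[h3 h4] _; apply/andP; split; lra.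
Qed.

Lemma trmul_bound A u i : (forall i, `|u i 0| <= 2) -> `|(A^T *m u) i 0| <= 2 * entry_sum A.
Proof.
move=> u2; rewrite mxE mulr_sumr; apply: (le_trans (ler_norm_sum _ _ _)).
apply: ler_sum => j _; rewrite mxE normrM mulrC; apply: ler_pM => //.
by rewrite (bigD1 i) //= lerDl; apply: sumr_ge0.
Qed.

Lemma dot_trmul_bound A u (y : 'cV[R]_d) : (forall i, `|u i 0| <= 2) ->
  `|dot (A^T *m u) y| <= 2 * entry_sum A * norm1 y.
Proof.
move=> u2; rewrite dotE mulr_sumr; apply: (le_trans (ler_norm_sum _ _ _)).
by apply: ler_sum => i _; rewrite normrM ler_wpM2r // trmul_bound.
Qed.

Lemma coef_bound A mu u k : (forall i, `|u i 0| <= 2) ->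
  `|coef A mu u k| <= 2 * entry_sum A * (1 + norm1 mu).
Proof.
move=> u2; have es0 := entry_sum_ge0 A; have n0 := norm1_ge0 mu.
case: k => [i|] /=.
  by apply: (le_trans (trmul_bound _ _ u2)); rewrite mulrDr mulr1 lerDl !mulr_ge0.
rewrite normrN; apply: (le_trans (dot_trmul_bound _ _ u2)).
by rewrite mulrDr mulr1 lerDr !mulr_ge0.
Qed.

Lemma coef_continuous A0 mu0 (del : R) : 0 < del -> exists2 rho : R, 0 < rho &
  forall A mu, (forall i j, `|A i j - A0 i j| < rho) -> (forall i, `|mu i 0 - mu0 i 0| < rho) ->
  forall u, (forall i, `|u i 0| <= 2) -> forall k, `|coef A mu u k - coef A0 mu0 u k| <= del.
Proof.
move=> del0; pose N : R := d%:R; pose C := 1 + 2 * (N * N) * (1 + norm1 mu0 + N) + 2 * entry_sum A0 * N.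
have n0 := norm1_ge0 mu0.
have es0 := entry_sum_ge0 A0.
have N0 : 0 <= N by rewrite ler0n.
have C1 : 1 <= C by rewrite /C -addrA lerDl addr_ge0 // !mulr_ge0 // !addr_ge0.
have C0 : 0 < C by apply: lt_le_trans C1.
exists (Num.min 1 (del / C)); first by rewrite lt_min ltr01 divr_gt0.
set rho := Num.min 1 _.
have rho1 : rho <= 1 by rewrite ge_min lexx.
have rhoC : rho * C <= del by rewrite -ler_pdivlMr // ge_min lexx orbT.
have rho0 : 0 < rho by rewrite lt_min ltr01 divr_gt0.
move=> A mu AA mm u u2 k; apply: le_trans rhoC.
(* [A] and [mu] are changed one after the other. The first increment is evaluated at [mu], whose
   norm is controlled by [rho <= 1]; the second affects the constant coefficient only. *)
have E : coef A mu u k - coef A0 mu0 u k = coef (A - A0) mu u k + (if k is None then coef A0 (mu - mu0) u None else 0).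
  case: k => [i|] /=; first by rewrite addr0 linearB /= mulmxBl !mxE.
  rewrite linearB /= mulmxBl -[- (A0^T *m u)]scaleN1r -[- mu0]scaleN1r dotDl dotZl dotDr dotZr; ring.
have normN (B : 'M[R]_d) : (forall i j : 'I_d, `|B i j| < rho) -> entry_sum B <= rho * (N * N).
  move=> h; apply: (@le_trans _ _ (\sum_(i < d) \sum_(j < d) rho)).
    by apply: ler_sum => i _; apply: ler_sum => j _; exact: ltW.
  by rewrite !sumr_const !card_ord -[rho *+ d]mulr_natr -[(rho * _) *+ d]mulr_natr mulrA.
have normm : norm1 (mu - mu0) <= rho * N.
  apply: (@le_trans _ _ (\sum_(i < d) rho)); last by rewrite sumr_const card_ord -[_ *+ d]mulr_natr.
  by apply: ler_sum => i _; rewrite mxE [(- mu0) i 0]mxE ltW.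
have normmu : norm1 mu <= norm1 mu0 + N.
  rewrite -[mu](subrK mu0); apply: (@le_trans _ _ (norm1 (mu - mu0) + norm1 mu0)).
    rewrite /norm1 -big_split /=; apply: ler_sum => i _; rewrite mxE; exact: ler_normD.
  rewrite addrC lerD2l; apply: (le_trans normm); by rewrite ler_piMl.
rewrite E; apply: (le_trans (ler_normD _ _)).
have h1 : `|coef (A - A0) mu u k| <= rho * (2 * (N * N) * (1 + norm1 mu0 + N)).
  apply: (le_trans (coef_bound _ _ _ u2)); rewrite [rho * _]mulrA; apply: ler_pM.
  - by rewrite mulr_ge0 // entry_sum_ge0.
  - by rewrite addr_ge0 ?norm1_ge0.
  - by rewrite mulrCA ler_pM2l //; apply: normN => i j; rewrite mxE [(- A0) i j]mxE.
  - lra.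
have h2 : `|if k is None then coef A0 (mu - mu0) u None else 0| <= rho * (2 * entry_sum A0 * N).
  case: k {E h1} => [i|]; first by rewrite normr0 !mulr_ge0 // ltW.
  rewrite /= normrN; apply: (le_trans (dot_trmul_bound _ _ u2)).
  by rewrite mulrCA ler_wpM2l // mulr_ge0.
apply: (le_trans (lerD h1 h2)); rewrite -mulrDr ler_pM2l // /C; lra.
Qed.

(** By Cauchy-Schwarz the correction of [v] has coordinates at most 1, like [v] itself; this is the
    origin of the bound 2 on the directions for which coefficients are controlled. *)
Lemma unit_reject u v : sqnorm u = 1 -> sqnorm v = 1 ->
  forall k, `|(v - dot v u *: u) k 0| <= 2.
Proof.
move=> u1 v1 k; have uv : `|dot v u| <= 1.
  rewrite -(@ler_pXn2r _ 2) ?nnegrE // expr1n real_normK ?num_real //.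
  by apply: (le_trans (dot_sqr_le _ _)); rewrite u1 v1 mulr1.
rewrite !mxE; apply: (le_trans (ler_normB _ _)).
have := unit_coord v1 k; have h : `|dot v u * u k 0| <= 1.
  by rewrite normrM mulr_ile1 // unit_coord.
lra.
Qed.

End Coefficients.

(** * Linearity and tightness of the empirical process *)

Section Linearity.
Context {d} {T : measurableType d} {R : realType} {dd} {Omega : measurableType dd}.
Context (P : probability T R) (Xs : nat -> Omega -> T).

(** In its uses the coefficients depend on [om]. They still come out, because the integral runs over
    a separate variable while the estimators are held fixed. *)
Lemma emp_proc_sum (J : finType) (a b : J -> R) (f g : J -> T -> R) n om :
  (forall j, square_integrable P (f j)) -> (forall j, square_integrable P (g j)) ->
  emp_proc P Xs n (fun x => \sum_j (a j * f j x + b j * g j x)) om =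
  \sum_j (a j * emp_proc P Xs n (f j) om + b j * emp_proc P Xs n (g j) om).
Proof.
move=> f2 g2.
have fi j : P.-integrable setT (EFin \o f j) by exact: square_integrable1.
have gi j : P.-integrable setT (EFin \o g j) by exact: square_integrable1.
have afi j : P.-integrable setT (EFin \o (fun x => a j * f j x)).
  by apply: square_integrable1; exact: square_integrableZ.
have bgi j : P.-integrable setT (EFin \o (fun x => b j * g j x)).
  by apply: square_integrable1; exact: square_integrableZ.
have si j : P.-integrable setT (EFin \o (fun x => a j * f j x + b j * g j x)).
  exact: (integrableD measurableT (afi j) (bgi j)).
have [_ sumE] := Rintegral_sum si.
rewrite /emp_proc sumE exchange_big /= mulr_sumr -sumrB mulr_sumr; apply: eq_bigr => j _.
rewrite RintegralD // !RintegralZl // big_split /= -!mulr_sumr; ring.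
Qed.

End Linearity.

Section Tightness.
Context {d} {T : measurableType d} {R : realType} {dd} {Omega : measurableType dd}.
Context (Pr : probability Omega R) (P : probability T R) (Xs : nat -> Omega -> T).
Hypothesis iid : iid_sequence Pr P Xs.
Context {F : finType} (phi : F -> T -> R) (k0 : F).
Hypothesis mphi : forall k, measurable_fun setT (phi k).
Hypothesis phi_k0 : forall x, phi k0 x = 1.

Lemma integral_sqr_ge0 (w : T -> R) : 0 <= \int[P]_x (w x ^+ 2).
Proof. by apply: Rintegral_ge0 => x _; exact: sqr_ge0. Qed.

(** Equicontinuity at level 0, with the whole space as strip: every halfspace is compared with the
    empty one, on which the process vanishes. *)
Lemma tight_halfspaces (w : T -> R) (eta : R) : square_integrable P w -> 0 < eta ->
  exists2 M : R, 0 < M & exists n0, forall n, (n0 <= n)%N ->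
    exists2 Bad, measurable Bad /\ (Pr Bad <= eta%:E)%E &
    forall om, ~ Bad om -> forall p, `|emp_proc P Xs n (fun x => w x * hs phi p x) om| <= M.
Proof.
move=> w2 eta0; have [L L1 hL] := equicontinuity iid mphi phi_k0 eta0.
have I0 := integral_sqr_ge0 w; set I2 := \int[P]_x (w x ^+ 2) in I0.
pose K := 8 * I2 + 1; have K0 : 0 < K by rewrite /K; lra.
have [||n0 hn] := hL w K 0%N unit (fun=> setT) w2 K0 _ (fun=> measurableT).
- by rewrite -/I2 /K; lra.
- move=> _; rewrite expr0 mulr1 (_ : \int[P]_x _ = I2) -/I2 /K; first by lra.
  by apply: eq_Rintegral => x _; rewrite indicT mulr1.
exists (2 * L * Num.sqrt K * (3 / 4) ^+ 0).
  by rewrite expr0 mulr1 !mulr_gt0 ?sqrtr_gt0 //; lra.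
exists n0 => n n0n; have [Bad mB hB] := hn n n0n; exists Bad => // om nB p.
(* an empty halfspace *)
pose p0 (k : F) : R := - (k == k0)%:R.
have p0E x : hs phi p0 x = 0.
  rewrite hsE leNgt /affine_form (bigD1 k0) //= big1 => [|k kk0].
    by rewrite /p0 eqxx /feature phi_k0 mulr1 addr0 oppr_lt0 ltr01.
  by rewrite /p0 (negbTE kk0) oppr0 mul0r.
have := hB om nB tt p p0; rewrite (_ : (fun x => _ * _) = (fun x => w x * hs phi p x)).
  by apply; exists 1.
by apply/funext => x; rewrite p0E subr0.
Qed.

End Tightness.

(** * The error of the plug-in functions *)

Section Plugin.
Context {R : realType} {d : nat} {dd} {Omega : measurableType dd} (Pr : probability Omega R).
Variables (P : probability (@Rd R d) R) (Xs : nat -> Omega -> @Rd R d).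
Variables (mu0 : 'cV[R]_d) (Sigma0 : 'M[R]_d).
Hypothesis iid : iid_sequence Pr P Xs.
Hypothesis Pac : forall B, borelRd B -> lebesgue_null B -> P B = 0%E.
Hypothesis coord2 : forall k, square_integrable P (fun x => x k 0).
Hypothesis mean : forall k, \int[P]_x x k 0 = mu0 k 0.
Hypothesis cov : forall k l,
  \int[P]_x ((x k 0 - mu0 k 0) * (x l 0 - mu0 l 0)) = Sigma0 k l.
Hypothesis Su : Sigma0 \in unitmx.

Let A0 := invsqrtmx Sigma0.
Let Ahat n om := invsqrtmx (emp_cov Xs n om).
Let muhat n om := emp_mean Xs n om.
Let mphi := @measurable_coords R d.
Let phi_k0 (x : @Rd R d) : coords None x = 1 := erefl.

Let coords2 k : square_integrable P (coords k).
Proof. by case: k => [i|]; [exact: coord2|exact: square_integrable_cst]. Qed.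

Lemma coef_consistent (del : R) : 0 < del -> likely Pr (fun n om => forall u : 'cV[R]_d,
  (forall i, `|u i 0| <= 2) -> forall k,
  `|coef (Ahat n om) (muhat n om) u k - coef A0 mu0 u k| <= del).
Proof.
move=> del0; have [rho rho0 h] := coef_continuous A0 mu0 del0.
have := likely_and (invsqrt_emp_cov_consistent iid coord2 mean cov Su rho0)
  (emp_mean_consistent iid coord2 mean rho0).
by apply: likely_sub => n om [hA hm] u u2 k; exact: h.
Qed.

(** The choices follow one another: [L] from [eta], [k] from [L] and [eps], strips of weight at most
    [K * 4^-1 ^+ k / 8], their width [del], and consistency of the coefficients up to [del / 2]. *)
Lemma plugin_equicontinuity (w : @Rd R d -> R) (eps : R) : square_integrable P w -> 0 < eps ->
  likely Pr (fun n om => forall (u : 'cV[R]_d) c, sqnorm u = 1 ->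
    `|emp_proc P Xs n (fun x => w x * (hs coords (thr (Ahat n om) (muhat n om) u c) x -
       hs coords (thr A0 mu0 u c) x)) om| <= eps).
Proof.
move=> w2 eps0; apply: likely_of_tight => eta eta0.
have [L L1 hL] := equicontinuity iid mphi phi_k0 eta0.
have I0 := integral_sqr_ge0 P w; set I2 := \int[P]_x (w x ^+ 2) in I0.
pose K := 4 * I2 + 1; have K0 : 0 < K by rewrite /K; lra.
have L0 : 0 < L by exact: lt_le_trans L1.
have [k hk] : exists k, 2 * L * Num.sqrt K * (3 / 4) ^+ k <= eps.
  pose D := 2 * L * Num.sqrt K; have D0 : 0 < D by rewrite !mulr_gt0 ?sqrtr_gt0.
  have q1 : `|3 / 4 : R| < 1 by rewrite ger0_norm; lra.
  have [k _ hk] := cvgr_lt 0 (cvg_expr q1) (eps / D) (divr_gt0 eps0 D0).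
  by exists k; rewrite -/D mulrC -ler_pdivlMr //; apply/ltW/hk => /=.
have kap0 : 0 < K * 4^-1 ^+ k / 8 by rewrite divr_gt0 // mulr_gt0 // exprn_gt0.
have A0u : A0 \in unitmx by exact/invsqrtmx_unit/Su/covariance_psd.
have [del del0 [I [S [mS cover]]]] := strip_net mu0 Pac A0u w2 kap0.
have [|i|i|n0 hn] := hL w K k I S w2 K0.
- by rewrite -/I2 /K; lra.
- by case: (mS i).
- by case: (mS i) => _ h; rewrite mulrC -ler_pdivlMr.
have del2 : 0 < del / 2 by rewrite divr_gt0.
exists (fun n om => forall u : 'cV[R]_d, (forall i, `|u i 0| <= 2) -> forall k,
  `|coef (Ahat n om) (muhat n om) u k - coef A0 mu0 u k| <= del / 2).
split; first exact: coef_consistent.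
exists n0 => n n0n; have [Bad mB hB] := hn n n0n; exists Bad => // om nB close u c u1.
have [i Si] := cover u c u1.
apply: le_trans hk; apply: (hB om nB i); apply: in_strip_thr Si => // j; apply: close => l.
by apply: (le_trans (unit_coord u1 l)); lra.
Qed.

(** A small coefficient times a tight process. The bound [M] depends on [eta], so the precision
    [eps / M] of the coefficients is chosen after it. *)
Lemma plugin_negligible (w : @Rd R d -> R) (eps : R) k : square_integrable P w -> 0 < eps ->
  likely Pr (fun n om => forall (u v : 'cV[R]_d) c, (forall i, `|v i 0| <= 2) ->
    `|(coef (Ahat n om) (muhat n om) v k - coef A0 mu0 v k) *
      emp_proc P Xs n (fun x => w x * hs coords (thr (Ahat n om) (muhat n om) u c) x) om| <= eps).
Proof.
move=> w2 eps0; apply: likely_of_tight => eta eta0.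
have [M M0 [n0 hn]] := tight_halfspaces iid mphi phi_k0 w2 eta0.
have eM : 0 < eps / M by rewrite divr_gt0.
exists (fun n om => forall u : 'cV[R]_d, (forall i, `|u i 0| <= 2) -> forall k,
  `|coef (Ahat n om) (muhat n om) u k - coef A0 mu0 u k| <= eps / M).
split; first exact: coef_consistent.
exists n0 => n n0n; have [Bad mB hB] := hn n n0n; exists Bad => // om nB close u v c v2.
rewrite normrM -(divfK (lt0r_neq0 M0) eps); apply: ler_pM => //.
  exact: close.
exact: hB.
Qed.

Definition plugin_error n u v c om (x : @Rd R d) : R :=
  ftheta u v c (Ahat n om) (muhat n om) x - ftheta u v c A0 mu0 x.

Lemma plugin_errorE n u v c om x : plugin_error n u v c om x =
  \sum_k ((coef (Ahat n om) (muhat n om) (v - dot v u *: u) k - coef A0 mu0 (v - dot v u *: u) k) *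
      (coords k x * hs coords (thr (Ahat n om) (muhat n om) u c) x) +
    coef A0 mu0 (v - dot v u *: u) k *
      (coords k x * (hs coords (thr (Ahat n om) (muhat n om) u c) x - hs coords (thr A0 mu0 u c) x))).
Proof.
rewrite /plugin_error !ftheta_coef -sumrB; apply: eq_bigr => k _; ring.
Qed.

Let feat_hs2 k p : square_integrable P (fun x => coords k x * hs coords p x).
Proof.
apply: (square_integrable_le _ (coords2 k)).
  by apply: measurable_funM; [exact: mphi|exact: measurable_hs].
by move=> x; rewrite normrM ler_piMr // ger0_norm; case/andP: (hs_le1 coords p x).
Qed.

(** Licenses the change of variables from [Omega] to [P] in the centring term. *)
Lemma integrable_plugin_error n u v c om :
  P.-integrable setT (EFin \o plugin_error n u v c om).
Proof.
rewrite (funext (plugin_errorE n u v c om)).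
apply: (Rintegral_sum _).1 => k; apply: square_integrable1.
by apply: square_integrableD; apply: square_integrableZ => //; exact: square_integrable_hs.
Qed.

Lemma emp_proc_plugin_error (eps : R) : 0 < eps -> likely Pr (fun n om =>
  forall (u v : 'cV[R]_d) c, sqnorm u = 1 -> sqnorm v = 1 ->
    `|emp_proc P Xs n (plugin_error n u v c om) om| <= eps).
Proof.
move=> eps0; pose N : R := #|{: option 'I_d}|%:R.
have N0 : 0 < N by rewrite ltr0n; apply/card_gt0P; exists None.
(* [C] bounds the limiting coefficients and is positive; [e] shares [eps] among [N] features with
   two terms each. *)
pose C := 2 * entry_sum A0 * (1 + norm1 mu0) + 1.
have C0 : 0 < C by rewrite ltr_wpDl // !mulr_ge0 ?entry_sum_ge0 // addr_ge0 ?norm1_ge0.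
pose e := eps / N / 2; have e0 : 0 < e by rewrite !divr_gt0.
have eC : 0 < e / C by rewrite divr_gt0.
have := likely_and
  (likely_forall (fun k : option 'I_d => plugin_negligible k (coords2 k) e0))
  (likely_forall (fun k : option 'I_d => plugin_equicontinuity (coords2 k) eC)).
apply: likely_sub => n om [h1 h2] u v c u1 v1.
rewrite (funext (plugin_errorE n u v c om)).
rewrite emp_proc_sum => [|k|k]; [|exact: feat_hs2|exact: square_integrable_hs].
apply: (le_trans (ler_norm_sum _ _ _)).
apply: (@le_trans _ _ (\sum_(k : option 'I_d) (e + e))).
  apply: ler_sum => k _; apply: (le_trans (ler_normD _ _)); apply: lerD.
    by apply: h1; exact: unit_reject.
  rewrite normrM -(divfK (lt0r_neq0 C0) e) mulrC; apply: ler_pM => //.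
    exact: h2.
  by apply: (le_trans (coef_bound _ _ _ (unit_reject u1 v1))); rewrite lerDl.
rewrite sumr_const -[_ *+ _]mulr_natl -/N /e -splitr mulrC divfK //.
by rewrite gt_eqF.
Qed.

End Plugin.

(** The exceptional sets are measurable covers of the events under [outer_prob], which is how a
    supremum over uncountably many parameters is handled. *)
Lemma likely_cvg_in_prob {R : realType} {dd} {Omega : measurableType dd}
    (Pr : probability Omega R) (Z : nat -> Omega -> \bar R) :
  (forall eps : R, 0 < eps -> likely Pr (fun n om => (Z n om <= eps%:E)%E)) -> cvg_in_prob_0 Pr Z.
Proof.
move=> hZ eps eps0.
have outer0 n : (0 <= outer_prob Pr [set w | (eps%:E < Z n w)%E])%E.
  by apply: le_ereal_inf_tmp => _ [B _ <-]; exact: measure_ge0.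
have small eta : 0 < eta -> \forall n \near \oo,
    (outer_prob Pr [set w | (eps%:E < Z n w)%E] <= eta%:E)%E.
  move=> eta0; have [n0 hn] := hZ eps eps0 eta eta0; exists n0 => // n /= n0n.
  have [Bad [mB PB] hB] := hn n n0n; apply: le_trans PB.
  apply: ereal_inf_lbound; exists Bad => //; split => // w /= Zw.
  by apply: contrapT => /hB; rewrite leNgt Zw.
apply/fine_cvgP; split.
  near=> n; rewrite ge0_fin_numE //; apply: (@le_lt_trans _ _ 1%E); last exact: ltry.
  by near: n; exact: (small 1).
apply/cvgrPdist_le => eta eta0; near=> n.
rewrite sub0r normrN ger0_norm ?fine_ge0 //.
have h : (outer_prob Pr [set w | (eps%:E < Z n w)%E] <= eta%:E)%E by near: n; exact: small.
rewrite -lee_fin fineK // ge0_fin_numE //; exact: le_lt_trans h (ltry _).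
Unshelve. all: by end_near. Qed.

Theorem theorem3p1 (R : realType) (d : nat) (dd : measure_display)
  (Omega : measurableType dd) (Pr : probability Omega R)
  (X : Omega -> 'cV[R]_d) (Xs : nat -> Omega -> 'cV[R]_d)
  (mu0 : 'cV[R]_d) (Sigma0 : 'M[R]_d) :
  random_vector X ->
  elliptically_symmetric Pr X ->
  abs_continuous Pr X ->
  finite_second_moment Pr X ->
  has_mean Pr X mu0 ->
  has_covariance Pr X mu0 Sigma0 ->
  Sigma0 \in unitmx ->
  iid_copies Pr Xs X ->
  cvg_in_prob_0 Pr (sup_Gn_diff Pr X Xs mu0 Sigma0).
Proof.
move=> rX _ Xac X2 Xmean Xcov Su XsX.
have [P [PE nonneg intE RintE]] := law_of_random_vector Pr rX.
have iid := iid_copies_sequence PE XsX.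
have Pac B : borelRd B -> lebesgue_null B -> P B = 0%E by move=> mB B0; rewrite PE; exact: Xac.
have coord2 k : square_integrable P (fun x => x k 0) by exact: square_integrable_coord nonneg X2.
have mean k : \int[P]_x x k 0 = mu0 k 0.
  have := intE (EFin \o (fun x => x k 0)) (square_integrable1 (coord2 k)).
  by rewrite [LHS]Xmean /Rintegral => <-.
have centered2 k := square_integrableB_cst (mu0 k 0) (coord2 k).
have cov k l : \int[P]_x ((x k 0 - mu0 k 0) * (x l 0 - mu0 l 0)) = Sigma0 k l.
  have := intE _ (square_integrableM (centered2 k) (centered2 l)).
  by rewrite [LHS]Xcov /Rintegral => <-.
apply: likely_cvg_in_prob => eps eps0.
apply: likely_sub (emp_proc_plugin_error iid Pac coord2 mean cov Su eps0) => n om h.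
apply: ge_ereal_sup => _ [[[u v] c] [/= u1 v1] <-]; rewrite lee_fin.
have := h u v c u1 v1; congr (`|_| <= _).
rewrite /Gn_diff /emp_proc; congr (_ * (_ - _)).
by rewrite -(RintE _ (integrable_plugin_error Xs mu0 Sigma0 coord2 n u v c om)).
Qed.
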